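(* Let $T\in\mathfrak{E}_1(H)$, let $F$ be its characteristic line bundle with characteristic function $\mathrm{T}_F(r)$, and let $s$ be a nontrivial holomorphic section of $F$ over $\mathbb{C}$, with zero counting function $N_s(r)$ and proximity function $m_s(r)$. Then $$\mathrm{T}_F(r)=m_s(r)+N_s(r)+O(1),$$ where $O(1)$ is a bounded term in $r$ as $r\to+\infty$.
   Context: Entire operators. $H$ denotes a separable infinite-dimensional complex Hilbert space (inner products are linear in the first variable). A symmetric operator $T$ in $H$ is a linear operator on a subspace $D(T)\subset H$, not necessarily dense, with $(Tx,y)=(x,Ty)$ for all $x,y\in D(T)$; it is always assumed closed. $T$ is simple if it has no nontrivial self-adjoint part as an orthogonal direct summand. On $\mathbb{H}=H\oplus H$ put $[x,y]_c=(x_2,y_1)_H-(x_1,y_2)_H$. Let $A_T\subset\mathbb{H}$ be the graph of $T$, $A_T^{\bot_s}=\{x\in\mathbb{H}: [x,y]_c=0\ \forall y\in A_T\}\supset A_T$, and $\mathcal{B}_T=A_T^{\bot_s}/A_T$ with the induced form $[\cdot,\cdot]_q$. The signature of $-\mathrm{i}[\cdot,\cdot]_q$ is the pair of deficiency indices of $T$, assumed to be $(1,1)$. $T$ is called regular (equivalently: entire) if for every $\lambda\in\mathbb{C}$ there is $c_\lambda>0$ with $\|(T-\lambda)x\|\ge c_\lambda\|x\|$ for all $x\in D(T)$. $\mathfrak{E}_1(H)$ is the set of closed simple symmetric entire operators in $H$ with deficiency indices $(1,1)$. Characteristic line bundle. For $\lambda\in\mathbb{C}$ let $E_\lambda=\{x\in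 H:(x,\lambda x)\in A_T^{\bot_s}\}$, a one-dimensional subspace of $H$; these form a holomorphic line bundle $E\subset\mathbb{C}\times H$. Let $F^\dag_\lambda=E_{\bar\lambda}$ (an anti-holomorphic line bundle), with the norm of $H$, and let $F_\lambda$ be the space of conjugate-linear functionals on $F^\dag_\lambda$ with the dual norm $|\cdot|$. $F$ is a holomorphic Hermitian line bundle over $\mathbb{C}$: a section $s$ is holomorphic iff $\lambda\mapsto\langle s(\lambda),v(\bar\lambda)\rangle$ is holomorphic for every local holomorphic section $v$ of $E$, where $\langle\cdot,\cdot\rangle$ is the pairing of $F$ and $F^\dag$. Growth functions. Let $R=\bar\partial\partial\ln|\sigma|^2$ ($\sigma$ any local holomorphic frame of $F$) be the curvature of the Chern connection of $F$, $c_1(F)=\frac{\mathrm{i}}{2\pi}R$, $\mathbb{D}_t=\{|\lambda|<t\}$, and $\mathrm{T}_F(r)=\int_0^r\frac{dt}{t}\int_{\mathbb{D}_t}c_1(F)$. For a nontrivial holomorphic section $s$ of $F$ let $n_s(r)$ be the number of zeros of $s$ in $\mathbb{D}_r$ counted with multiplicity, $n_s(0)$ the multiplicity of $0$ as a zero of $s$, and $$N_s(r)=\int_0^r\frac{n_s(t)-n_s(0)}{t}dt+n_s(0)\ln r,\qquad m_s(r)=-\frac1{2\pi}\int_0^{2\pi}\ln|s(re^{\mathrm{i}\phi})|\,d\phi .$$ *)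

(* Defs.v *)
From HB Require Import structures.
From mathcomp Require Import all_boot all_order all_algebra sesquilinear.
From mathcomp Require Import complex.
From mathcomp Require Import all_classical all_reals all_analysis.

Set Implicit Arguments.
Unset Strict Implicit.
Unset Printing Implicit Defensive.

Import Order.TTheory GRing.Theory Num.Theory.
Import numFieldNormedType.Exports.

Local Open Scope classical_set_scope.
Local Open Scope ring_scope.
Local Open Scope complex_scope.

(* The complex plane as a normed space over itself: the topology of a
   numFieldType is attached to its regular module. *)
Notation plane R := (R[i]^o).

Section HilbertSpace.
Context {R : realType} {H : completeNormedModType R[i]}.

Definition subspace (V : lmodType R[i]) (A : set V) : Prop :=
  A 0 /\ forall (a : R[i]) (x y : V), A x -> A y -> A (a *: x + y).

Definition separable : Prop :=
  exists D : set H, countable D /\ dense D.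

Definition infinite_dimensional : Prop :=
  ~ exists (n : nat) (b : 'I_n -> H),
      forall x, exists a : 'I_n -> R[i], x = \sum_(i < n) a i *: b i.

(* A {dot H for conj} is positive definite, Hermitian, and linear in its first
   variable. *)
Definition separable_hilbert (ip : {dot H for Num.conj}) : Prop :=
  [/\ forall x : H, `|x| ^+ 2 = ip x x, separable & infinite_dimensional].

Definition orthocomplement (ip : {dot H for Num.conj}) (K : set H) : set H :=
  [set x | forall y, K y -> ip x y = 0].

End HilbertSpace.
Arguments separable {R} H.
Arguments infinite_dimensional {R} H.

(* An operator with domain [dom]; the values of [app] outside of [dom] are
   irrelevant. *)
Record operator (R : realType) (H : completeNormedModType R[i]) := Operator {
  dom : set H;
  app :> H -> H;
  dom_subspace : subspace dom;
  app_linear : forall (a : R[i]) (x y : H), dom x -> dom y ->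
    app (a *: x + y) = a *: app x + app y }.

Section Operators.
Context {R : realType} {H : completeNormedModType R[i]}.
Variables (ip : {dot H for Num.conj}) (T : operator H).

Definition graph : set (H * H) := [set (x, T x) | x in dom T].

Definition closed_operator : Prop := closed graph.

Definition symmetric_operator : Prop :=
  forall x y, dom T x -> dom T y -> ip (T x) y = ip x (T y).

(* [K] reduces [T], and the part of [T] in [K] is a self-adjoint operator in the
   Hilbert space [K]. *)
Definition selfadjoint_summand (K : set H) : Prop :=
  let K' := orthocomplement ip K in
  [/\ subspace K /\ closed K,
      forall x, dom T x -> exists x1 x2,
        [/\ x = x1 + x2, dom T x1 /\ K x1 & dom T x2 /\ K' x2],
      (forall x, dom T x -> K x -> K (T x)) /\
        (forall x, dom T x -> K' x -> K' (T x)),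
      K `<=` closure (dom T `&` K) &
      forall x y, K x -> K y ->
        ((forall u, dom T u -> K u -> ip (T u) x = ip u y)
         <-> (dom T x /\ T x = y))].

Definition simple_operator : Prop :=
  forall K, selfadjoint_summand K -> K = [set 0].

Definition regular_operator : Prop :=
  forall lambda : R[i], exists2 c : R, 0 < c &
    forall x, dom T x -> c%:C * `|x| <= `|T x - lambda *: x|.

Definition bracket (x y : H * H) : R[i] := ip x.2 y.1 - ip x.1 y.2.

Definition graph_perp : set (H * H) :=
  [set x | forall y, graph y -> bracket x y = 0].

(* The form induced by the Hermitian form [Q] on the quotient [W / A], where [A]
   is contained in the radical of the restriction of [Q] to [W], has signature
   [(p, q)]: the classes of the [u i] and [v j] are a basis of [W / A] in which
   the induced form is diagonal with [p] entries 1 and [q] entries -1.  (They are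
   linearly independent modulo [A] because they are pseudo-orthonormal.) *)
Definition quotient_signature (Q : H * H -> H * H -> R[i]) (W A : set (H * H))
    (p q : nat) : Prop :=
  exists (u : 'I_p -> H * H) (v : 'I_q -> H * H),
    [/\ (forall i, W (u i)) /\ (forall j, W (v j)),
        forall i j, Q (u i) (u j) = (i == j)%:R,
        forall i j, Q (v i) (v j) = - (i == j)%:R,
        forall i j, Q (u i) (v j) = 0 &
        forall w, W w -> exists (a : 'I_p -> R[i]) (b : 'I_q -> R[i]),
          A (w - (\sum_(i < p) a i *: u i + \sum_(j < q) b j *: v j))].

Definition deficiency_indices (p q : nat) : Prop :=
  quotient_signature (fun x y => - 'i%C * bracket x y) graph_perp graph p q.

Record entire_operator11 : Prop := {
  entire_closed : closed_operator;
  entire_symmetric : symmetric_operator;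
  entire_simple : simple_operator;
  entire_regular : regular_operator;
  entire_deficiency : deficiency_indices 1 1 }.

End Operators.

Section CharacteristicLineBundle.
Context {R : realType} {H : completeNormedModType R[i]}.
Variables (ip : {dot H for Num.conj}) (T : operator H).
Local Notation C := (plane R).

Definition holomorphic_on (V : normedModType R[i]) (U : set C) (f : C -> V) :
  Prop := forall z, U z -> derivable f z 1.

Definition Efiber (lambda : C) : set H :=
  [set x | graph_perp ip T (x, (lambda : R[i]) *: x)].

Definition Elocal_section (U : set C) (v : C -> H) : Prop :=
  [/\ open U, forall z, U z -> Efiber z (v z) & holomorphic_on U v].

(* F_lambda: a conjugate-linear functional on [Efiber lambda^*] is represented by
   its extension by 0 to [H], so that equality of functionals is equality of the
   representatives. *)
Definition Ffiber (lambda : C) : set (H -> C) :=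
  [set f | (forall (a : R[i]) x y, Efiber lambda^*%C x -> Efiber lambda^*%C y ->
              f (a *: x + y) = a^*%C * f x + f y)
         /\ (forall x, ~ Efiber lambda^*%C x -> f x = 0)].

Definition dual_norm (lambda : C) (f : H -> C) : R :=
  sup [set Normc.normc (f x) | x in
         [set x | Efiber lambda^*%C x /\ `|x| <= 1]].

Definition Fholomorphic_section (W : set C) (s : C -> H -> C) : Prop :=
  [/\ open W,
      forall z, W z -> Ffiber z (s z) &
      forall U v, Elocal_section U v ->
        holomorphic_on [set z : C | W z /\ U z^*%C]
                       (fun z : C => s z (v z^*%C) : C)].

Definition nonvanishing_at (s : C -> H -> C) (z : C) : Prop :=
  exists x, s z x != 0.

Definition Fframe (W : set C) (s : C -> H -> C) : Prop :=
  Fholomorphic_section W s /\ forall z, W z -> nonvanishing_at s z.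

Definition Fframe_near (z : C) (s : C -> H -> C) : Prop :=
  exists2 W : set C, W z & Fframe W s.

(* Derivative of [f] at [z] in the real direction [d], real and imaginary parts
   being differentiated separately. *)
Definition real_directional (d : C) (f : C -> C) (z : C) : C :=
  (derive1 (fun t : R => complex.Re (f (z + t%:C * d))) 0) +i*
  (derive1 (fun t : R => complex.Im (f (z + t%:C * d))) 0).

Definition wirtinger (f : C -> C) (z : C) : C :=
  (real_directional 1 f z - 'i%C * real_directional 'i%C f z) / 2%:R.

Definition wirtinger_bar (f : C -> C) (z : C) : C :=
  (real_directional 1 f z + 'i%C * real_directional 'i%C f z) / 2%:R.

(* The coefficient of dzbar /\ dz in the curvature form
   dbar d ln |sigma|^2, where sigma is a chosen holomorphic frame near [z];
   the value does not depend on the choice. *)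
Definition curvature (z : C) : C :=
  let sigma := xget (fun _ _ => 0) (Fframe_near z) in
  wirtinger_bar
    (wirtinger (fun w : C => (ln (dual_norm w (sigma w) ^+ 2))%:C)) z.

(* The density of c_1(F) = (i / 2 pi) R with respect to dx /\ dy, using
   dzbar /\ dz = 2 i dx /\ dy.  It is real valued. *)
Definition c1_density (z : C) : R :=
  complex.Re ('i%C / (2%:R * pi)%:C * curvature z * (2%:R * 'i%C)).

Definition disk (t : R) : set C := [set z | Normc.normc z < t].

Local Notation mu := (@lebesgue_measure R).

Definition c1_disk (t : R) : R :=
  \int[(mu \x mu)%E]_(p in [set p : R * R | disk t (p.1 +i* p.2)])
    c1_density (p.1 +i* p.2).

Definition characteristic_function (r : R) : R :=
  \int[mu]_(t in `]0, r]) (c1_disk t / t).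

Definition vanishing_order (s : C -> H -> C) (z0 : C) (k : nat) : Prop :=
  exists W sigma, [/\ W z0, Fframe W sigma &
    forall z x, W z -> s z x = (z - z0) ^+ k * sigma z x].

Definition multiplicity (s : C -> H -> C) (z0 : C) : nat :=
  xget 0%N (vanishing_order s z0).

(* The index set of the nonzero terms is finite for a nontrivial holomorphic
   section. *)
Definition zero_count (s : C -> H -> C) (t : R) : R :=
  \sum_(z \in disk t) ((multiplicity s z)%:R : R).

Definition counting_function (s : C -> H -> C) (r : R) : R :=
  let n0 : R := (multiplicity s 0)%:R in
  \int[mu]_(t in `]0, r]) ((zero_count s t - n0) / t) + n0 * ln r.

Definition proximity_function (s : C -> H -> C) (r : R) : R :=
  - ((2%:R * pi)^-1 *
     \int[mu]_(phi in `[0, 2%:R * pi])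
       let z : C := (r * cos phi) +i* (r * sin phi) in ln (dual_norm z (s z))).

End CharacteristicLineBundle.

(* Main.v *)
(* Fix l0 and let M be the range of T - conj l0, which is closed because T is
   closed and regular.  Riesz representation of z |-> (x, (T - conj l0)^-1 z) on M
   gives a bounded operator K such that x lies in E_l iff x - (l - l0) K x lies in
   E_l0; hence (1 - (l - l0) K)^-1 carries E_l0 to E_l, which gives holomorphic
   frames of E.  That E_l has dimension at most 1 comes from the signature (1,1),
   and E_l <> 0 propagates over the plane by connectedness.

   If v is such a frame, |s(z)| = |f(z)| / |v(conj z)| with f = <s, v> holomorphic,
   so the curvature of F is the Laplacian of ln |v(conj z)|^2, up to a factor.
   Dividing s by the product of the (z - a)^(m_a) over its zeros a in the closed
   disk of radius r gives a section sigma without zeros near that disk.  The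
   divergence theorem on disks (Jensen's formula for smooth functions) gives
   T_F(r) = ln |sigma(0)| - mean of ln |sigma| on the circle.  Since the mean of
   ln |z - a| over the circle is ln max(r, |a|), the zeros contribute N_s(r) to
   m_s(r), and T_F - m_s - N_s is the constant ln |(s / z^(n0))(0)|. *)

(* The identity is exact for every [r > 0], so circles through zeros of [s] cannot be avoided. All
   zeros in the closed disk are divided out, boundary included, and the mean of [ln |z - a|] is
   needed for [|a| = r] too, where the integrand is singular and [ln 0 = 0] is only a default;
   equalities there hold for almost every angle. [curvature] and [multiplicity] are defined by a
   choice. Two frames near a point differ by a zero-free holomorphic factor [F], and [ln |F|^2] is
   harmonic, so the Laplacian at a point is the same for every [adapted] function. Frames can thus
   be exchanged freely, and the divided section enters only through [reduced_log], the logarithm of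
   its squared norm. Nontriviality of the fibres starts from [s]: a point where [s] does not vanish
   yields a nonzero vector in some [E_l]. Cauchy's theorem is proved by Goursat's bisection for
   images of rectangles under [a + phi x * gam y], which shrink a circle towards an arbitrary point
   inside it. This gives off-centre Cauchy formulas without winding numbers, and from them
   derivatives and orders of zeros. *)
From HB Require Import structures.
From mathcomp Require Import all_boot all_order all_algebra sesquilinear.
From mathcomp Require Import complex.
From mathcomp Require Import all_classical all_reals all_analysis.
From mathcomp Require Import measurable_realfun ring lra.
Require Import Defs.
Set Implicit Arguments.
Unset Strict Implicit.
Unset Printing Implicit Defensive.
Import Order.TTheory GRing.Theory Num.Theory.
Import numFieldNormedType.Exports.
Local Open Scope classical_set_scope.
Local Open Scope ring_scope.
Local Open Scope complex_scope.

(** * The complex plane *)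

Section Plane.
Context {R : realType}.
Local Notation C := (plane R).
Local Notation nc := (@Normc.normc R).
Implicit Types (z w : C) (e : R).

Lemma normCE (z : C) : `|z| = (nc z)%:C.
Proof. by []. Qed.

(** The order of [R[i]] relates only numbers with equal imaginary parts, so a positive element is a
    positive real. This lets every complex epsilon of the normed structure be traded for a real
    one. *)
Lemma ltcR_re (e : R[i]) : 0 < e -> e = (complex.Re e)%:C /\ 0 < complex.Re e.
Proof. by case: e => a b; rewrite ltcE /= => /andP[/eqP ->]. Qed.

Lemma cvgC (T : Type) (F : set_system T) (FF : Filter F) (f : T -> C) (l : C) :
  (f x @[x --> F] --> l) <->
  (forall e : R, 0 < e -> \forall x \near F, nc (l - f x) < e).
Proof.
split=> [/cvgrPdist_lt h e e0|h].
  have := h e%:C; rewrite ltcR => /(_ e0); apply: filterS => x.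
  by rewrite normCE ltcR.
apply/cvgrPdist_lt => e /ltcR_re[-> e0].
by apply: filterS (h _ e0) => x; rewrite normCE ltcR.
Qed.

Lemma nbhsC (z : C) (A : set C) :
  nbhs z A <-> exists2 e : R, 0 < e & forall w, nc (w - z) < e -> A w.
Proof.
split.
  move=> /nbhs_ballP[e /= /ltcR_re[-> e0] h]; exists (complex.Re e) => // w hw.
  by apply: h; rewrite -ball_normE /ball_ /= normCE ltcR -normcN opprB.
move=> [e e0 h]; apply/nbhs_ballP; exists e%:C; first by rewrite /= ltcR.
move=> w; rewrite -ball_normE /ball_ /= normCE ltcR -normcN opprB; exact: h.
Qed.

Lemma nc_ge0 z : 0 <= nc z.
Proof. by case: z => a b; exact: sqrtr_ge0. Qed.

Lemma nc_Re z : `|complex.Re z| <= nc z.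
Proof. by rewrite -lecR -normCE normc_ge_Re. Qed.

Lemma nc_Im z : `|complex.Im z| <= nc z.
Proof.
rewrite -[complex.Im z]opprK -ReiNIm normrN (le_trans (nc_Re _))// Normc.normcM.
suff -> : nc 'i%C = 1 by rewrite mulr1.
by rewrite /Normc.normc /= expr0n add0r expr1n sqrtr1.
Qed.

Lemma nc_le z : nc z <= `|complex.Re z| + `|complex.Im z|.
Proof.
case: z => a b; rewrite /= -[leRHS]ger0_norm ?addr_ge0// -sqrtr_sqr.
rewrite ler_wsqrtr// sqrrD !real_normK ?num_real//.
by rewrite addrAC lerDl mulrn_wge0// mulr_ge0.
Qed.

Lemma nc_sqr z : nc z ^+ 2 = complex.Re z ^+ 2 + complex.Im z ^+ 2.
Proof. by case: z => a b; rewrite /= sqr_sqrtr// addr_ge0 ?sqr_ge0. Qed.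

Lemma ncR (x : R) : nc x%:C = `|x|.
Proof. by rewrite /= expr0n addr0 sqrtr_sqr. Qed.

Lemma ncD z w : nc (z + w) <= nc z + nc w.
Proof. exact: le_normcD. Qed.

Lemma ncN z : nc (- z) = nc z.
Proof. exact: normcN. Qed.

Lemma ncB z w : nc (z - w) = nc (w - z).
Proof. by rewrite -ncN opprB. Qed.

Lemma nc_eq0 z : (nc z == 0) = (z == 0).
Proof. by apply/eqP/eqP => [/Normc.eq0_normc//|->]; rewrite Normc.normc0. Qed.

Lemma nc_gt0 z : (0 < nc z) = (z != 0).
Proof. by rewrite lt_def nc_ge0 andbT nc_eq0. Qed.

Lemma ncJ z : nc z^*%C = nc z.
Proof. by case: z => a b; rewrite /= sqrrN. Qed.

Lemma ncX z n : nc (z ^+ n) = nc z ^+ n.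
Proof.
elim: n => [|n ih]; first by rewrite !expr0 Normc.normc1.
by rewrite !exprS Normc.normcM ih.
Qed.

Lemma ncB_ge z w : nc z - nc w <= nc (z - w).
Proof. by rewrite lerBlDr -{1}(subrK w z) ncD. Qed.

Lemma cvgC_ReIm (T : Type) (F : set_system T) (FF : Filter F) (f : T -> C) (l : C) :
  (f x @[x --> F] --> l) <->
  (complex.Re (f x) @[x --> F] --> complex.Re l) /\
  (complex.Im (f x) @[x --> F] --> complex.Im l).
Proof.
split.
  move=> /cvgC h; split; apply/cvgrPdist_lt => e /h; apply: filterS => x.
    by apply: le_lt_trans; rewrite -raddfB; exact: nc_Re.
  by apply: le_lt_trans; rewrite -raddfB; exact: nc_Im.
move=> [/cvgrPdist_lt h1 /cvgrPdist_lt h2]; apply/cvgC => e e0.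
have e2 : 0 < e / 2 by rewrite divr_gt0.
apply: filterS2 (h1 _ e2) (h2 _ e2) => x xa xb.
rewrite (le_lt_trans (nc_le _))// (splitr e) !raddfB/=; exact: ltrD.
Qed.

Lemma continuousC (T : topologicalType) (f : T -> C) (x : T) :
  {for x, continuous f} <->
  {for x, continuous (@complex.Re R \o f)} /\ {for x, continuous (@complex.Im R \o f)}.
Proof. exact: cvgC_ReIm. Qed.

Lemma continuous_Re : continuous (@complex.Re R : C -> R).
Proof. by move=> z; exact: (proj1 (proj1 (cvgC_ReIm _ id z) (fun=> id))). Qed.

Lemma continuous_Im : continuous (@complex.Im R : C -> R).
Proof. by move=> z; exact: (proj2 (proj1 (cvgC_ReIm _ id z) (fun=> id))). Qed.

Lemma cvgJ (T : Type) (F : set_system T) (FF : Filter F) (f : T -> C) (l : C) :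
  f x @[x --> F] --> l -> ((f x)^*%C : C) @[x --> F] --> (l^*%C : C).
Proof.
by move=> /cvgC h; apply/cvgC => e /h; apply: filterS => x; rewrite -raddfB /= ncJ.
Qed.

Lemma continuousJ : continuous (fun z : C => z^*%C : C).
Proof. by move=> z; apply: (@cvgJ _ (nbhs z) _ id z) => A. Qed.

Lemma cvgRC (T : Type) (F : set_system T) (FF : Filter F) (f : T -> R) (l : R) :
  f x @[x --> F] --> l -> ((f x)%:C : C) @[x --> F] --> (l%:C : C).
Proof. by move=> h; apply/cvgC_ReIm; split => //=; exact: cvg_cst. Qed.

Lemma continuous_pair (p : R * R) :
  {for p, continuous (fun p : R * R => (p.1 +i* p.2 : C))}.
Proof. by apply/continuousC; split => /=; [exact: cvg_fst|exact: cvg_snd]. Qed.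

Lemma nc_continuous : continuous (nc : C -> R).
Proof.
move=> z; apply/(@cvgrPdist_lt _ R^o C (nbhs z)) => e e0; near=> w.
have : nc (z - w) < e by near: w; exact: (proj1 (cvgC _ id z) (fun=> id)).
by apply: le_lt_trans; rewrite ler_norml ncB_ge andbT lerNl opprB ncB ncB_ge.
Unshelve. all: by end_near. Qed.

End Plane.

(** * Integrals on an interval *)

Section RealIntegral.
Context {R : realType}.
Local Notation mu := (@lebesgue_measure R).
Implicit Types (f g : R -> R) (a b c : R).

(** Integrands are mostly continuous on the whole line, so that integrability on a segment comes for
    free. *)
Definition RI a b f : R := \int[mu]_(x in `[a, b]) f x.

Lemma RI_integrable a b f : continuous f -> mu.-integrable `[a, b] (EFin \o f).
Proof.
move=> cf; apply: continuous_compact_integrable; first exact: segment_compact.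
exact: continuous_subspaceT.
Qed.

Lemma eq_RI a b f g : {in `[a, b], f =1 g} -> RI a b f = RI a b g.
Proof. by move=> fg; apply: eq_Rintegral => x; rewrite inE; apply: fg. Qed.

Lemma RI_add a b f g : continuous f -> continuous g ->
  RI a b (fun x => f x + g x) = RI a b f + RI a b g.
Proof. by move=> cf cg; apply: RintegralD => //; exact: RI_integrable. Qed.

Lemma RI_sub a b f g : continuous f -> continuous g ->
  RI a b (fun x => f x - g x) = RI a b f - RI a b g.
Proof. by move=> cf cg; apply: RintegralB => //; exact: RI_integrable. Qed.

Lemma RI_scale a b k f : continuous f ->
  RI a b (fun x => k * f x) = k * RI a b f.
Proof. by move=> cf; apply: RintegralZl => //; exact: RI_integrable. Qed.

Lemma RI_cst a b k : a <= b -> RI a b (fun=> k) = k * (b - a).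
Proof.
move=> ab; rewrite /RI Rintegral_cst//.
rewrite /= lebesgue_measure_itv/= lte_fin.
case: ltP => //= ba; have -> : a = b by apply: le_anti; rewrite ab.
by rewrite subrr.
Qed.

Lemma RI_split a b c f : a <= c -> c <= b -> continuous f ->
  RI a b f = RI a c f + RI c b f.
Proof.
move=> ac cb cf; rewrite /RI.
have fab : mu.-integrable `[a, b] (EFin \o f) by exact: RI_integrable.
have := @Rintegral_itvB R f (BLeft a) (BRight b) c fab.
rewrite !bnd_simp => /(_ ac cb) /eqP; rewrite subr_eq addrC => /eqP ->.
congr (_ + _); rewrite Rintegral_itv_obnd_cbnd//.
apply: integrableS fab => //; apply: subset_itvr; rewrite bnd_simp//.
Qed.

Lemma RI_bound a b f M : a <= b -> continuous f ->
  (forall x, a <= x <= b -> `|f x| <= M) -> `|RI a b f| <= M * (b - a).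
Proof.
move=> ab cf fM; rewrite (le_trans (le_normr_Rintegral _ (RI_integrable _ _ cf)))//.
rewrite -(RI_cst M ab); apply: le_Rintegral => //.
- apply: (@RI_integrable a b (fun x => `|f x|)) => x.
  by apply: cvg_norm; exact: cf.
- exact: RI_integrable (@cst_continuous _ _ _).
Qed.

Lemma RI_FTC a b F f : a <= b -> continuous f ->
  (forall x : R, is_derive x 1 F (f x)) -> RI a b f = F b - F a.
Proof.
rewrite le_eqVlt => /predU1P[<- cf _|ab cf Ff].
  by rewrite /RI set_itv1 Rintegral_set1 subrr.
have cF : continuous F.
  by move=> x; apply: differentiable_continuous; apply/derivable1_diffP; case: (Ff x).
rewrite /RI /Rintegral (@continuous_FTC2 _ f F)//.
- exact: continuous_subspaceT.
- split=> [x _||]; first by case: (Ff x).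
  + exact/cvg_at_right_filter/cF.
  + exact/cvg_at_left_filter/cF.
- by move=> x _; rewrite derive1E; case: (Ff x).
Qed.

End RealIntegral.

Section ComplexIntegral.
Context {R : realType}.
Local Notation C := (plane R).
Local Notation nc := (@Normc.normc R).
Local Notation Re := (@complex.Re R).
Local Notation Im := (@complex.Im R).
Implicit Types (f g : R -> C) (a b c : R).

Definition CI a b f : C := RI a b (Re \o f) +i* RI a b (Im \o f).

Lemma contRe f : continuous f -> continuous (Re \o f).
Proof. by move=> cf x; have /continuousC[] := cf x. Qed.

Lemma contIm f : continuous f -> continuous (Im \o f).
Proof. by move=> cf x; have /continuousC[] := cf x. Qed.

Lemma eq_CI a b f g : {in `[a, b], f =1 g} -> CI a b f = CI a b g.
Proof. by move=> fg; congr (_ +i* _); apply: eq_RI => x /fg /= ->. Qed.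

Lemma CI_add a b f g : continuous f -> continuous g ->
  CI a b (fun x => f x + g x) = CI a b f + CI a b g.
Proof.
move=> cf cg; rewrite /CI.
have -> : Re \o (fun x => f x + g x) = (fun x => (Re \o f) x + (Re \o g) x).
  by apply/funext => x /=; rewrite raddfD.
have -> : Im \o (fun x => f x + g x) = (fun x => (Im \o f) x + (Im \o g) x).
  by apply/funext => x /=; rewrite raddfD.
by rewrite !RI_add//; [exact: contIm|exact: contIm|exact: contRe|exact: contRe].
Qed.

Lemma CI_scale a b (k : C) f : continuous f ->
  CI a b (fun x => k * f x) = k * CI a b f.
Proof.
move=> cf; rewrite /CI.
have cRe := contRe cf; have cIm := contIm cf.
have cs (u : R -> R) (m : R) : continuous u -> continuous (fun x => m * u x).
  by move=> cu x; apply: cvgM; [exact: cvg_cst|exact: cu].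
case: k => k1 k2.
have -> : Re \o (fun x => (k1 +i* k2 : C) * f x) =
    (fun x => k1 * (Re \o f) x - k2 * (Im \o f) x).
  by apply/funext => x /=; case: (f x).
have -> : Im \o (fun x => (k1 +i* k2 : C) * f x) =
    (fun x => k1 * (Im \o f) x + k2 * (Re \o f) x).
  by apply/funext => x /=; case: (f x) => ? ?.
by rewrite RI_sub ?RI_add ?RI_scale//; exact: cs.
Qed.

Lemma CI_opp a b f : continuous f -> CI a b (fun x => - f x) = - CI a b f.
Proof.
move=> cf; rewrite -[RHS]mulN1r -CI_scale//.
by apply: eq_CI => x _; rewrite mulN1r.
Qed.

Lemma CI_sub a b f g : continuous f -> continuous g ->
  CI a b (fun x => f x - g x) = CI a b f - CI a b g.
Proof.
move=> cf cg; have cN : continuous (fun x => - g x : C).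
  by move=> x; exact: (cvgN (cg x)).
by have := CI_add a b cf cN; rewrite CI_opp.
Qed.

Lemma CI_cst a b (k : C) : a <= b -> CI a b (fun=> k) = k * (b - a)%:C.
Proof.
move=> ab; rewrite /CI !RI_cst//; case: k => k1 k2 /=.
by apply/eqP; rewrite eq_complex/= !mulr0 subr0 add0r !eqxx.
Qed.

Lemma CI_split a b c f : a <= c -> c <= b -> continuous f ->
  CI a b f = CI a c f + CI c b f.
Proof.
move=> ac cb cf; rewrite /CI.
by rewrite !(RI_split ac cb); [|exact: contIm|exact: contRe].
Qed.

(** The factor 2 comes from estimating the real and imaginary parts separately; every use tolerates
    a constant factor. *)
Lemma CI_bound a b f M : a <= b -> continuous f ->
  (forall x, a <= x <= b -> nc (f x) <= M) -> nc (CI a b f) <= 2 * M * (b - a).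
Proof.
move=> ab cf fM; rewrite (le_trans (nc_le _))// -mulrA mulr_natl mulr2n lerD//.
- apply: RI_bound => //; first exact: contRe.
  by move=> x /fM; apply: le_trans; exact: nc_Re.
- apply: RI_bound => //; first exact: contIm.
  by move=> x /fM; apply: le_trans; exact: nc_Im.
Qed.

Definition is_cderive (x : R) (f : R -> C) (d : C) :=
  is_derive x 1 (Re \o f) (Re d) /\ is_derive x 1 (Im \o f) (Im d).

Lemma CI_FTC a b f g : a <= b -> continuous g ->
  (forall x, is_cderive x f (g x)) -> CI a b g = f b - f a.
Proof.
move=> ab cg fg; rewrite /CI.
have -> : RI a b (Re \o g) = Re (f b) - Re (f a).
  apply: (@RI_FTC _ a b (Re \o f)) => //; first exact: contRe.
  by move=> x; have [] := fg x.
have -> : RI a b (Im \o g) = Im (f b) - Im (f a).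
  apply: (@RI_FTC _ a b (Im \o f)) => //; first exact: contIm.
  by move=> x; have [] := fg x.
by case: (f b); case: (f a).
Qed.

Lemma CI_J a b f : continuous f ->
  CI a b (fun x => (f x)^*%C) = (CI a b f)^*%C.
Proof.
move=> cf; rewrite /CI /=; congr (_ +i* _).
  by apply: eq_RI => x _ /=; case: (f x).
rewrite -mulN1r -RI_scale; last exact: contIm.
by apply: eq_RI => x _ /=; rewrite mulN1r; case: (f x).
Qed.

End ComplexIntegral.

(** * Cauchy's formula *)

Section Goursat.
Context {R : realType}.

(** The segments [[u n, u n + A / 2 ^ n]] are nested; the supremum of their left ends lies in all of
    them. *)
Lemma nested_limit (u : R^nat) (A : R) : 0 <= A ->
  (forall n, u n <= u n.+1 <= u n + A / 2 ^+ n.+1) ->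
  exists x, forall n, u n <= x <= u n + A / 2 ^+ n.
Proof.
move=> A0 hu.
have nd n m : (n <= m)%N -> u n <= u m.
  move=> /subnKC <-; elim: (m - n)%N => [|k ih]; first by rewrite addn0.
  by rewrite addnS (le_trans ih)//; have /andP[] := hu (n + k)%N.
have ni n m : (n <= m)%N -> u m + A / 2 ^+ m <= u n + A / 2 ^+ n.
  move=> /subnKC <-; elim: (m - n)%N => [|k ih]; first by rewrite addn0.
  rewrite addnS (le_trans _ ih)//; have /andP[_] := hu (n + k)%N.
  move=> /(lerD (lexx (A / 2 ^+ (n + k).+1))); rewrite addrC => /le_trans; apply.
  rewrite addrCA lerD2l exprS invfM (mulrC 2^-1) mulrA -splitr lexx//.
have ub n m : u m <= u n + A / 2 ^+ n.
  rewrite (le_trans (nd _ _ (leq_maxr n m)))//.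
  by rewrite (le_trans _ (ni _ _ (leq_maxl n m)))// lerDl divr_ge0// exprn_ge0.
exists (sup (range u)) => n; apply/andP; split.
  apply: ub_le_sup; last by exists n.
  by exists (u 0%N + A / 2 ^+ 0) => _ [m _ <-]; exact: ub.
apply: ge_sup; first by exists (u 0%N), 0%N.
by move=> _ [m _ <-]; exact: ub.
Qed.

(* A nonnegative subadditive function of rectangles [[x, x + A l] x [y, y + B l]]
   that is [o(l ^ 2)] at every point vanishes. *)
Lemma bisection (N : R -> R -> R -> R) (A B x0 y0 : R) : 0 <= A -> 0 <= B ->
  (forall x y l, 0 < l -> N x y l <= N x y (l / 2) + N (x + A * (l / 2)) y (l / 2)
     + (N x (y + B * (l / 2)) (l / 2)
        + N (x + A * (l / 2)) (y + B * (l / 2)) (l / 2))) ->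
  (forall x y e, 0 < e -> exists2 d, 0 < d & forall x' y' l, 0 < l < d ->
     x' <= x <= x' + A * l -> y' <= y <= y' + B * l -> N x' y' l <= e * l ^+ 2) ->
  N x0 y0 1 <= 0.
Proof.
move=> A0 B0 sub small; rewrite leNgt; apply/negP => N0.
pose c := N x0 y0 1.
(* By subadditivity one of the four quarters carries at least a quarter of [N]. *)
have step (p : R * R) l : 0 < l -> exists q : R * R,
    [/\ p.1 <= q.1 <= p.1 + A * (l / 2), p.2 <= q.2 <= p.2 + B * (l / 2) &
       N p.1 p.2 l / 4 <= N q.1 q.2 (l / 2)].
  move=> l0; have := sub p.1 p.2 l l0.
  have Al : 0 <= A * (l / 2) by rewrite mulr_ge0// divr_ge0// ltW.
  have Bl : 0 <= B * (l / 2) by rewrite mulr_ge0// divr_ge0// ltW.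
  case: (leP (N p.1 p.2 l / 4) (N p.1 p.2 (l / 2))) => [h _|h1].
    by exists (p.1, p.2); rewrite /= !lexx !lerDl Al Bl.
  case: (leP (N p.1 p.2 l / 4) (N (p.1 + A * (l / 2)) p.2 (l / 2))) => [h _|h2].
    by exists (p.1 + A * (l / 2), p.2); rewrite /= !lexx !lerDl Al Bl.
  case: (leP (N p.1 p.2 l / 4) (N p.1 (p.2 + B * (l / 2)) (l / 2))) => [h _|h3].
    by exists (p.1, p.2 + B * (l / 2)); rewrite /= !lexx !lerDl Al Bl.
  move=> h; exists (p.1 + A * (l / 2), p.2 + B * (l / 2)).
  by rewrite /= !lexx !lerDl Al Bl; split => //; lra.
(* [step] asks for a proof that the side length is positive; the second branch is never taken. *)
pose F (n : nat) (p : R * R) : R * R :=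
  match pselect (0 < (2 ^+ n)^-1 :> R) with
  | left h => projT1 (cid (step p _ h)) | right _ => p end.
pose q := fix q n : R * R := if n is m.+1 then F m (q m) else (x0, y0).
have qS n : [/\ (q n).1 <= (q n.+1).1 <= (q n).1 + A / 2 ^+ n.+1,
    (q n).2 <= (q n.+1).2 <= (q n).2 + B / 2 ^+ n.+1 &
    N (q n).1 (q n).2 (2 ^+ n)^-1 / 4 <= N (q n.+1).1 (q n.+1).2 (2 ^+ n.+1)^-1].
  rewrite /= /F; case: pselect => [h|]; last by rewrite invr_gt0 exprn_gt0.
  case: cid => r /= [h1 h2 h3].
  by rewrite exprSr invfM.
have [x hx] : exists x, forall n, (q n).1 <= x <= (q n).1 + A / 2 ^+ n.
  by apply: (@nested_limit (fun n => (q n).1)) => // n; have [] := qS n.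
have [y hy] : exists y, forall n, (q n).2 <= y <= (q n).2 + B / 2 ^+ n.
  by apply: (@nested_limit (fun n => (q n).2)) => // n; have [] := qS n.
have lower n : c / 4 ^+ n <= N (q n).1 (q n).2 (2 ^+ n)^-1.
  elim: n => [|n ih]; first by rewrite expr0 !invr1 mulr1.
  have [_ _] := qS n; apply: le_trans.
  by rewrite exprSr invfM mulrA ler_pM2r.
(* Along the chosen quarters [N] is at least [c l ^ 2] with [l = 2 ^ - n], which contradicts the
   bound [c / 2 * l ^ 2] near the limit point. *)
have [d d0 hd] := small x y (c / 2) (divr_gt0 N0 (ltr0Sn _ 1)).
have [n hn] : exists n, (2 ^+ n)^-1 < d.
  have := @cvg_geometric R 1 (2^-1); rewrite ger0_norm ?invr_ge0//.
  rewrite invf_lt1 ?ltr1n// => /(_ isT) /cvgrPdist_lt /(_ _ d0) [n _ /(_ n (leqnn n))].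
  rewrite /geometric /= sub0r normrN mul1r exprVn ger0_norm ?invr_ge0 ?exprn_ge0//.
  by exists n.
have := hd (q n).1 (q n).2 (2 ^+ n)^-1.
rewrite invr_gt0 exprn_gt0// hn => /(_ isT (hx n) (hy n)).
move=> /(le_trans (lower n)).
have -> : c / 2 * (2 ^+ n)^-1 ^+ 2 = (c / 4 ^+ n) / 2.
  have -> : (4 : R) = 2 * 2 by rewrite -natrM.
  by rewrite exprMn; field; rewrite expf_neq0.
have : 0 < c / 4 ^+ n by rewrite divr_gt0// exprn_gt0.
lra.
Qed.

Local Notation C := (plane R).
Local Notation Re := (@complex.Re R).
Local Notation Im := (@complex.Im R).

Lemma is_cderiveM (x : R) (f g : R -> C) (df dg : C) :
  is_cderive x f df -> is_cderive x g dg ->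
  is_cderive x (fun t => f t * g t) (df * g x + f x * dg).
Proof.
move=> [f1 f2] [g1 g2]; split.
- have -> : Re \o (fun t => f t * g t) = (Re \o f) * (Re \o g) - (Im \o f) * (Im \o g).
    by apply/funext => t /=; rewrite !fctE /=; case: (f t) => ? ?; case: (g t).
  apply: is_derive_eq; rewrite /=.
  by case: (f x) => ? ?; case: (g x) => ? ?; case: (df) => ? ?; case: (dg) => ? ?;
    rewrite /GRing.scale /=; ring.
- have -> : Im \o (fun t => f t * g t) = (Re \o f) * (Im \o g) + (Im \o f) * (Re \o g).
    by apply/funext => t /=; rewrite !fctE /=; case: (f t) => ? ?; case: (g t).
  apply: is_derive_eq; rewrite /=.
  by case: (f x) => ? ?; case: (g x) => ? ?; case: (df) => ? ?; case: (dg) => ? ?;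
    rewrite /GRing.scale /=; ring.
Qed.

Lemma is_cderiveD (x : R) (f g : R -> C) (df dg : C) :
  is_cderive x f df -> is_cderive x g dg ->
  is_cderive x (fun t => f t + g t) (df + dg).
Proof.
move=> [f1 f2] [g1 g2]; split.
- have -> : Re \o (fun t => f t + g t) = (Re \o f) + (Re \o g).
    by apply/funext => t /=; rewrite !fctE /= raddfD.
  by rewrite raddfD; exact: is_deriveD.
- have -> : Im \o (fun t => f t + g t) = (Im \o f) + (Im \o g).
    by apply/funext => t /=; rewrite !fctE /= raddfD.
  by rewrite raddfD; exact: is_deriveD.
Qed.

Lemma is_cderive_cst (x : R) (k : C) : is_cderive x (fun=> k) 0.
Proof. by split => /=; exact: is_derive_cst. Qed.

Lemma is_cderive_real (x : R) (f : R -> R) (df : R) :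
  is_derive x 1 f df -> is_cderive x (fun t => (f t)%:C) df%:C.
Proof. by move=> fd; split => //=; exact: is_derive_cst. Qed.

Lemma is_cderive_cont (f df : R -> C) :
  (forall x, is_cderive x f (df x)) -> continuous f.
Proof.
move=> fd x; have [[d1 _] [d2 _]] := fd x; apply/continuousC; split.
- exact/differentiable_continuous/derivable1_diffP.
- exact/differentiable_continuous/derivable1_diffP.
Qed.

Lemma continuousMC (f g : R -> C) : continuous f -> continuous g ->
  continuous (fun t => f t * g t : C).
Proof. by move=> cf cg x; exact: (cvgM (cf x) (cg x)). Qed.

Lemma continuousDC (f g : R -> C) : continuous f -> continuous g ->
  continuous (fun t => f t + g t : C).
Proof. by move=> cf cg x; exact: (cvgD (cf x) (cg x)). Qed.

Lemma continuous_cstC (k : C) : continuous (fun _ : R => k).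
Proof. exact: cst_continuous. Qed.

(** The contour integral of [G] along [W]; the derivative [W'] is an argument, so that paths can be
    given with explicit derivatives. *)
Definition PI (G : C -> C) (W W' : R -> C) (s t : R) : C :=
  CI s t (fun x => G (W x) * W' x).

(** [c0 z + l0 z ^ 2 / 2] is a primitive, so only the end points matter. Around a closed contour the
    affine part of a function contributes nothing. *)
Lemma PI_affine (c0 l0 : C) (W W' : R -> C) s t : s <= t ->
  (forall x, is_cderive x W (W' x)) -> continuous W' ->
  PI (fun z => c0 + l0 * z) W W' s t =
  (c0 * W t + l0 / 2 * (W t * W t)) - (c0 * W s + l0 / 2 * (W s * W s)).
Proof.
move=> st hW cW'; have cW := is_cderive_cont hW.
have H := @CI_FTC R s t (fun x => c0 * W x + l0 / 2 * (W x * W x))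
  (fun x => (c0 + l0 * W x) * W' x) st.
apply: H.
  apply: continuousMC cW'; apply: continuousDC; first exact: continuous_cstC.
  by apply: continuousMC cW; exact: continuous_cstC.
move=> x.
have := is_cderiveD (is_cderiveM (is_cderive_cst x c0) (hW x))
  (is_cderiveM (is_cderive_cst x (l0 / 2)) (is_cderiveM (hW x) (hW x))).
by congr is_cderive; field.
Qed.

End Goursat.

Section GoursatRect.
Context {R : realType}.
Local Notation C := (plane R).
Local Notation nc := (@Normc.normc R).

(** Differentiability as a first-order expansion without quotients, the form in which Goursat's
    argument uses it; [cdiff_atP] is the link with [is_derive]. *)
Definition cdiff_at (F : C -> C) (w l : C) := forall e : R, 0 < e ->
  exists2 d : R, 0 < d & forall z, nc (z - w) < d ->
    nc (F z - F w - l * (z - w)) <= e * nc (z - w).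

Lemma cdiff_at_cont F w l : cdiff_at F w l -> {for w, continuous F}.
Proof.
move=> /(_ 1 ltr01) [d d0 h]; apply/(@cvgC R _ (nbhs w)) => e e0.
apply/nbhsC; exists (Num.min d (e / (1 + nc l))).
  by rewrite lt_min d0 divr_gt0// ltr_pwDl// nc_ge0.
move=> z; rewrite lt_min => /andP[/h hz].
rewrite ltr_pdivlMr; last by rewrite ltr_pwDl// nc_ge0.
apply: le_lt_trans; rewrite ncB.
rewrite -[F z - F w](subrK (l * (z - w))) (le_trans (ncD _ _))//.
by move: hz; rewrite mul1r Normc.normcM; lra.
Qed.

Lemma PI_add (G1 G2 : C -> C) (W W' : R -> C) s t :
  continuous (G1 \o W) -> continuous (G2 \o W) -> continuous W' ->
  PI (fun z => G1 z + G2 z) W W' s t = PI G1 W W' s t + PI G2 W W' s t.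
Proof.
move=> c1 c2 cW.
have := CI_add s t (continuousMC c1 cW) (continuousMC c2 cW).
move=> <-; rewrite /PI; congr CI; apply/funext => x /=; exact: mulrDl.
Qed.

Lemma PI_split (G : C -> C) (W W' : R -> C) s m t : s <= m -> m <= t ->
  continuous (G \o W) -> continuous W' ->
  PI G W W' s t = PI G W W' s m + PI G W W' m t.
Proof. by move=> sm mt cG cW; apply: CI_split sm mt (continuousMC cG cW). Qed.

Lemma PI_bound (G : C -> C) (W W' : R -> C) (M K s t : R) : s <= t ->
  continuous (G \o W) -> continuous W' -> 0 <= K ->
  (forall x, s <= x <= t -> nc (G (W x)) <= M) -> (forall x, nc (W' x) <= K) ->
  nc (PI G W W' s t) <= 2 * (M * K) * (t - s).
Proof.
move=> st cG cW K0 hM hK; apply: CI_bound st (continuousMC cG cW) _ => x xst.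
by rewrite Normc.normcM ler_pM ?nc_ge0// hM.
Qed.

Variables (F : C -> C) (a : C) (phi phi' : R -> R) (gam gam' : R -> C) (K : R).
Hypothesis K0 : 0 <= K.
Hypothesis hphi : forall x : R, is_derive x 1 phi (phi' x).
Hypothesis cphi' : continuous phi'.
Hypothesis hgam : forall y, is_cderive y gam (gam' y).
Hypothesis cgam' : continuous gam'.
Hypothesis bphi : forall x, `|phi x| <= K.
Hypothesis bphi' : forall x, `|phi' x| <= K.
Hypothesis bgam : forall x, nc (gam x) <= K.
Hypothesis bgam' : forall x, nc (gam' x) <= K.
Hypothesis Lphi : forall x y, `|phi x - phi y| <= K * `|x - y|.
Hypothesis Lgam : forall x y, nc (gam x - gam y) <= K * `|x - y|.

Let w x y : C := a + (phi x)%:C * gam y.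
Hypothesis hF : forall x y, exists l, cdiff_at F (w x y) l.

Let w1 y x : C := (phi' x)%:C * gam y.
Let w2 x y : C := (phi x)%:C * gam' y.

Let dw1 y x : is_cderive x (w ^~ y) (w1 y x).
Proof.
have := is_cderiveD (is_cderive_cst x a)
  (is_cderiveM (is_cderive_real (hphi x)) (is_cderive_cst x (gam y))).
by rewrite mulr0 addr0 add0r.
Qed.

Let dw2 x y : is_cderive y (w x) (w2 x y).
Proof.
have := is_cderiveD (is_cderive_cst y a)
  (is_cderiveM (is_cderive_cst y (phi x)%:C) (hgam y)).
by rewrite mul0r !add0r.
Qed.

Let cw1 y : continuous (w1 y).
Proof.
apply: continuousMC; last exact: continuous_cstC.
by move=> x; apply: cvgRC; exact: cphi'.
Qed.

Let cw2 x : continuous (w2 x).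
Proof. by apply: continuousMC cgam'; exact: continuous_cstC. Qed.

Let contw (G : C -> C) := (forall y, continuous (G \o (w ^~ y))) /\
  (forall x, continuous (G \o w x)).

Let contF : contw F.
Proof.
split=> [y x|x y].
- have [l /cdiff_at_cont cF] := hF x y.
  by apply: continuous_comp; [exact: (is_cderive_cont (dw1 y))|exact: cF].
- have [l /cdiff_at_cont cF] := hF x y.
  by apply: continuous_comp; [exact: (is_cderive_cont (dw2 x))|exact: cF].
Qed.

(** The integral around the image under [w] of the boundary of [[x, x + A] x [y, y + B]]. Working in
    the parameter rectangle replaces any topology of the contour. *)
Definition rectPI (G : C -> C) (x y A B : R) : C :=
  PI G (w ^~ y) (w1 y) x (x + A) - PI G (w ^~ (y + B)) (w1 (y + B)) x (x + A)
  + (PI G (w (x + A)) (w2 (x + A)) y (y + B) - PI G (w x) (w2 x) y (y + B)).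

Let rectPI_add G1 G2 x y A B : contw G1 -> contw G2 ->
  rectPI (fun z => G1 z + G2 z) x y A B = rectPI G1 x y A B + rectPI G2 x y A B.
Proof.
move=> [c1 c1'] [c2 c2']; rewrite /rectPI.
rewrite (PI_add _ _ (c1 y) (c2 y) (@cw1 y)).
rewrite (PI_add _ _ (c1 (y + B)) (c2 (y + B)) (@cw1 (y + B))).
rewrite (PI_add _ _ (c1' x) (c2' x) (@cw2 x)).
rewrite (PI_add _ _ (c1' (x + A)) (c2' (x + A)) (@cw2 (x + A))).
by ring.
Qed.

Let rectPI_affine c0 l0 x y A B : 0 <= A -> 0 <= B ->
  rectPI (fun z => c0 + l0 * z) x y A B = 0.
Proof.
move=> A0 B0; have xA : x <= x + A by rewrite lerDl.
have yB : y <= y + B by rewrite lerDl.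
rewrite /rectPI (PI_affine c0 l0 xA (dw1 y) (@cw1 y)).
rewrite (PI_affine c0 l0 xA (dw1 (y + B)) (@cw1 (y + B))).
rewrite (PI_affine c0 l0 yB (dw2 x) (@cw2 x)).
rewrite (PI_affine c0 l0 yB (dw2 (x + A)) (@cw2 (x + A))).
by ring.
Qed.

Let rectPI_split x y A B : 0 <= A -> 0 <= B ->
  rectPI F x y (A + A) (B + B) =
  rectPI F x y A B + rectPI F (x + A) y A B +
  (rectPI F x (y + B) A B + rectPI F (x + A) (y + B) A B).
Proof.
move=> A0 B0; have [c c'] := contF; rewrite /rectPI !addrA.
have xA z : z <= z + A by rewrite lerDl.
have yB z : z <= z + B by rewrite lerDl.
rewrite (PI_split (xA x) (xA (x + A)) (c y) (@cw1 y)).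
rewrite (PI_split (xA x) (xA (x + A)) (c (y + B + B)) (@cw1 (y + B + B))).
rewrite (PI_split (yB y) (yB (y + B)) (c' x) (@cw2 x)).
rewrite (PI_split (yB y) (yB (y + B)) (c' (x + A + A)) (@cw2 (x + A + A))).
by ring.
Qed.

Let L := K * K.

Let Lw x y x' y' : nc (w x y - w x' y') <= L * (`|x - x'| + `|y - y'|).
Proof.
have -> : w x y - w x' y' = (phi x)%:C * (gam y - gam y') + (phi x - phi x')%:C * gam y'.
  by rewrite /w rmorphB /=; ring.
rewrite (le_trans (ncD _ _))// 2!Normc.normcM !ncR mulrDr addrC lerD//.
  by rewrite -mulrA mulrCA mulrC ler_pM// ?nc_ge0// mulrC.
by rewrite -mulrA ler_pM ?nc_ge0.
Qed.

Let bw1 y x : nc (w1 y x) <= L.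
Proof. by rewrite Normc.normcM ncR ler_pM ?nc_ge0. Qed.

Let bw2 x y : nc (w2 x y) <= L.
Proof. by rewrite Normc.normcM ncR ler_pM ?nc_ge0. Qed.

(** Near the point singled out by [bisection], [F] is affine up to an error [e |z - w|]. The affine
    part integrates to zero; the error integrates to at most [e] times diameter times length, up to
    a constant, and both are of order [l]. *)
Lemma goursat_rect x y A B : 0 <= A -> 0 <= B -> rectPI F x y A B = 0.
Proof.
move=> A0 B0.
have L0 : 0 <= L by rewrite mulr_ge0.
suff: nc (rectPI F x y (A * 1) (B * 1)) <= 0.
  by rewrite !mulr1 le_eqVlt ltNge nc_ge0 orbF nc_eq0 => /eqP.
apply: (@bisection R (fun x y l => nc (rectPI F x y (A * l) (B * l))) A B x y A0 B0).
  move=> {}x {}y l l0.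
  have [hA hB] : 0 <= A * (l / 2) /\ 0 <= B * (l / 2).
    by split; rewrite mulr_ge0// divr_ge0// ltW.
  have := rectPI_split x y hA hB.
  have -> : A * (l / 2) + A * (l / 2) = A * l by field.
  have -> : B * (l / 2) + B * (l / 2) = B * l by field.
  move=> ->.
  by rewrite (le_trans (ncD _ _))// lerD// ncD.
move=> xs ys e e0; have [l0 hl0] := hF xs ys.
(* The four edges below contribute at most [4 (L (A + B)) ^ 2 * (e / D) * l ^ 2]; the summand 1
   keeps [D] positive. *)
pose D := 8 * (L * (A + B)) * (L * (A + B)) + 1.
have LAB : 0 <= L * (A + B) by rewrite mulr_ge0// addr_ge0.
have D0 : 0 < D by rewrite ltr_wpDl// !mulr_ge0// addr_ge0.
have [d d0 hd] := hl0 _ (divr_gt0 e0 D0).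
exists (d / (L * (A + B) + 1)); first by rewrite divr_gt0// ltr_wpDl.
move=> x' y' l /andP[lp ld] xl yl.
have dist t s : x' <= t <= x' + A * l -> y' <= s <= y' + B * l ->
    nc (w t s - w xs ys) <= L * (A + B) * l.
  move=> ht hs; rewrite (le_trans (Lw _ _ _ _))// -mulrA ler_wpM2l//.
  by rewrite mulrDl lerD// ler_norml; apply/andP; split; lra.
have ldd : L * (A + B) * l < d.
  move: ld; rewrite ltr_pdivlMr ?ltr_wpDl//; apply: le_lt_trans.
  by rewrite mulrC ler_pM2l// lerDl.
(* [F = E + G], with [G] the affine part at the limit point and [E] the error. *)
pose E z := F z - F (w xs ys) - l0 * (z - w xs ys).
pose M := e / D * (L * (A + B) * l).
have M0 : 0 <= M.
  by rewrite /M mulr_ge0 ?divr_ge0 ?(ltW e0) ?(ltW D0)// mulr_ge0// ltW.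
have bE t s : x' <= t <= x' + A * l -> y' <= s <= y' + B * l -> nc (E (w t s)) <= M.
  move=> ht hs; have hts := dist _ _ ht hs.
  rewrite (le_trans (hd _ (le_lt_trans hts ldd)))// ler_wpM2l//.
  by rewrite divr_ge0 ?(ltW e0) ?(ltW D0).
pose G z := (F (w xs ys) - l0 * w xs ys) + l0 * z.
have cG (W : R -> C) : continuous W -> continuous (G \o W).
  move=> cW; apply: continuousDC; first exact: continuous_cstC.
  by apply: continuousMC cW; exact: continuous_cstC.
have EFG : E = (fun z => F z + (- 1) * G z) by apply/funext => z; rewrite /E /G; ring.
have cE (W : R -> C) : continuous W -> continuous (F \o W) -> continuous (E \o W).
  rewrite EFG => cW cFW; apply: (continuousDC cFW).
  by apply: (continuousMC _ (cG _ cW)); exact: continuous_cstC.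
have cw y0 : continuous (w ^~ y0) by exact: is_cderive_cont (dw1 y0).
have cw' x0 : continuous (w x0) by exact: is_cderive_cont (dw2 x0).
have contE : contw E.
  by split=> z; apply: cE; [exact: cw|exact: contF.1|exact: cw'|exact: contF.2].
have contG : contw G.
  by split=> z; apply: cG; [exact: cw|exact: cw'].
have Al : 0 <= A * l by rewrite mulr_ge0// ltW.
have Bl : 0 <= B * l by rewrite mulr_ge0// ltW.
have -> : F = (fun z => E z + G z) by apply/funext => z; rewrite /E /G; ring.
rewrite (rectPI_add _ _ _ _ contE contG) (rectPI_affine _ _ _ _ Al Bl) addr0.
have xA : x' <= x' + A * l by rewrite lerDl.
have yB : y' <= y' + B * l by rewrite lerDl.
have xx : x' <= x' <= x' + A * l by rewrite lexx.
have xx' : x' <= x' + A * l <= x' + A * l by rewrite lexx andbT.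
have yy : y' <= y' <= y' + B * l by rewrite lexx.
have yy' : y' <= y' + B * l <= y' + B * l by rewrite lexx andbT.
have b1 := PI_bound xA (contE.1 y') (@cw1 y') L0 (fun t ht => bE _ _ ht yy) (bw1 y').
have b2 := PI_bound xA (contE.1 (y' + B * l)) (@cw1 (y' + B * l)) L0
  (fun t ht => bE _ _ ht yy') (bw1 (y' + B * l)).
have b3 := PI_bound yB (contE.2 x') (@cw2 x') L0 (fun t ht => bE _ _ xx ht) (bw2 x').
have b4 := PI_bound yB (contE.2 (x' + A * l)) (@cw2 (x' + A * l)) L0
  (fun t ht => bE _ _ xx' ht) (bw2 (x' + A * l)).
rewrite /rectPI (le_trans (ncD _ _))//.
have -> : e * l ^+ 2 = e / D * l ^+ 2 * D by field; rewrite gt_eqF.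
apply: (@le_trans _ _ (4 * (M * L) * (A * l) + 4 * (M * L) * (B * l))).
  apply: lerD; rewrite (le_trans (ncD _ _))// ncN.
    apply: (le_trans (lerD b1 b2)); rewrite (_ : x' + A * l - x' = A * l).
      by rewrite le_eqVlt; apply/orP; left; apply/eqP; clearbody M L; ring.
    by rewrite addrAC subrr add0r.
  apply: (le_trans (lerD b4 b3)); rewrite (_ : y' + B * l - y' = B * l).
    by rewrite le_eqVlt; apply/orP; left; apply/eqP; clearbody M L; ring.
  by rewrite addrAC subrr add0r.
have -> : 4 * (M * L) * (A * l) + 4 * (M * L) * (B * l) =
  e / D * l ^+ 2 * (4 * (L * (A + B)) * (L * (A + B))) by rewrite /M; ring.
rewrite ler_wpM2l//; first by rewrite mulr_ge0 ?sqr_ge0// divr_ge0 ?(ltW e0) ?(ltW D0).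
rewrite /D; have : 0 <= L * (A + B) * (L * (A + B)) by exact: mulr_ge0.
lra.
Qed.

End GoursatRect.

Section Cdiff.
Context {R : realType}.
Local Notation C := (plane R).
Local Notation nc := (@Normc.normc R).

Lemma cdiff_atP (f : C -> C) (z l : C) : cdiff_at f z l <-> is_derive z 1 f l.
Proof.
suff H : cdiff_at f z l <-> (h^-1 *: (f (h *: 1 + z) - f z) @[h --> (0 : C)^'] --> l).
  split=> [/H fl|[fd fl]].
    by apply: DeriveDef; [apply/cvg_ex; exists l|exact: cvg_lim].
  by apply/H; rewrite -fl; exact: fd.
split.
  move=> h; apply/cvgC => e e0.
  have [d d0 hd] := h _ (divr_gt0 e0 (ltr0Sn R 1)).
  near=> k.
  have k0 : k != 0 by near: k; exact: (@withinT _ (nbhs (0 : C)) (fun y => y != 0) _).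
  have kd : nc k < d.
    near: k; apply: nbhs_dnbhs; apply/nbhsC; exists d => // w.
    by rewrite subr0.
  rewrite ncB /GRing.scale /=.
  have -> : k^-1 * (f (k * 1 + z) - f z) - l =
      k^-1 * (f (z + k) - f z - l * (z + k - z)).
    rewrite mulr1 (addrC k) (_ : z + k - z = k); first by field.
    by rewrite addrAC subrr add0r.
  rewrite Normc.normcM Normc.normcV mulrC ltr_pdivrMr ?nc_gt0//.
  have := hd (z + k); rewrite (addrAC z) subrr add0r => /(_ kd).
  move=> /le_lt_trans; apply; rewrite ltr_pM2r ?nc_gt0//.
  by rewrite ltr_pdivrMr// ltr_pMr// ltr1n.
move=> /(@cvgC R _ ((0 : C)^')) h e /h /nbhsC[d d0 hd]; exists d => // w wd.
have [->|wz] := eqVneq w z.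
  by rewrite !subrr mulr0 subrr Normc.normc0 mulr0.
have wz0 : w - z != 0 by rewrite subr_eq0.
have := hd (w - z); rewrite subr0 => /(_ wd wz0).
rewrite /GRing.scale /= mulr1 subrK => /ltW H.
have -> : f w - f z - l * (w - z) = - ((l - (w - z)^-1 * (f w - f z)) * (w - z)).
  by field.
by rewrite ncN Normc.normcM ler_wpM2r ?nc_ge0.
Unshelve. all: by end_near. Qed.

Lemma cdiff_at_near (f g : C -> C) (z l : C) :
  (exists2 d : R, 0 < d & forall w, nc (w - z) < d -> f w = g w) ->
  cdiff_at f z l -> cdiff_at g z l.
Proof.
move=> [d d0 fg] fl e /fl[d' d'0 h]; exists (Num.min d d').
  by rewrite lt_min d0.
move=> w; rewrite lt_min => /andP[/fg <- /h].
by rewrite -(fg z)// subrr Normc.normc0.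
Qed.

Lemma cdiff_atM (f g : C -> C) (z l m : C) : cdiff_at f z l -> cdiff_at g z m ->
  cdiff_at (fun w => f w * g w) z (l * g z + f z * m).
Proof.
move=> /cdiff_atP fl /cdiff_atP gm; apply/cdiff_atP.
have := is_deriveM fl gm; rewrite /GRing.scale /= addrC (mulrC (g z)).
exact.
Qed.

Lemma cdiff_atD (f g : C -> C) (z l m : C) : cdiff_at f z l -> cdiff_at g z m ->
  cdiff_at (fun w => f w + g w) z (l + m).
Proof. by move=> /cdiff_atP fl /cdiff_atP gm; apply/cdiff_atP; exact: is_deriveD. Qed.

Lemma cdiff_at_cst (k : C) (z : C) : cdiff_at (fun=> k) z 0.
Proof. by apply/cdiff_atP; exact: is_derive_cst. Qed.

Lemma cdiff_at_id (z : C) : cdiff_at id z 1.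
Proof. by apply/cdiff_atP; exact: is_derive_id. Qed.

Lemma cdiff_at_affine (a b z : C) : cdiff_at (fun w => a * w + b) z a.
Proof.
have := cdiff_atD (cdiff_atM (cdiff_at_cst a z) (cdiff_at_id z)) (cdiff_at_cst b z).
by rewrite mul0r add0r addr0 mulr1.
Qed.

Lemma cdiff_atV (f : C -> C) (z l : C) : f z != 0 -> cdiff_at f z l ->
  cdiff_at (fun w => (f w)^-1) z (- l / f z ^+ 2).
Proof.
move=> fz /cdiff_atP[fl <-]; apply/cdiff_atP.
apply: DeriveDef; first exact: derivableV.
by rewrite deriveV// /GRing.scale /= mulNr mulrC -mulNr.
Qed.

End Cdiff.

Section Circle.
Context {R : realType}.
Local Notation C := (plane R).
Local Notation nc := (@Normc.normc R).

Definition cis (t : R) : C := cos t +i* sin t.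

Lemma nc_cis t : nc (cis t) = 1.
Proof. by rewrite /= cos2Dsin2 sqrtr1. Qed.

Lemma cis_neq0 t : cis t != 0.
Proof. by rewrite -nc_eq0 nc_cis oner_eq0. Qed.

Lemma cis_derive (t : R) : is_cderive t cis ('i%C * cis t).
Proof.
split=> /=; first by rewrite mul0r mul1r add0r; exact: is_derive_cos.
by rewrite mul0r mul1r add0r; exact: is_derive_sin.
Qed.

Lemma cis_continuous : continuous cis.
Proof. exact: is_cderive_cont cis_derive. Qed.

Lemma cis_2pi t : cis (t + 2 * pi) = cis t.
Proof. by rewrite /cis mulr_natl cosD2pi sinD2pi. Qed.

Lemma lip_of_derive (f f' : R -> R) (K : R) : continuous f' ->
  (forall x : R, is_derive x 1 f (f' x)) -> (forall x, `|f' x| <= K) ->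
  forall x y, `|f x - f y| <= K * `|x - y|.
Proof.
move=> cf' ff' bf'; suff H x y : x <= y -> `|f x - f y| <= K * `|x - y|.
  move=> x y; have [/H//|/ltW/H] := leP x y.
  by rewrite distrC (distrC y).
move=> xy; rewrite distrC -(RI_FTC xy cf' ff') distrC (ger0_norm (_ : 0 <= y - x)).
  exact: RI_bound.
by rewrite subr_ge0.
Qed.

Lemma lip_cos (x y : R) : `|cos x - cos y| <= 1 * `|x - y|.
Proof.
have c1 : continuous (fun x : R => - sin x).
  by move=> z; apply: cvgN; exact: continuous_sin.
apply: (@lip_of_derive cos _ 1 c1) => z.
by rewrite normrN sin_max.
Qed.

Lemma lip_sin (x y : R) : `|sin x - sin y| <= 1 * `|x - y|.
Proof.
apply: (@lip_of_derive sin _ 1 (@continuous_cos R)) => z.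
exact: cos_max.
Qed.

Lemma lip_cis (x y : R) : nc (cis x - cis y) <= 2 * `|x - y|.
Proof.
rewrite (le_trans (nc_le _))//= mulr_natl mulr2n.
by apply: lerD; rewrite -[leRHS]mul1r ?lip_cos ?lip_sin.
Qed.

End Circle.

Section CircleAt.
Context {R : realType}.
Local Notation C := (plane R).
Local Notation nc := (@Normc.normc R).

Definition circ (c : C) (r t : R) : C := c + r%:C * cis t.

Lemma circ_continuous c r : continuous (circ c r).
Proof.
apply: continuousDC; first exact: continuous_cstC.
by apply: continuousMC; [exact: continuous_cstC|exact: cis_continuous].
Qed.

Lemma circ_gap (q : C) r t : 0 <= r -> r - nc q <= nc (r%:C * cis t - q).
Proof.
move=> r0; rewrite lerBlDr (le_trans _ (ncD _ _))// subrK.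
by rewrite Normc.normcM ncR nc_cis mulr1 ger0_norm.
Qed.

Lemma circ_neq (q : C) r t : nc q < r -> r%:C * cis t - q != 0.
Proof.
move=> qr; rewrite -nc_gt0 (lt_le_trans _ (circ_gap _ _ _)) ?subr_gt0//.
exact: ltW (le_lt_trans (nc_ge0 _) qr).
Qed.

Lemma continuous_kernel (q : C) r : nc q < r ->
  continuous (fun t => (r%:C * cis t - q)^-1 : C).
Proof.
move=> qr t; apply: cvgV; first exact: circ_neq.
apply: cvgB; last exact: cvg_cst.
by apply: (continuousMC (@continuous_cstC R r%:C) (@cis_continuous R)).
Qed.

End CircleAt.

Section Cauchy.
Context {R : realType}.
Local Notation C := (plane R).
Local Notation nc := (@Normc.normc R).

Lemma continuous_onto (f : C -> C) (u : R -> C) :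
  (forall t, exists l, cdiff_at f (u t) l) -> continuous u -> continuous (f \o u).
Proof.
move=> hf cu t; have [l /cdiff_at_cont cf] := hf t.
by apply: continuous_comp; [exact: cu|exact: cf].
Qed.

Variables (f : C -> C) (c : C) (r0 : R).
Hypothesis hf : forall z, nc (z - c) < r0 -> exists l, cdiff_at f z l.

Lemma fcirc_continuous r : 0 <= r -> r < r0 -> continuous (f \o circ c r).
Proof.
move=> rp rr; apply: continuous_onto; last exact: circ_continuous.
by move=> t; apply: hf; rewrite addrAC subrr add0r Normc.normcM ncR nc_cis mulr1 ger0_norm.
Qed.

Section OnePoint.
Variables (a : C) (r : R).
Hypothesis ar : nc (a - c) < r.
Hypothesis rr0 : r < r0.

Let r_gt0 : 0 < r. Proof. exact: le_lt_trans (nc_ge0 _) ar. Qed.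
Let gam (t : R) : C := (c - a) + r%:C * cis t.
Let gam' (t : R) : C := r%:C * ('i%C * cis t).

Let gam_neq0 t : gam t != 0.
Proof.
apply/eqP => /(congr1 nc); rewrite Normc.normc0 => h.
have : nc (r%:C * cis t) <= nc (gam t) + nc (a - c).
  have -> : r%:C * cis t = gam t + (a - c) by rewrite /gam; ring.
  exact: ncD.
by rewrite h add0r Normc.normcM ncR nc_cis mulr1 gtr0_norm// leNgt ar.
Qed.

Let gamE t : a + gam t = circ c r t.
Proof. by rewrite /gam /circ; ring. Qed.

Let dgam t : is_cderive t gam (gam' t).
Proof.
have := is_cderiveD (is_cderive_cst t (c - a))
  (is_cderiveM (is_cderive_cst t r%:C) (cis_derive t)).
by rewrite mul0r !add0r.
Qed.

Let cgam' : continuous gam'.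
Proof.
apply: continuousMC; first exact: continuous_cstC.
by apply: continuousMC; [exact: continuous_cstC|exact: cis_continuous].
Qed.

Let cgam : continuous gam. Proof. exact: is_cderive_cont dgam. Qed.

Let cquot : continuous (fun t => gam' t / gam t : C).
Proof.
apply: continuousMC cgam' _ => t.
by apply: cvgV; [exact: gam_neq0|exact: cgam].
Qed.

Let F (z : C) : C := (f z - f a) / (z - a).

Let in_disc p t : 0 <= p -> p <= 1 -> nc (a + p%:C * gam t - c) < r0.
Proof.
move=> p0 p1.
have -> : a + p%:C * gam t - c = (1 - p)%:C * (a - c) + p%:C * (r%:C * cis t).
  by rewrite rmorphB rmorph1 /gam /=; ring.
rewrite (le_lt_trans (ncD _ _))// !Normc.normcM !ncR nc_cis mulr1 (gtr0_norm r_gt0).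
rewrite (ger0_norm p0) (ger0_norm (_ : 0 <= 1 - p)) ?subr_ge0//.
apply: le_lt_trans rr0.
rewrite [leRHS](_ : r = (1 - p) * r + p * r); last by ring.
by rewrite lerD2r ler_wpM2l ?subr_ge0// ltW.
Qed.

Let quotE t : gam' t / gam t = 'i%C * (r%:C * cis t / gam t).
Proof. by rewrite /gam'; ring. Qed.

(* The homotopy [a + phi x * gam t] contracts the circle to [a] while avoiding
   [a]; [phi] runs from [1] at [x = 0] down to [s > 0] at [x = pi]. *)
Let contraction (s : R) : 0 < s -> s <= 1 ->
  CI 0 (2 * pi) (fun t => (f (a + s%:C * gam t) - f a) * (gam' t / gam t)) =
  CI 0 (2 * pi) (fun t => (f (circ c r t) - f a) * (gam' t / gam t)).
Proof.
move=> s0 s1.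
pose A := (1 + s) / 2; pose B := (1 - s) / 2.
have B0 : 0 <= B by rewrite divr_ge0 ?subr_ge0.
(* A cosine instead of an affine interpolation keeps [phi] in [[s, 1]] on the whole line, as the
   global bounds required by [goursat_rect] demand. *)
pose phi (x : R) := A + B * cos x; pose phi' (x : R) := - (B * sin x).
have phis x : s <= phi x <= 1.
  rewrite /phi; have := cos_geN1 x; have := cos_le1 x => c1 c2.
  have : B * cos x <= B * 1 by rewrite ler_wpM2l.
  have : B * -1 <= B * cos x by rewrite ler_wpM2l.
  by rewrite /A /B => h1 h2; apply/andP; split; lra.
have Bh : B <= 1 by rewrite /B; lra.
have dphi (x : R) : is_derive x 1 phi (phi' x).
  have -> : phi = cst A + B *: cos by apply/funext.
  have -> : phi' x = 0 + B *: (- sin x) by rewrite add0r /GRing.scale /= mulrN.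
  exact: (is_deriveD (is_derive_cst A x 1) (is_deriveZ B (is_derive_cos x))).
have cphi' : continuous phi'.
  by move=> x; apply: cvgN; apply: cvgM; [exact: cvg_cst|exact: continuous_sin].
pose K := 1 + 2 * (r + r).
have K0 : 0 <= K by rewrite addr_ge0// mulr_ge0// addr_ge0// ltW.
have K1 : 1 <= K by rewrite lerDl mulr_ge0// addr_ge0// ltW.
have bphi' x : `|phi' x| <= K.
  rewrite normrN normrM (le_trans _ K1)// -(mulr1 1) ler_pM//.
    by rewrite ger0_norm.
  exact: sin_max.
have bgam t : nc (gam t) <= K.
  rewrite (le_trans (ncD _ _))// Normc.normcM ncR nc_cis mulr1 gtr0_norm// ncB /K.
  by move: ar r_gt0; lra.
have bgam' t : nc (gam' t) <= K.
  rewrite !Normc.normcM ncR nc_cis mulr1 gtr0_norm//.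
  rewrite (_ : nc 'i%C = 1); last by rewrite /= expr0n add0r expr1n sqrtr1.
  by rewrite mulr1 /K; move: r_gt0; lra.
have Lphi x y : `|phi x - phi y| <= K * `|x - y|.
  exact: (lip_of_derive cphi' dphi bphi').
have Lgam x y : nc (gam x - gam y) <= K * `|x - y|.
  have -> : gam x - gam y = r%:C * (cis x - cis y) by rewrite /gam; ring.
  rewrite Normc.normcM ncR gtr0_norm//.
  rewrite (le_trans (ler_wpM2l (ltW r_gt0) (lip_cis x y)))// mulrA ler_wpM2r//.
  by rewrite /K; move: r_gt0; lra.
have bphi x : `|phi x| <= K.
  have /andP[h1 h2] := phis x; rewrite ger0_norm ?(le_trans h2)//.
  exact: le_trans (ltW s0) h1.
have wneq x t : a + (phi x)%:C * gam t - a != 0.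
  rewrite addrAC subrr add0r mulf_neq0 ?gam_neq0// -nc_eq0 ncR normr_eq0 gt_eqF//.
  by have /andP[h1 _] := phis x; exact: lt_le_trans s0 h1.
have hF x t : exists l, cdiff_at F (a + (phi x)%:C * gam t) l.
  have [l hl] : exists l, cdiff_at f (a + (phi x)%:C * gam t) l.
    apply: hf.
    have /andP[h1 h2] := phis x; apply: in_disc => //.
    exact: le_trans (ltW s0) h1.
  exists ((l + 0) * (a + (phi x)%:C * gam t - a)^-1 +
    (f (a + (phi x)%:C * gam t) - f a) *
      (- 1 / (a + (phi x)%:C * gam t - a) ^+ 2)).
  apply: (cdiff_atM (cdiff_atD hl (cdiff_at_cst (- f a) _))).
  apply: (@cdiff_atV R (fun w => w - a) _ 1 (wneq x t)).
  have := cdiff_at_affine 1 (- a) (a + (phi x)%:C * gam t).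
  by apply: cdiff_at_near; exists 1 => // z _; rewrite mul1r.
have := goursat_rect K0 dphi cphi' dgam cgam' bphi bphi' bgam bgam' Lphi Lgam hF
  0 0 (pi_ge0 R) (mulr_ge0 (ler0n _ 2) (pi_ge0 R)).
rewrite /rectPI !add0r.
(* By periodicity the two edges at [y = 0] and [y = 2 * pi] cancel; what is left equates the
   integrals over the closed curves at [x = 0] and [x = pi]. *)
have -> : gam (2 * pi) = gam 0 by rewrite /gam -[2 * pi]add0r cis_2pi.
rewrite subrr add0r => /eqP; rewrite subr_eq0 => /eqP.
have PE x : PI F (fun t => a + (phi x)%:C * gam t) (fun t => (phi x)%:C * gam' t)
    0 (2 * pi) =
    CI 0 (2 * pi) (fun t => (f (a + (phi x)%:C * gam t) - f a) * (gam' t / gam t)).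
  rewrite /PI; congr CI; apply/funext => t; rewrite /F.
  have := wneq x t; rewrite (addrAC a) subrr add0r mulf_eq0 negb_or => /andP[p0 g0].
  by field; rewrite g0.
rewrite !PE /phi cospi cos0.
have -> : A + B * -1 = s by rewrite /A /B; field.
have -> : A + B * 1 = 1 by rewrite /A /B; field.
move=> ->; congr CI; apply/funext => t; rewrite rmorph1 mul1r gamE //.
Qed.

(** By [contraction] the integral may be taken over the curve shrunk towards [a] by the factor [s].
    There [f - f a] is [O(s)], by differentiability at [a], while [gam' / gam] does not depend on
    [s]; so the integral is at most [s Q] for all small [s]. *)
Lemma cauchy_zero :
  CI 0 (2 * pi) (fun t => (f (circ c r t) - f a) * (gam' t / gam t)) = 0.
Proof.
set I := CI _ _ _; apply/eqP; rewrite -nc_eq0; apply/eqP/le_anti; rewrite nc_ge0 andbT.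
rewrite leNgt; apply/negP => I0.
have pi2 : 0 <= 2 * pi :> R by rewrite mulr_ge0// pi_ge0.
have ar0 : nc (a - c) < r0 by exact: lt_trans ar rr0.
have [l hl] := hf ar0; have [d d0 hd] := hl 1 ltr01.
pose m := r - nc (a - c); have m0 : 0 < m by rewrite subr_gt0.
pose K := r + r; have K0 : 0 < K by rewrite addr_gt0.
pose Q := 2 * ((1 + nc l) * K * (r / m)) * (2 * pi).
have l1 : 0 <= 1 + nc l by rewrite addr_ge0// nc_ge0.
have Q0 : 0 <= Q.
  by rewrite /Q mulr_ge0// mulr_ge0// mulr_ge0 ?divr_ge0 ?(ltW r_gt0) ?(ltW m0)// mulr_ge0// ltW.
(* The second entry brings the shrunken curve within the distance [d] of [a]; the third makes [s Q]
   smaller than [nc I]. *)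
pose s := Num.min 1 (Num.min (d / (K + 1)) (nc I / (2 * (Q + 1)))).
have K1 : 0 < K + 1 by rewrite addr_gt0.
have Q1 : 0 < 2 * (Q + 1) by rewrite mulr_gt0// ltr_wpDl.
have s0 : 0 < s by rewrite !lt_min ltr01 !divr_gt0.
have s1 : s <= 1 by rewrite ge_min lexx.
have sd : s * K < d.
  have : s <= d / (K + 1) by rewrite !ge_min lexx orbT.
  rewrite ler_pdivlMr// => /(lt_le_trans _); apply.
  by rewrite ltr_pM2l// ltrDl.
have sI : s * (2 * (Q + 1)) <= nc I.
  by rewrite -ler_pdivlMr// !ge_min lexx !orbT.
have bgam t : nc (gam t) <= K.
  rewrite (le_trans (ncD _ _))// Normc.normcM ncR nc_cis mulr1 gtr0_norm// ncB /K.
  by rewrite lerD2r ltW.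
have hs t : nc (f (a + s%:C * gam t) - f a) <= (1 + nc l) * (s * K).
  have e : a + s%:C * gam t - a = s%:C * gam t by ring.
  have nb : nc (s%:C * gam t) <= s * K.
    by rewrite Normc.normcM ncR gtr0_norm// ler_wpM2l// ltW.
  have := hd (a + s%:C * gam t); rewrite e => /(_ (le_lt_trans nb sd)).
  rewrite mul1r => h.
  rewrite -[X in nc X](subrK (l * (s%:C * gam t))) (le_trans (ncD _ _))//.
  rewrite (Normc.normcM l) mulrDl mul1r lerD//; first exact: le_trans h nb.
  by rewrite ler_wpM2l// nc_ge0.
have hq t : nc (gam' t / gam t) <= r / m.
  rewrite Normc.normcM Normc.normcV !Normc.normcM ncR nc_cis mulr1 gtr0_norm//.
  rewrite (_ : nc 'i%C = 1); last by rewrite /= expr0n add0r expr1n sqrtr1.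
  rewrite mulr1 ler_wpM2l ?(ltW r_gt0)// lef_pV2 ?posrE ?nc_gt0 ?gam_neq0//.
  rewrite /m lerBlDr.
  have -> : r = nc (gam t + (a - c)).
    rewrite (_ : gam t + (a - c) = r%:C * cis t); last by rewrite /gam; ring.
    by rewrite Normc.normcM ncR nc_cis mulr1 gtr0_norm.
  exact: ncD.
have cs : continuous (fun t => f (a + s%:C * gam t) - f a : C).
  apply: continuousDC; last exact: continuous_cstC.
  apply: (@continuous_onto f (fun t => a + s%:C * gam t)).
    by move=> t; apply: hf; apply: in_disc => //; exact: ltW.
  apply: continuousDC; first exact: continuous_cstC.
  by apply: continuousMC cgam; exact: continuous_cstC.
have := CI_bound pi2 (continuousMC cs cquot)
   (fun t _ => (_ : nc _ <= (1 + nc l) * (s * K) * (r / m))).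
rewrite (contraction s0 s1) -/I => H.
have {}H : nc I <= 2 * ((1 + nc l) * (s * K) * (r / m)) * (2 * pi - 0).
  by apply: H => t; rewrite Normc.normcM ler_pM ?nc_ge0.
have H2 : 2 * ((1 + nc l) * (s * K) * (r / m)) * (2 * pi - 0) = s * Q.
  by rewrite /Q subr0; ring.
move: H sI; rewrite H2 => H sI.
have sQ : 0 <= s * Q by rewrite mulr_ge0// ltW.
by lra.
Qed.

End OnePoint.

(** At the centre the kernel [gam' / gam] of [cauchy_zero] is the constant [i]. *)
Lemma mean_value r : 0 < r -> r < r0 ->
  CI 0 (2 * pi) (f \o circ c r) = f c * (2 * pi)%:C.
Proof.
move=> rp rr; have pi2 : 0 <= 2 * pi :> R by rewrite mulr_ge0// pi_ge0.
have cr : nc (c - c) < r by rewrite subrr Normc.normc0.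
have cf := fcirc_continuous (ltW rp) rr.
have := cauchy_zero cr rr.
have -> : (fun t => (f (circ c r t) - f c) *
    (r%:C * ('i%C * cis t) / (c - c + r%:C * cis t))) =
    (fun t => 'i%C * ((f \o circ c r) t - f c)).
  apply/funext => t; rewrite subrr add0r.
  rewrite /=; have : r%:C != 0 by rewrite -nc_eq0 ncR normr_eq0 gt_eqF.
  by move: (cis_neq0 t) => h1 h2; field; rewrite h1.
rewrite CI_scale; last by apply: (continuousDC cf); exact: continuous_cstC.
have i0 : 'i%C != 0 :> C by rewrite -nc_eq0 /= expr0n add0r expr1n sqrtr1 oner_eq0.
move=> /eqP; rewrite mulf_eq0 (negPf i0) /= (CI_sub _ _ cf (@continuous_cstC R (f c))).
by rewrite CI_cst// subr0 subr_eq0 => /eqP.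
Qed.

End Cauchy.

Section CauchyFormula.
Context {R : realType}.
Local Notation C := (plane R).
Local Notation nc := (@Normc.normc R).

(** On the circle the kernel is the complex conjugate of [g z = 1 / (1 - conj q * z / r ^ 2)], which
    is holomorphic near the closed disk, so its mean is [g 0 = 1]. *)
Lemma cauchy_kernel (q : C) (r : R) : nc q < r ->
  CI 0 (2 * pi) (fun t => r%:C * cis t / (r%:C * cis t - q)) = (2 * pi)%:C.
Proof.
move=> qr; have rp : 0 < r by exact: le_lt_trans (nc_ge0 _) qr.
have q0 : 0 <= nc q by exact: nc_ge0.
have rq : 0 < r + nc q by rewrite ltr_wpDr.
(* A radius strictly between [r] and the modulus [r ^ 2 / nc q] of the pole of [g], written without
   division by [q], which may be 0. *)
pose r0 := 2 * r ^+ 2 / (r + nc q).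
have rr0 : r < r0 by rewrite ltr_pdivlMr// expr2; nra.
have qr0 : nc q * r0 < r ^+ 2.
  rewrite /r0 mulrA ltr_pdivrMr// -subr_gt0.
  rewrite (_ : _ - _ = r ^+ 2 * (r - nc q)); last by ring.
  by rewrite mulr_gt0 ?exprn_gt0 ?subr_gt0.
pose g (w : C) : C := (1 - (q^*%C / (r ^+ 2)%:C) * w)^-1.
have r2 : 0 < r ^+ 2 by rewrite exprn_gt0.
have gn (w : C) : nc (w - 0) < r0 -> - (q^*%C / (r ^+ 2)%:C) * w + 1 != 0.
  rewrite subr0 => wr; apply/eqP => /(congr1 (fun z => z - 1)) /(congr1 nc).
  rewrite addrK sub0r ncN Normc.normc1 mulNr ncN !Normc.normcM Normc.normcV ncJ ncR.
  rewrite gtr0_norm// => /eqP; rewrite lt_eqF// mulrAC ltr_pdivrMr// mul1r.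
  by rewrite (le_lt_trans _ qr0)// ler_wpM2l// ltW.
have hg (w : C) : nc (w - 0) < r0 -> exists l, cdiff_at g w l.
  move=> /gn wn; eexists.
  have := @cdiff_atV R (fun w => - (q^*%C / (r ^+ 2)%:C) * w + 1) w _ wn
    (cdiff_at_affine (- (q^*%C / (r ^+ 2)%:C)) 1 w).
  by apply: cdiff_at_near; exists 1 => // z _; rewrite /g addrC mulNr.
have := mean_value hg rp rr0.
have -> : g 0 = 1 by rewrite /g mulr0 subr0 invr1.
rewrite mul1r => H.
have cg := fcirc_continuous hg (ltW rp) rr0.
have := CI_J 0 (2 * pi) cg; rewrite H conjc_real => <-.
congr CI; apply/funext => t; rewrite /= /g /circ add0r.
have rC : r%:C != 0 :> C by rewrite -nc_eq0 ncR normr_eq0 gt_eqF.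
have cc : (cis t)^*%C * cis t = 1 :> C.
  apply/eqP; rewrite eq_complex /= !mulNr opprK; apply/andP; split; apply/eqP.
    by rewrite -!expr2 cos2Dsin2.
  by rewrite (mulrC (cos t)) subrr.
have cn := circ_neq t qr.
have cM (x y : C) : (x * y)^*%C = x^*%C * y^*%C by exact: rmorphM.
have cV (x : C) : (x^-1)^*%C = (x^*%C)^-1 by exact: fmorphV.
have cB (x y : C) : (x - y)^*%C = x^*%C - y^*%C by exact: rmorphB.
rewrite cV cB !cM cV !conjc_real conjcK.
have -> : (cis t)^*%C = (cis t)^-1 :> C.
  by apply: (mulIf (cis_neq0 t)); rewrite cc mulVf ?cis_neq0.
rewrite rmorphXn /=; have := cis_neq0 t => ct.
have -> : (1 : R)%:C = 1 :> C by [].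
have cn' : r%:C - q * (cis t)^-1 != 0.
  apply: contra_neq cn => h; apply: (mulIf (invr_neq0 ct)).
  by rewrite mul0r mulrBl mulfK.
rewrite (_ : 1 - q / r%:C ^+ 2 * (r%:C * (cis t)^-1) = (r%:C - q * (cis t)^-1) / r%:C); last first.
  by field; rewrite ct rC.
rewrite invf_div; apply: (mulIf cn'); rewrite divfK//.
have -> : r%:C - q / cis t = (r%:C * cis t - q) / cis t by field.
by field; rewrite ct.
Qed.

(** [cauchy_zero] replaces [f] by its value at [a], and [cauchy_kernel] integrates the kernel. *)
Lemma cauchy_formula (f : C -> C) (c a : C) (r r0 : R) :
  (forall z, nc (z - c) < r0 -> exists l, cdiff_at f z l) -> nc (a - c) < r -> r < r0 ->
  CI 0 (2 * pi) (fun t => f (circ c r t) * (r%:C * cis t / (r%:C * cis t - (a - c))))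
  = f a * (2 * pi)%:C.
Proof.
move=> hf ar rr; have rp : 0 < r by exact: le_lt_trans (nc_ge0 _) ar.
have cf := fcirc_continuous hf (ltW rp) rr.
pose k t : C := r%:C * cis t / (r%:C * cis t - (a - c)).
have ck : continuous k.
  apply: continuousMC.
    by apply: continuousMC; [exact: continuous_cstC|exact: cis_continuous].
  exact: continuous_kernel.
have := cauchy_zero hf ar rr.
have -> : (fun t => (f (circ c r t) - f a) *
    (r%:C * ('i%C * cis t) / (c - a + r%:C * cis t))) =
    (fun t => 'i%C * ((f \o circ c r) t * k t - f a * k t)).
  apply/funext => t; rewrite /= /k (_ : c - a + r%:C * cis t = r%:C * cis t - (a - c)).
    by ring.
  by ring.
have cfk := continuousMC cf ck.
have cak : continuous (fun t => f a * k t : C).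
  by apply: continuousMC ck; exact: continuous_cstC.
rewrite CI_scale; last first.
  by move=> t; apply: cvgB; [exact: cfk|exact: cak].
have i0 : 'i%C != 0 :> C by rewrite -nc_eq0 /= expr0n add0r expr1n sqrtr1 oner_eq0.
move=> /eqP; rewrite mulf_eq0 (negPf i0) /= (CI_sub _ _ cfk cak) (CI_scale _ _ _ ck).
by rewrite /k (cauchy_kernel ar) subr_eq0 => /eqP.
Qed.

End CauchyFormula.

(** * Zeros and derivatives of holomorphic functions *)

Section CauchyIntegrals.
Context {R : realType}.
Local Notation C := (plane R).
Local Notation nc := (@Normc.normc R).

Lemma ccont_bounded (g : R -> C) (a b : R) : a <= b -> continuous g ->
  exists M, forall t, a <= t <= b -> nc (g t) <= M.
Proof.
move=> ab cg.
have cn : {within `[a, b], continuous (fun t => nc (g t))}.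
  apply: continuous_subspaceT => t.
  by apply: continuous_comp; [exact: cg|exact: nc_continuous].
have [m _ hm] := EVT_max ab cn; exists (nc (g m)) => t tab; apply: hm.
by rewrite in_itv.
Qed.

(** Integrals of Cauchy type. The density [phi] is arbitrary, so that the same differentiation
    lemmas serve a holomorphic function, its derivative and its Taylor remainders. *)
Definition Jint (phi : R -> C) (c : C) (r : R) (n : nat) (a : C) : C :=
  CI 0 (2 * pi) (fun t => phi t * (r%:C * cis t - (a - c))^-1 ^+ n).

Variables (phi : R -> C) (c : C) (r : R).
Hypothesis cphi : continuous phi.

Let pi2 : 0 <= 2 * pi :> R. Proof. by rewrite mulr_ge0// pi_ge0. Qed.

Lemma continuousXC (g : R -> C) n : continuous g -> continuous (fun t => g t ^+ n : C).
Proof.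
move=> cg; elim: n => [|n ih].
  have -> : (fun t => g t ^+ 0 : C) = (fun=> 1) by apply/funext => t; rewrite expr0.
  exact: continuous_cstC.
have -> : (fun t => g t ^+ n.+1 : C) = (fun t => g t * g t ^+ n).
  by apply/funext => t; rewrite exprS.
exact: continuousMC.
Qed.

Lemma Jint_continuous n a : nc (a - c) < r ->
  continuous (fun t => phi t * (r%:C * cis t - (a - c))^-1 ^+ n : C).
Proof.
by move=> ar; apply: (continuousMC cphi); apply: continuousXC; exact: continuous_kernel.
Qed.

Lemma kernel_bound (a : C) t : nc (a - c) < r ->
  nc (r%:C * cis t - (a - c))^-1 <= (r - nc (a - c))^-1.
Proof.
move=> ar; have r0 : 0 <= r by exact: ltW (le_lt_trans (nc_ge0 _) ar).
rewrite Normc.normcV lef_pV2 ?posrE ?subr_gt0 ?nc_gt0 ?circ_neq//.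
exact: circ_gap.
Qed.

(* A second-order expansion of the integrand, with remainder [e t] of size
   [O(|z - a|^2)] uniformly in [t], can be integrated term by term. *)
Lemma Jint_cdiff_aux (n : nat) (k a : C) (B d : R) : nc (a - c) < r ->
  0 < d -> d <= r - nc (a - c) -> 0 <= B ->
  (forall z t, nc (z - a) < d ->
     nc ((r%:C * cis t - (z - c))^-1 ^+ n - (r%:C * cis t - (a - c))^-1 ^+ n
       - k * (z - a) * (r%:C * cis t - (a - c))^-1 ^+ n.+1) <= B * nc (z - a) ^+ 2) ->
  cdiff_at (Jint phi c r n) a (k * Jint phi c r n.+1 a).
Proof.
move=> ar d0 dr B0 hB e e0.
have [M0 hM0] := ccont_bounded pi2 cphi.
pose M := Num.max M0 0.
have M1 : 0 <= M by rewrite le_max lexx orbT.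
have hM t : 0 <= t <= 2 * pi -> nc (phi t) <= M.
  by move=> /hM0 h; rewrite le_max h.
pose Q := 2 * (M * B) * (2 * pi) + 1.
have Q0 : 0 < Q by rewrite ltr_wpDl// mulr_ge0// mulr_ge0// mulr_ge0.
exists (Num.min d (e / Q)); first by rewrite lt_min d0 divr_gt0.
move=> z; rewrite lt_min => /andP[zd ze].
have zr : nc (z - c) < r.
  rewrite (_ : z - c = (z - a) + (a - c)); last by ring.
  by rewrite (le_lt_trans (ncD _ _))// -ltrBrDr (lt_le_trans zd).
pose u t : C := (r%:C * cis t - (a - c))^-1.
pose v t : C := (r%:C * cis t - (z - c))^-1.
have c1 := @Jint_continuous n _ zr; have c2 := @Jint_continuous n _ ar.
have c3 := @Jint_continuous n.+1 _ ar.
have c4 : continuous (fun t => (k * (z - a)) * (phi t * u t ^+ n.+1) : C).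
  by apply: continuousMC c3; exact: continuous_cstC.
have c12 : continuous (fun t => phi t * v t ^+ n - phi t * u t ^+ n : C).
  by move=> t; apply: cvgB; [exact: c1|exact: c2].
have c124 : continuous (fun t => phi t * v t ^+ n - phi t * u t ^+ n -
    (k * (z - a)) * (phi t * u t ^+ n.+1) : C).
  by move=> t; apply: cvgB; [exact: c12|exact: c4].
have -> : Jint phi c r n z - Jint phi c r n a - k * Jint phi c r n.+1 a * (z - a) =
  CI 0 (2 * pi) (fun t => phi t * v t ^+ n - phi t * u t ^+ n -
    (k * (z - a)) * (phi t * u t ^+ n.+1)).
  rewrite (CI_sub _ _ c12 c4) (CI_sub _ _ c1 c2) (CI_scale _ _ _ c3) /Jint /u /v.
  by rewrite mulrAC.
apply: (le_trans (CI_bound (M := M * (B * nc (z - a) ^+ 2)) pi2 c124 _)).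
  move=> t /hM ht.
  rewrite (_ : _ - _ = phi t * (v t ^+ n - u t ^+ n - k * (z - a) * u t ^+ n.+1)); last by ring.
  by rewrite Normc.normcM ler_pM ?nc_ge0// hB.
rewrite subr0 expr2.
have -> : 2 * (M * (B * (nc (z - a) * nc (z - a)))) * (2 * pi) =
   (2 * (M * B) * (2 * pi) * nc (z - a)) * nc (z - a) by ring.
rewrite ler_wpM2r ?nc_ge0//.
move: ze; rewrite ltr_pdivlMr// => /ltW; apply: le_trans.
rewrite mulrC ler_wpM2l ?nc_ge0// /Q lerDl//.
Qed.

Let half (a z : C) t : nc (a - c) < r -> nc (z - a) < (r - nc (a - c)) / 2 ->
  nc (r%:C * cis t - (z - c))^-1 <= 2 / (r - nc (a - c)).
Proof.
move=> ar zd.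
have h : nc (z - c) <= nc (a - c) + (r - nc (a - c)) / 2.
  rewrite (_ : z - c = (z - a) + (a - c)); last by ring.
  by rewrite (le_trans (ncD _ _))// addrC lerD2l ltW.
have zr : nc (z - c) < r by lra.
rewrite (le_trans (kernel_bound t zr))// -[leRHS]invrK invf_div.
by rewrite lef_pV2 ?posrE ?subr_gt0// ?divr_gt0 ?subr_gt0//; lra.
Qed.

(** For the kernels [x] at [z] and [y] at [a] one has [x - y = (z - a) x y]. Used twice, this leaves
    the remainder [(z - a) ^ 2 x y ^ 2], and both kernels are bounded by [m] within half the
    distance to the circle. *)
Lemma Jint1_cdiff a : nc (a - c) < r ->
  cdiff_at (Jint phi c r 1) a (Jint phi c r 2 a).
Proof.
move=> ar; have m0 : 0 < r - nc (a - c) by rewrite subr_gt0.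
pose m := 2 / (r - nc (a - c)).
have mp : 0 <= m by rewrite divr_ge0// ltW.
rewrite -[X in cdiff_at _ _ X]mul1r.
apply: (@Jint_cdiff_aux 1 1 a (m ^+ 3) ((r - nc (a - c)) / 2)) => //.
- by rewrite divr_gt0.
- by rewrite ler_pdivrMr// ler_peMr ?ler1n// ltW.
- by rewrite exprn_ge0.
move=> z t zd.
have hx := half t ar zd; set x := (r%:C * cis t - (z - c))^-1 in hx *.
have hy : nc (r%:C * cis t - (a - c))^-1 <= m.
  by apply: half ar _; rewrite subrr Normc.normc0 divr_gt0.
set y := (r%:C * cis t - (a - c))^-1 in hy *.
have zr : nc (z - c) < r.
  rewrite (_ : z - c = (z - a) + (a - c)); last by ring.
  by rewrite (le_lt_trans (ncD _ _))//; lra.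
have xy : x - y = (z - a) * x * y.
  rewrite /x /y; have := circ_neq t zr; have := circ_neq t ar.
  move=> h1 h2; field; rewrite h1 h2 //.
have -> : x ^+ 1 - y ^+ 1 - 1 * (z - a) * y ^+ 2 = (z - a) ^+ 2 * (x * y * y).
  rewrite !expr1 xy mul1r.
  have -> : (z - a) * x * y - (z - a) * y ^+ 2 = (z - a) * y * (x - y) by ring.
  by rewrite xy; ring.
rewrite Normc.normcM ncX mulrC ler_wpM2r ?exprn_ge0 ?nc_ge0//.
rewrite !Normc.normcM !exprSr expr0 mul1r.
by do 2!(apply: ler_pM; rewrite ?mulr_ge0 ?nc_ge0//).
Qed.

(** This is what makes the derivative found in [hol_disk_derive] holomorphic in turn. *)
Lemma Jint2_cdiff a : nc (a - c) < r ->
  cdiff_at (Jint phi c r 2) a (2 * Jint phi c r 3 a).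
Proof.
move=> ar; have m0 : 0 < r - nc (a - c) by rewrite subr_gt0.
pose m := 2 / (r - nc (a - c)).
have mp : 0 <= m by rewrite divr_ge0// ltW.
apply: (@Jint_cdiff_aux 2 2 a (3 * m ^+ 4) ((r - nc (a - c)) / 2)) => //.
- by rewrite divr_gt0.
- by rewrite ler_pdivrMr// ler_peMr ?ler1n// ltW.
- by rewrite mulr_ge0// exprn_ge0.
move=> z t zd.
have hx := half t ar zd; set x := (r%:C * cis t - (z - c))^-1 in hx *.
have hy : nc (r%:C * cis t - (a - c))^-1 <= m.
  by apply: half ar _; rewrite subrr Normc.normc0 divr_gt0.
set y := (r%:C * cis t - (a - c))^-1 in hy *.
have zr : nc (z - c) < r.
  rewrite (_ : z - c = (z - a) + (a - c)); last by ring.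
  by rewrite (le_lt_trans (ncD _ _))//; lra.
have xy : x - y = (z - a) * x * y.
  rewrite /x /y; have := circ_neq t zr; have := circ_neq t ar.
  move=> h1 h2; field; rewrite h1 h2 //.
have -> : x ^+ 2 - y ^+ 2 - 2 * (z - a) * y ^+ 3 =
    (z - a) ^+ 2 * (x * y * y * (x + y + y)).
  have -> : x ^+ 2 - y ^+ 2 = (x - y) * (x + y) by ring.
  rewrite xy.
  have -> : (z - a) * x * y * (x + y) - 2 * (z - a) * y ^+ 3 =
    (z - a) * y * ((x - y) * (x + y + y)) by ring.
  by rewrite xy; ring.
rewrite Normc.normcM ncX mulrC ler_wpM2r ?exprn_ge0 ?nc_ge0//.
have h3 : nc (x + y + y) <= 3 * m.
  rewrite (_ : 3 * m = m + m + m); last by ring.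
  apply: (le_trans (ncD _ _)); apply: lerD; last exact: hy.
  by apply: (le_trans (ncD _ _)); exact: lerD.
have -> : 3 * m ^+ 4 = m * m * m * (3 * m) by ring.
rewrite !Normc.normcM.
by do 3!(apply: ler_pM; rewrite ?mulr_ge0 ?nc_ge0//).
Qed.

End CauchyIntegrals.

Section Holomorphic.
Context {R : realType}.
Local Notation C := (plane R).
Local Notation nc := (@Normc.normc R).

Definition hol_disk (f : C -> C) (c : C) (r : R) :=
  forall z, nc (z - c) < r -> exists l, cdiff_at f z l.

Let pi2_gt0 : 0 < 2 * pi :> R. Proof. by rewrite mulr_gt0// pi_gt0. Qed.
Let pi2C : (2 * pi)%:C != 0 :> C.
Proof. by rewrite -nc_eq0 ncR normr_eq0 gt_eqF. Qed.

Lemma cdiff_at_scale (k : C) (f : C -> C) z l :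
  cdiff_at f z l -> cdiff_at (fun w => k * f w) z (k * l).
Proof.
by move=> fl; have := cdiff_atM (cdiff_at_cst k z) fl; rewrite mul0r add0r.
Qed.

Lemma hol_disk_derive (f : C -> C) c r r0 : 0 < r -> r < r0 -> hol_disk f c r0 ->
  exists2 f', hol_disk f' c r & forall z, nc (z - c) < r -> cdiff_at f z (f' z).
Proof.
move=> rp rr hf.
pose phi t : C := f (circ c r t) * (r%:C * cis t).
have cphi : continuous phi.
  apply: (continuousMC (fcirc_continuous hf (ltW rp) rr)).
  by apply: continuousMC; [exact: continuous_cstC|exact: cis_continuous].
exists (fun z => (2 * pi)%:C^-1 * Jint phi c r 2 z).
  move=> z zr; exists ((2 * pi)%:C^-1 * (2 * Jint phi c r 3 z)).
  exact: (cdiff_at_scale _ (Jint2_cdiff cphi zr)).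
move=> z zr; have := cdiff_at_scale ((2 * pi)%:C^-1) (Jint1_cdiff cphi zr).
apply: cdiff_at_near; exists (r - nc (z - c)); first by rewrite subr_gt0.
move=> w wz; have wr : nc (w - c) < r.
  rewrite (_ : w - c = (w - z) + (z - c)); last by ring.
  by rewrite (le_lt_trans (ncD _ _))// -ltrBrDr.
have := cauchy_formula hf wr rr.
move=> H; apply: (mulfI pi2C); rewrite mulVKf// mulrC -H.
by rewrite /Jint; congr CI; apply/funext => t; rewrite expr1 /phi -mulrA.
Qed.

(** Taylor's formula with [A k] the coefficients, up to powers of [r] absorbed in [u] and the factor
    [2 * pi], and [G k] the remainders, tied by [G k z = A k + (z - c) * G k.+1 z]. The first
    nonzero coefficient gives the order. If all vanish, [nc (f z)] is bounded by a multiple of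
    [(nc (z - c) / r) ^ n] for every [n]. *)
Lemma hol_disk_order (f : C -> C) c r r0 : 0 < r -> r < r0 -> hol_disk f c r0 ->
  (forall z, nc (z - c) < r -> f z = 0) \/
  exists n g, [/\ hol_disk g c r, g c != 0 &
    forall z, nc (z - c) < r -> f z = (z - c) ^+ n * g z].
Proof.
move=> rp rr hf.
have cf := fcirc_continuous hf (ltW rp) rr.
pose u t : C := r%:C * cis t.
have cu : continuous u.
  by apply: continuousMC; [exact: continuous_cstC|exact: cis_continuous].
have u0 t : u t != 0 by have := @circ_neq R 0 r t; rewrite Normc.normc0 subr0; apply.
have cuV : continuous (fun t => (u t)^-1 : C).
  by move=> t; apply: cvgV; [exact: u0|exact: cu].
have cfu k : continuous (fun t => f (circ c r t) * (u t)^-1 ^+ k : C).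
  by apply: (continuousMC cf); exact: continuousXC.
pose A k := CI 0 (2 * pi) (fun t => f (circ c r t) * (u t)^-1 ^+ k).
pose phi k t : C := f (circ c r t) * (u t)^-1 ^+ k * u t.
have cphi k : continuous (phi k) by exact: (continuousMC (@cfu k)).
pose G k := Jint (phi k) c r 1.
have un z t : nc (z - c) < r -> u t - (z - c) != 0 by move=> zr; exact: circ_neq.
have Gstep k z : nc (z - c) < r -> G k z = A k + (z - c) * G k.+1 z.
  move=> zr; rewrite /G /A /Jint.
  have c1 := @Jint_continuous R (phi k.+1) c r (@cphi k.+1) 1 z zr.
  rewrite -(CI_scale _ _ _ c1).
  have c2 : continuous (fun t => (z - c) * (phi k.+1 t * (u t - (z - c))^-1 ^+ 1) : C).
    by apply: continuousMC c1; exact: continuous_cstC.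
  rewrite -(CI_add _ _ (@cfu k) c2); congr CI; apply/funext => t.
  rewrite /phi !expr1 exprS -/(u t).
  move: (u0 t) (un z t zr); set v := u t; set w := v^-1 ^+ k => v0 vz.
  by field; rewrite vz.
have G0 k : G k c = A k by rewrite Gstep ?subrr ?Normc.normc0// mul0r addr0.
have S n : (forall k, (k < n)%N -> A k = 0) -> forall z, nc (z - c) < r ->
    f z * (2 * pi)%:C = (z - c) ^+ n * G n z.
  elim: n => [_ z zr|n ih hA z zr].
    rewrite expr0 mul1r -(cauchy_formula hf zr rr) /G /Jint; congr CI.
    by apply/funext => t; rewrite /phi !expr0 !expr1 mulr1 mulrA.
  rewrite (ih _ z zr); last by move=> k kn; apply: hA; exact: ltnW.
  by rewrite Gstep// hA// add0r exprSr mulrA.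
have [[n An]|noA] := pselect (exists n, A n != 0).
  right; have exA : exists n, A n != 0 by exists n.
  pose m := ex_minn exA.
  have [Am hm] : A m != 0 /\ forall k, (k < m)%N -> A k = 0.
    rewrite /m; case: ex_minnP => m' Am' hm'; split => // k km'.
    by apply/eqP; apply: contraTT km' => /hm'; rewrite -leqNgt.
  exists m, (fun z => (2 * pi)%:C^-1 * G m z); split.
  - move=> z zr; exists ((2 * pi)%:C^-1 * Jint (phi m) c r 2 z).
    exact: (cdiff_at_scale _ (Jint1_cdiff (@cphi m) zr)).
  - by rewrite G0 mulf_neq0 ?invr_neq0.
  - move=> z zr; apply: (mulIf pi2C); rewrite (S m hm z zr) -mulrA; congr (_ * _).
    by rewrite mulrAC mulVf ?mul1r.
left=> z zr; have hA k : A k = 0.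
  by apply/eqP; apply: contrapT => /negP h; apply: noA; exists k.
have [M0 hM0] := ccont_bounded (ltW pi2_gt0) cf.
pose M := Num.max M0 0.
have M1 : 0 <= M by rewrite le_max lexx orbT.
have m0 : 0 < r - nc (z - c) by rewrite subr_gt0.
pose K := 2 * (M * r / (r - nc (z - c))) * (2 * pi).
have q1 : nc (z - c) / r < 1 by rewrite ltr_pdivrMr ?mul1r.
have q0 : 0 <= nc (z - c) / r by rewrite divr_ge0 ?nc_ge0// ltW.
have bnd n : nc (f z) * (2 * pi) <= K * (nc (z - c) / r) ^+ n.
  have := S n (fun k _ => hA k) z zr => /(congr1 nc).
  rewrite !Normc.normcM ncR ncX (gtr0_norm pi2_gt0) => ->.
  have c1 := @Jint_continuous R (phi n) c r (@cphi n) 1 z zr.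
  have := CI_bound (M := M * (r^-1 ^+ n) * r / (r - nc (z - c))) (ltW pi2_gt0) c1 => H.
  rewrite expr_div_n [leRHS]mulrCA ler_wpM2l ?exprn_ge0 ?nc_ge0//.
  rewrite (le_trans (H _))//; last first.
    by rewrite subr0 /K -exprVn le_eqVlt; apply/orP; left; apply/eqP; ring.
  move=> t t2; rewrite expr1 !Normc.normcM ncX Normc.normcV -/(u t).
  have -> : nc (u t) = r by rewrite Normc.normcM ncR nc_cis mulr1 gtr0_norm.
  rewrite ler_pM ?nc_ge0 ?mulr_ge0 ?nc_ge0 ?exprn_ge0 ?invr_ge0 ?(ltW rp)//; last first.
    exact: kernel_bound.
  rewrite ncR nc_cis mulr1 (gtr0_norm rp).
  rewrite ler_wpM2r ?(ltW rp)// ler_wpM2r ?exprn_ge0 ?invr_ge0 ?(ltW rp)//.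
  by rewrite le_max hM0.
apply/eqP; rewrite -nc_eq0; apply/eqP/le_anti; rewrite nc_ge0 andbT.
rewrite -(pmulr_lle0 _ pi2_gt0).
have cvg0 : K * (nc (z - c) / r) ^+ n @[n --> \oo] --> 0.
  have := @cvg_geometric R K _ (_ : `|nc (z - c) / r| < 1).
  by apply; rewrite ger0_norm.
rewrite leNgt; apply/negP => X0.
move/cvgrPdist_lt : cvg0 => /(_ _ X0) [n _ /(_ n (leqnn n))].
by rewrite /= sub0r normrN => /(le_lt_trans (ler_norm _)); rewrite ltNge bnd.
Qed.

End Holomorphic.

(** * Jensen's formula for smooth functions *)

Section Primitive.
Context {R : realType}.
Implicit Types (g u : R -> R) (a b c : R).

Lemma RI_empty a b g : b < a -> RI a b g = 0.
Proof.
by move=> ba; rewrite /RI set_itv_ge ?Rintegral_set0// bnd_simp -ltNge.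
Qed.

Lemma RI_refl a g : RI a a g = 0.
Proof. by rewrite /RI set_itv1 Rintegral_set1. Qed.

(** [RI] vanishes on a reversed segment, so the difference is the oriented integral from 0 to
    [x]. *)
Lemma exists_primitive g : continuous g ->
  exists G : R -> R, forall x : R, is_derive x 1 G (g x).
Proof.
move=> cg; exists (fun x => RI 0 x g - RI x 0 g) => x.
have GE m y : m <= 0 -> m <= y -> RI 0 y g - RI y 0 g = RI m y g - RI m 0 g.
  move=> m0 my; have [y0|y0] := leP 0 y.
    rewrite (RI_split m0 y0 cg); move: y0; rewrite le_eqVlt => /predU1P[<-|y0].
      by rewrite RI_refl subrr addr0 subrr.
    by rewrite (RI_empty _ y0) subr0 (addrC (RI m 0 g)) addrK.
  by rewrite (RI_split my (ltW y0) cg) (RI_empty _ y0) sub0r opprD addrA subrr add0r.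
(* A base point to the left of both [x] and 0: near [x] the oriented integral is the one from [m],
   up to a constant. *)
pose m := Num.min x 0 - 1.
have mx : m < x by rewrite /m ltrBlDr (@le_lt_trans _ _ x) ?ge_min ?lexx// ltrDl.
have m0 : m < 0 by rewrite /m ltrBlDr (@le_lt_trans _ _ 0) ?ge_min ?lexx ?orbT// ltrDl.
have xx : x < x + 1 by rewrite ltrDl.
have [dF FE] := continuous_FTC1_closed xx (RI_integrable _ _ cg) mx (cg x).
have dG : is_derive x 1 (fun y => RI m y g - RI m 0 g) (g x).
  have h : is_derive x 1 (fun y => RI m y g) (g x).
    by rewrite -FE derive1E; exact: (derivableP dF).
  have := is_deriveB h (is_derive_cst (RI m 0 g) x 1); rewrite subr0; exact.
apply: (near_eq_is_derive _ dG); near=> y; apply/esym/GE; first exact: ltW.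
by near: y; apply: (@cvgr_ge _ _ _ _ id x); [exact: cvg_id|exact: mx].
Unshelve. all: by end_near. Qed.

Lemma RI_substitution a b g u u' : a <= b -> u a <= u b ->
  continuous g -> continuous u' -> (forall x : R, is_derive x 1 u (u' x)) ->
  RI a b (fun x => g (u x) * u' x) = RI (u a) (u b) g.
Proof.
move=> ab uab cg cu' du; have [G dG] := exists_primitive cg.
rewrite (RI_FTC uab cg dG).
have cu : continuous u.
  by move=> x; apply/differentiable_continuous/derivable1_diffP; case: (du x).
have cgu : continuous (fun x => g (u x) * u' x).
  move=> x; apply: cvgM; last exact: cu'.
  by apply: continuous_comp; [exact: cu|exact: cg].
by apply: (RI_FTC (F := G \o u) ab cgu).
Qed.

Lemma RI_reflect a b c g : a <= b -> continuous g ->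
  RI a b (fun x => g (c - x)) = RI (c - b) (c - a) g.
Proof.
move=> ab cg; have [G dG] := exists_primitive cg.
have cab : c - b <= c - a by rewrite lerD2l lerN2.
have cu : continuous (fun x : R => c - x).
  by move=> x; apply: cvgB; [exact: cvg_cst|exact: cvg_id].
have cg' : continuous (fun x => g (c - x)).
  by move=> x; apply: continuous_comp; [exact: cu|exact: cg].
rewrite (RI_FTC cab cg dG).
have dG' (x : R) : is_derive x 1 (fun x : R => - G (c - x)) (g (c - x)).
  have du : is_derive x 1 (fun x : R => c - x) (- 1).
    have := is_deriveB (is_derive_cst c x 1) (is_derive_id x 1).
    by rewrite sub0r; exact.
  have := is_deriveN (@is_derive1_comp _ G _ x _ _ (dG (c - x)) du).
  by rewrite /GRing.scale /= mulrN1 opprK; exact.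
by rewrite (RI_FTC ab cg' dG') opprK addrC.
Qed.

Lemma RI_shift a b c g : a <= b -> continuous g ->
  RI a b (fun x => g (x + c)) = RI (a + c) (b + c) g.
Proof.
move=> ab cg.
have du (x : R) : is_derive x 1 (fun x : R => x + c) 1.
  have := is_deriveD (is_derive_id x (1 : R)) (is_derive_cst c x 1).
  by rewrite addr0; exact.
have c1 : continuous (fun _ : R => 1 : R) by exact: cst_continuous.
have abc : a + c <= b + c by rewrite lerD2r.
rewrite -(RI_substitution ab abc cg c1 du).
by apply: eq_RI => x _; rewrite mulr1.
Qed.

Lemma RI_periodic a b T g : 0 <= T -> continuous g -> (forall x, g (x + T) = g x) ->
  RI a (a + T) g = RI b (b + T) g.
Proof.
move=> T0 cg pg; wlog ab : a b / a <= b => [h|].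
  by have [/h//|/ltW /h ->//] := leP a b.
have E x y : x <= y -> RI x y g = RI (x + T) (y + T) g.
  by move=> xy; rewrite -RI_shift//; apply: eq_RI => z _; rewrite pg.
have [G dG] := exists_primitive cg.
have h := E _ _ ab.
move: h; rewrite !(RI_FTC _ cg dG) ?lerDl ?lerD2r//; lra.
Qed.

End Primitive.

Section PlaneMeasurability.
Context {R : realType}.
Local Notation mR := (measurableTypeR R).

(** Every open set is a union of boxes with rational centre and radius [1 / n.+1], of which there
    are countably many. *)
Lemma open_measurable2 (O : set (R * R)) : open O ->
  measurable (O : set (mR * mR)).
Proof.
move=> oO.
pose B (q : rat * rat * nat) : set (R * R) :=
  ball (ratr q.1.1 : R) (q.2.+1%:R^-1) `*` ball (ratr q.1.2 : R) (q.2.+1%:R^-1).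
have -> : O = \bigcup_(q in [set: rat * rat * nat]) (if `[< B q `<=` O >] then B q else set0).
  apply/seteqP; split=> [[x y] Oxy|p [q _]]; last by case: asboolP => // h; exact: h.
  have [e /= e0 he] : exists2 e : R, 0 < e & ball (x, y) e `<=` O.
    by have /nbhs_ballP[e] := oO _ Oxy; exists e.
  have e2 : 0 < e / 2 by rewrite divr_gt0.
  have [n] := ltr_add_invr e2; rewrite add0r => hn.
  have n0 : 0 < n.+1%:R^-1 :> R by rewrite invr_gt0.
  have near_rat (z : R) : exists q : rat, ball (ratr q : R) n.+1%:R^-1 z.
    have lt1 : z - n.+1%:R^-1 < z + n.+1%:R^-1 by rewrite ltrBlDr -addrA ltrDl addr_gt0.
    have [q] := rat_in_itvoo lt1; rewrite in_itv /= => /andP[h1 h2]; exists q.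
    move: h1 h2; rewrite -ball_normE /ball_ /= ltr_norml.
    by move: n.+1%:R^-1 => d h1 h2; apply/andP; split; lra.
  have [q1 hq1] := near_rat x; have [q2 hq2] := near_rat y.
  exists (q1, q2, n) => //; case: asboolP => [_|[]]; first by split.
  move=> [u v] [/= hu hv]; apply: he; split => /=.
    apply: (@le_ball _ _ _ (n.+1%:R^-1 + n.+1%:R^-1)).
      by rewrite (splitr e) lerD// ltW.
    by apply: ball_triangle hu; exact: ball_sym.
  apply: (@le_ball _ _ _ (n.+1%:R^-1 + n.+1%:R^-1)).
    by rewrite (splitr e) lerD// ltW.
  by apply: ball_triangle hv; exact: ball_sym.
apply: countable_bigcupT_measurable => // q; case: ifP => _ //.
by apply: measurableX; apply: open_measurable; exact: ball_open.
Qed.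

Lemma open_continuous_measurable2 (O : set (R * R)) (f : R * R -> R) :
  open O -> (forall p, O p -> {for p, continuous f}) ->
  measurable_fun (O : set (mR * mR)) f.
Proof.
move=> oO cf; apply: (measurability _ (RGenOInfty.measurableE R)).
move=> /= _ [_ [a ->]] <-; apply: open_measurable2; rewrite preimage_itvoy.
rewrite openE => p [Op fpa]; apply: filterI; first exact: open_nbhs_nbhs.
apply: (cf p Op [set x | a < x]); apply: open_nbhs_nbhs; split => //.
Qed.

End PlaneMeasurability.

Lemma continuous_pairing {R : realType} (T : topologicalType) (u v : T -> R) (x : T) :
  {for x, continuous u} -> {for x, continuous v} ->
  {for x, continuous (fun y => (u y, v y))}.
Proof.
by move=> cu cv; apply: (@cvg_pair _ _ _ _ (nbhs (u x)) (nbhs (v x))).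
Qed.

(** * The divergence theorem on a disk *)

Section DiskDivergence.
Context {R : realType}.
Local Notation mu := (@lebesgue_measure R).

Definition rdisk (t : R) : set (R * R) := [set p | p.1 ^+ 2 + p.2 ^+ 2 < t ^+ 2].
Definition cdisk (t : R) : set (R * R) := [set p | p.1 ^+ 2 + p.2 ^+ 2 <= t ^+ 2].

Variables (t : R) (f F : R * R -> R).
Hypothesis t0 : 0 < t.
Hypothesis hF : forall x y : R, cdisk t (x, y) ->
  is_derive x 1 (fun x => F (x, y)) (f (x, y)).
Hypothesis cF : forall p, cdisk t p -> {for p, continuous F}.
Hypothesis cf : forall p, cdisk t p -> {for p, continuous f}.

Let s (y : R) : R := Num.sqrt (t ^+ 2 - y ^+ 2).

(** The integral over the horizontal slice at height [y]. As [Num.sqrt] is 0 on negative numbers,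
    [chord] vanishes for [|y| >= t] and is continuous on the whole line. *)
Definition chord (y : R) := F (s y, y) - F (- s y, y).

Let s_cont : continuous s.
Proof.
suff : continuous (Num.sqrt \o (fun y : R => t ^+ 2 - y ^+ 2)) by exact.
move=> y; apply: continuous_comp.
  apply: cvgB; first exact: cvg_cst.
  by apply: cvgM; exact: cvg_id.
exact: sqrt_continuous.
Qed.

Let s_out y : t ^+ 2 <= y ^+ 2 -> s y = 0.
Proof. by move=> h; apply: ler0_sqrtr; rewrite subr_le0. Qed.

Let s_sqr y : y ^+ 2 <= t ^+ 2 -> s y ^+ 2 = t ^+ 2 - y ^+ 2.
Proof. by move=> h; rewrite sqr_sqrtr// subr_ge0. Qed.

Lemma chord_out y : t ^+ 2 <= y ^+ 2 -> chord y = 0.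
Proof. by move=> /s_out h; rewrite /chord h oppr0 subrr. Qed.

Lemma chord_continuous : continuous chord.
Proof.
move=> y; have [h|h] := ltP (t ^+ 2) (y ^+ 2).
  apply: (near_cst_continuous 0); near=> z; apply: chord_out; apply: ltW.
  near: z.
  apply: (@cvgr_gt _ _ _ _ (fun z => z ^+ 2) (y ^+ 2)); last exact: h.
  by apply: cvgM; exact: cvg_id.
have sy := s_sqr h.
have d1 : cdisk t (s y, y) by rewrite /cdisk /= sy subrK.
have d2 : cdisk t (- s y, y) by rewrite /cdisk /= sqrrN sy subrK.
apply: cvgB.
  apply: (@continuous_comp _ _ _ (fun y => (s y, y)) F); last exact: cF.
  by apply: continuous_pairing; [exact: s_cont|exact: cvg_id].
apply: (@continuous_comp _ _ _ (fun y => (- s y, y)) F); last exact: cF.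
by apply: continuous_pairing; [apply: cvgN; exact: s_cont|exact: cvg_id].
Unshelve. all: by end_near. Qed.

Lemma integral_slice y : (\int[mu]_x ((f \_ (rdisk t)) (x, y))%:E)%E = (chord y)%:E.
Proof.
have [h|h] := leP (t ^+ 2) (y ^+ 2).
  rewrite chord_out// integral0_eq// => x _; rewrite patchE ifF//.
  apply/negbTE; rewrite notin_setE /rdisk /= => hx.
  have : 0 <= x ^+ 2 by rewrite sqr_ge0.
  by move: hx; lra.
have s0 : 0 < s y by rewrite sqrtr_gt0 subr_gt0.
have sy := s_sqr (ltW h).
have dd x : x \in `[- s y, s y] -> cdisk t (x, y).
  rewrite in_itv /= -ler_norml => xs; rewrite /cdisk /= -lerBrDr -sy.
  by rewrite -real_normK ?num_real// ler_sqr ?nnegrE// ltW.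
have cfy x : cdisk t (x, y) -> {for x, continuous (fun x => f (x, y))}.
  move=> xy; apply: (@continuous_comp _ _ _ (fun x => (x, y)) f); last exact: cf.
  by apply: continuous_pairing; [exact: cvg_id|exact: cvg_cst].
transitivity (\int[mu]_(x in `](- s y)%R, (s y)%R[) (f (x, y))%:E)%E.
  rewrite [RHS]integral_mkcond; apply: eq_integral => x _ /=.
  rewrite !patchE; have -> : ((x, y) \in rdisk t) = (x \in `]- s y, s y[%classic).
    apply/idP/idP; rewrite !inE /rdisk /= in_itv /= -ltr_norml.
      rewrite -ltrBrDr -sy => hx; rewrite -ltr_sqr ?nnegrE ?(ltW s0)//.
      by rewrite real_normK ?num_real.
    move=> hx; rewrite -ltrBrDr -sy -real_normK ?num_real//.
    by rewrite ltr_sqr ?nnegrE// ltW.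
  by case: ifP.
have ss : - s y < s y by rewrite (lt_trans _ s0)// oppr_lt0.
rewrite -(@integral_itv_bndoo _ _ _ _ true false); last first.
  have mf : measurable_fun `](- s y)%R, (s y)%R[ (fun x => f (x, y)).
    apply: open_continuous_measurable_fun; first exact: interval_open.
    by move=> x /set_mem /subset_itv_oo_cc /dd /cfy.
  exact/measurable_EFinP.
apply: (@continuous_FTC2 _ (fun x => f (x, y)) (fun x => F (x, y))) => //.
- by apply: continuous_in_subspaceT => x; rewrite inE => /dd /cfy.
- have cFy x : cdisk t (x, y) -> {for x, continuous (fun x => F (x, y))}.
    by move=> /hF xy; apply/differentiable_continuous/derivable1_diffP; case: xy.
  split=> [x xi||].
  + have /hF[] // : cdisk t (x, y) by apply: dd; exact: subset_itv_oo_cc xi.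
  + by apply/cvg_at_right_filter/cFy/dd; rewrite in_itv /= lexx ltW.
  + by apply/cvg_at_left_filter/cFy/dd; rewrite in_itv /= lexx ltW.
- move=> x xi; rewrite derive1E.
  by have /hF[] : cdisk t (x, y) by apply: dd; exact: subset_itv_oo_cc xi.
Qed.

Lemma integral_chord : (\int[mu]_y (chord y)%:E)%E = (RI (- t) t chord)%:E.
Proof.
have it := RI_integrable (- t) t chord_continuous.
rewrite /RI /Rintegral fineK; last exact: integrable_fin_num.
rewrite [RHS]integral_mkcond; apply: eq_integral => y _ /=; rewrite patchE.
case: ifPn => //; rewrite notin_setE /= in_itv /= -ler_norml => /negP; rewrite -ltNge => h.
rewrite chord_out// -[leRHS]real_normK ?num_real// ler_sqr ?nnegrE ?(ltW t0)//.
exact: ltW.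
Qed.

Lemma polar_in_cdisk a : cdisk t (t * cos a, t * sin a).
Proof. by rewrite /cdisk /= !exprMn -mulrDr cos2Dsin2 mulr1. Qed.

Lemma polar_continuous (G : R * R -> R) :
  (forall p, cdisk t p -> {for p, continuous G}) ->
  continuous (fun a => G (t * cos a, t * sin a)).
Proof.
move=> cG a; apply: (@continuous_comp _ _ _ (fun a => (t * cos a, t * sin a)) G).
  by apply: continuous_pairing; apply: cvgM;
    [exact: cvg_cst|exact: continuous_cos|exact: cvg_cst|exact: continuous_sin].
by apply: cG; exact: polar_in_cdisk.
Qed.

(** With [y = t sin a] the right ends of the chords run over the right half circle; the left ends
    lie at the angle [pi - a] and give the other half. The range of angles is then moved to
    [[0, 2 pi]] by periodicity. *)
Lemma chord_polar : RI (- t) t chord =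
  RI 0 (2 * pi) (fun a => F (t * cos a, t * sin a) * (t * cos a)).
Proof.
pose g a := F (t * cos a, t * sin a) * (t * cos a).
have cg : continuous g.
  move=> a; apply: cvgM; first exact: polar_continuous.
  by apply: cvgM; [exact: cvg_cst|exact: continuous_cos].
have p0 : 0 < pi :> R by exact: pi_gt0.
have pp : - (pi / 2) <= pi / 2 :> R by lra.
have tt : t * sin (- (pi / 2)) <= t * sin (pi / 2).
  by rewrite sinN sin_pihalf; move: t0; lra.
have cu' : continuous (fun a => t * cos a).
  by move=> a; apply: cvgM; [exact: cvg_cst|exact: continuous_cos].
have du (a : R) : is_derive a 1 (fun a => t * sin a) (t * cos a).
  exact: (is_deriveZ t (is_derive_sin a)).
have := RI_substitution pp tt chord_continuous cu' du.
rewrite sinN sin_pihalf mulrN1 mulr1 => <-.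
rewrite (@eq_RI _ _ _ _ (fun a => g a + g (pi - a))); last first.
  move=> a; rewrite in_itv /= => /andP[a1 a2]; rewrite /chord /g /s.
  have ca : 0 <= cos a by apply: cos_ge0_pihalf; rewrite a1 a2.
  have -> : t ^+ 2 - (t * sin a) ^+ 2 = (t * cos a) ^+ 2.
    by rewrite !exprMn cos2sin2; ring.
  rewrite sqrtr_sqr ger0_norm ?mulr_ge0 ?(ltW t0)//.
  have -> : cos (pi - a) = - cos a by rewrite cosB cospi sinpi; ring.
  have -> : sin (pi - a) = sin a by rewrite sinB cospi sinpi; ring.
  by rewrite !mulrN; ring.
have cr : continuous (fun a => g (pi - a)).
  move=> a; apply: (@continuous_comp _ _ _ (fun a => pi - a) g); last exact: cg.
  by apply: cvgB; [exact: cvg_cst|exact: cvg_id].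
rewrite RI_add// RI_reflect//.
have -> : pi - pi / 2 = pi / 2 :> R by lra.
have -> : pi - - (pi / 2) = - (pi / 2) + 2 * pi :> R by lra.
rewrite -RI_split//; [|lra].
rewrite -[2 * pi in RHS]add0r; apply: RI_periodic => //; first by lra.
by move=> a; rewrite /g mulr_natl cosD2pi sinD2pi.
Qed.

End DiskDivergence.

Section DiskIntegral.
Context {R : realType}.
Local Notation mu := (@lebesgue_measure R).
Local Notation mR := (measurableTypeR R).

Lemma continuous_sqnorm : continuous (fun p : R * R => p.1 ^+ 2 + p.2 ^+ 2).
Proof.
by move=> p; apply: cvgD; apply: cvgM; [exact: cvg_fst|exact: cvg_fst|exact: cvg_snd|exact: cvg_snd].
Qed.

Lemma open_rdisk t : open (@rdisk R t).
Proof.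
apply: (@open_comp _ _ _ [set x | x < t ^+ 2]); last exact: open_lt.
by move=> p _; exact: continuous_sqnorm.
Qed.

Lemma rdisk_sub_cdisk t : @rdisk R t `<=` cdisk t.
Proof. by move=> p /ltW. Qed.

Lemma cdisk_box t : 0 <= t -> @cdisk R t `<=` `[- t, t] `*` `[- t, t].
Proof.
move=> t0 [x y]; rewrite /cdisk /= => h.
have hx := sqr_ge0 x; have hy := sqr_ge0 y.
have aux z : z ^+ 2 <= t ^+ 2 -> - t <= z <= t.
  by rewrite -ler_norml -{1}real_normK ?num_real// ler_sqr ?nnegrE.
by split => /=; rewrite in_itv /=; apply: aux; lra.
Qed.

Lemma compact_cdisk t : 0 <= t -> compact (@cdisk R t).
Proof.
move=> t0; apply: subclosed_compact (cdisk_box t0).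
  apply: (@preimage_closed _ _ _ [set x | x <= t ^+ 2]); last exact: closed_le.
  by move=> p _; exact: continuous_sqnorm.
by apply: compact_setX; exact: segment_compact.
Qed.

Lemma cdisk_bounded (f : R * R -> R) t : 0 <= t ->
  (forall p, cdisk t p -> {for p, continuous f}) ->
  exists M, forall p, cdisk t p -> `|f p| <= M.
Proof.
move=> t0 cf.
have : compact (f @` cdisk t).
  apply: continuous_compact (compact_cdisk t0).
  by apply: continuous_in_subspaceT => p; rewrite inE; exact: cf.
move=> /(@compact_bounded R R^o) [M [_ hM]]; exists (M + 1) => p pt.
by apply: (hM (M + 1)); [rewrite ltrDl|exists p].
Qed.

Lemma disk_integrable (f : R * R -> R) t : 0 < t ->
  (forall p, cdisk t p -> {for p, continuous f}) ->
  (mu \x mu)%E.-integrable (rdisk t : set (mR * mR)) (EFin \o f).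
Proof.
move=> t0 cf.
have mD : measurable (rdisk t : set (mR * mR)) by apply: open_measurable2; exact: open_rdisk.
have mf : measurable_fun (rdisk t : set (mR * mR)) f.
  apply: open_continuous_measurable2; first exact: open_rdisk.
  by move=> p /rdisk_sub_cdisk /cf.
have fin : ((mu \x mu)%E (rdisk t : set (mR * mR)) < +oo)%E.
  apply: (@le_lt_trans _ _ ((mu \x mu)%E (`[- t, t] `*` `[- t, t]))).
    apply: le_measure; rewrite ?inE//.
      by apply: measurableX; exact: measurable_itv.
    by move=> p /rdisk_sub_cdisk; apply: cdisk_box; exact: ltW.
  rewrite product_measure1E; [|exact: measurable_itv|exact: measurable_itv].
  by rewrite /= lebesgue_measure_itv /=; case: ifP => _; rewrite -?EFinD -?EFinM ?mule0 ltry.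
apply: measurable_bounded_integrable => //.
have [M hM] := cdisk_bounded (ltW t0) cf.
exists M; split; first exact: num_real.
by move=> N MN p /rdisk_sub_cdisk /hM h; exact: le_trans h (ltW MN).
Qed.

Lemma disk_integrableT (f : R * R -> R) t : 0 < t ->
  (forall p, cdisk t p -> {for p, continuous f}) ->
  (mu \x mu)%E.-integrable [set: mR * mR] (EFin \o (f \_ (rdisk t))).
Proof.
move=> t0 cf; rewrite -restrict_EFin; apply/integrable_restrict => //.
  by apply: open_measurable2; exact: open_rdisk.
by rewrite setTI; exact: disk_integrable.
Qed.

Lemma disk_divergence_x (f F : R * R -> R) t : 0 < t ->
  (forall x y : R, cdisk t (x, y) -> is_derive x 1 (fun x => F (x, y)) (f (x, y))) ->
  (forall p, cdisk t p -> {for p, continuous F}) ->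
  (forall p, cdisk t p -> {for p, continuous f}) ->
  \int[(mu \x mu)%E]_(p in rdisk t) f p =
  RI 0 (2 * pi) (fun a => F (t * cos a, t * sin a) * (t * cos a)).
Proof.
move=> t0 hF cF cf; rewrite Rintegral_mkcond /Rintegral.
have := integral21_prod_meas1 (disk_integrableT t0 cf).
rewrite /fubini_G => <-.
under eq_integral do rewrite (integral_slice hF cf).
by rewrite (integral_chord t0 cF)//= (chord_polar t0 cF).
Qed.

Lemma disk_divergence_y (f F : R * R -> R) t : 0 < t ->
  (forall x y : R, cdisk t (x, y) -> is_derive y 1 (fun y => F (x, y)) (f (x, y))) ->
  (forall p, cdisk t p -> {for p, continuous F}) ->
  (forall p, cdisk t p -> {for p, continuous f}) ->
  \int[(mu \x mu)%E]_(p in rdisk t) f p =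
  RI 0 (2 * pi) (fun a => F (t * cos a, t * sin a) * (t * sin a)).
Proof.
move=> t0 hF cF cf; rewrite Rintegral_mkcond /Rintegral.
have := integral12_prod_meas1 (disk_integrableT t0 cf).
rewrite /fubini_F => <-.
(* Exchanging the coordinates reduces to horizontal slices. On the circle the exchange is the
   reflection of the angle [a] to [pi / 2 - a]. *)
pose F' (p : R * R) := F (p.2, p.1); pose f' (p : R * R) := f (p.2, p.1).
have sw p : cdisk t p -> cdisk t (p.2, p.1) by rewrite /cdisk /= addrC.
have cs (G : R * R -> R) : (forall p, cdisk t p -> {for p, continuous G}) ->
    forall p, cdisk t p -> {for p, continuous (fun p => G (p.2, p.1))}.
  move=> cG p pt; apply: (@continuous_comp _ _ _ (fun p => (p.2, p.1)) G).
    by apply: continuous_pairing; [exact: cvg_snd|exact: cvg_fst].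
  exact/cG/sw.
have cF' : forall p, cdisk t p -> {for p, continuous F'} by exact: cs.
have cf' : forall p, cdisk t p -> {for p, continuous f'} by exact: cs.
have hF' (x y : R) : cdisk t (x, y) -> is_derive x 1 (fun x => F' (x, y)) (f' (x, y)).
  by move=> /sw /hF.
have pE (x y : R) : (f \_ (rdisk t)) (x, y) = (f' \_ (rdisk t)) (y, x).
  rewrite !patchE; have -> // : ((x, y) \in rdisk t) = ((y, x) \in rdisk t).
  by apply/idP/idP; rewrite !inE /rdisk /= addrC.
under eq_integral => x _.
  under eq_integral do rewrite /= pE.
  rewrite (integral_slice hF' cf').
  over.
rewrite (integral_chord t0 cF')//= (chord_polar t0 cF') /F' /=.
pose g a := F (t * cos a, t * sin a) * (t * sin a).
have cg : continuous g.
  move=> a; apply: cvgM; first exact: polar_continuous.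
  by apply: cvgM; [exact: cvg_cst|exact: continuous_sin].
have p0 : 0 < pi :> R by exact: pi_gt0.
transitivity (RI 0 (2 * pi) (fun a => g (pi / 2 - a))).
  by apply: eq_RI => a _; rewrite /g cosB sinB cos_pihalf sin_pihalf !mul0r !mul1r add0r subr0.
rewrite RI_reflect//; last by lra.
have -> : pi / 2 - 0 = (pi / 2 - 2 * pi) + 2 * pi :> R by lra.
rewrite -[2 * pi in RHS]add0r; apply: RI_periodic => //; first by lra.
by move=> a; rewrite /g mulr_natl cosD2pi sinD2pi.
Qed.

End DiskIntegral.

(** * From the divergence theorem to means over circles *)

Section SmoothJensen.
Context {R : realType}.
Local Notation mu := (@lebesgue_measure R).
Local Notation mR := (measurableTypeR R).

Variables (r : R) (W : set (R * R)) (h hx hy hxx hyy : R * R -> R).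
Hypothesis r0 : 0 < r.
Hypothesis oW : open W.
Hypothesis rW : cdisk r `<=` W.
Hypothesis hrad : forall (x y a b : R), W (x, y) ->
  is_derive (0 : R) 1 (fun t => h (x + t * a, y + t * b)) (a * hx (x, y) + b * hy (x, y)).
Hypothesis dhx : forall x y : R, W (x, y) ->
  is_derive x 1 (fun x => hx (x, y)) (hxx (x, y)).
Hypothesis dhy : forall x y : R, W (x, y) ->
  is_derive y 1 (fun y => hy (x, y)) (hyy (x, y)).
Hypothesis ch : forall p, W p -> {for p, continuous h}.
Hypothesis chx : forall p, W p -> {for p, continuous hx}.
Hypothesis chy : forall p, W p -> {for p, continuous hy}.
Hypothesis chxx : forall p, W p -> {for p, continuous hxx}.
Hypothesis chyy : forall p, W p -> {for p, continuous hyy}.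

Let pol (q : R * R) : R * R := (q.1 * cos q.2, q.1 * sin q.2).
(** The radial derivative of [h] in polar coordinates. *)
Let G (q : R * R) : R := cos q.2 * hx (pol q) + sin q.2 * hy (pol q).

Let pol_cdisk t a : 0 <= t -> t <= r -> cdisk r (pol (t, a)).
Proof.
move=> t0 tr; rewrite /cdisk /= !exprMn -mulrDr cos2Dsin2 mulr1.
by rewrite ler_sqr ?nnegrE// (le_trans t0).
Qed.

Let pol_cont : continuous pol.
Proof.
move=> q; apply: (@continuous_pairing R _ (fun q : R * R => q.1 * cos q.2)
  (fun q : R * R => q.1 * sin q.2) q); apply: cvgM.
- exact: cvg_fst.
- by apply: (@continuous_comp _ _ _ snd cos); [exact: cvg_snd|exact: continuous_cos].
- exact: cvg_fst.
- by apply: (@continuous_comp _ _ _ snd sin); [exact: cvg_snd|exact: continuous_sin].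
Qed.

Let V : set (R * R) := pol @^-1` W.

Let oV : open V.
Proof. by apply: open_comp => // q _; exact: pol_cont. Qed.

Let G_cont q : V q -> {for q, continuous G}.
Proof.
move=> Vq; apply: cvgD; apply: cvgM.
- by apply: (@continuous_comp _ _ _ snd cos); [exact: cvg_snd|exact: continuous_cos].
- by apply: (@continuous_comp _ _ _ pol hx); [exact: pol_cont|exact: chx].
- by apply: (@continuous_comp _ _ _ snd sin); [exact: cvg_snd|exact: continuous_sin].
- by apply: (@continuous_comp _ _ _ pol hy); [exact: pol_cont|exact: chy].
Qed.

Let Q : set (R * R) := `]0, r] `*` `[0, 2 * pi].

Let QV : Q `<=` V.
Proof.
move=> [t a] [/=]; rewrite in_itv /= => /andP[t0 tr] _.
by apply: rW; apply: pol_cdisk => //; exact: ltW.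
Qed.

Let mQ : measurable (Q : set (mR * mR)).
Proof. by apply: measurableX; exact: measurable_itv. Qed.

Let G_integrable : (mu \x mu)%E.-integrable [set: mR * mR] (EFin \o (G \_ Q)).
Proof.
have fin : ((mu \x mu)%E (`]0%R, r] `*` `[0%R, (2 * pi)%R]) < +oo)%E.
  rewrite product_measure1E; [|exact: measurable_itv|exact: measurable_itv].
  by rewrite /= !lebesgue_measure_itv /=; do 2!case: ifP => _;
    rewrite -?EFinD ?mule0 ?mul0e -?EFinM ltry.
rewrite -restrict_EFin; apply/integrable_restrict => //; rewrite setTI.
apply: measurable_bounded_integrable => //.
- by apply: measurable_funS (open_continuous_measurable2 oV G_cont) => //;
    exact: open_measurable2.
have rr := ltW r0.
have [M1 h1] := cdisk_bounded rr (fun p hp => chx (rW hp)).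
have [M2 h2] := cdisk_bounded rr (fun p hp => chy (rW hp)).
exists (M1 + M2); split; first exact: num_real.
move=> N MN [t a] [/=]; rewrite in_itv /= => /andP[t0 tr] _.
have d : cdisk r (pol (t, a)) by apply: pol_cdisk => //; exact: ltW.
apply: le_trans (ltW MN); rewrite (le_trans (ler_normD _ _))// !normrM.
apply: lerD.
  by rewrite -[leRHS]mul1r ler_pM ?cos_max// h1.
by rewrite -[leRHS]mul1r ler_pM ?sin_max// h2.
Qed.

(** The divergence theorem for the gradient of [h], whose flux density through the circle is the
    radial derivative [G]. *)
Lemma disk_laplacian t : 0 < t -> t <= r ->
  \int[(mu \x mu)%E]_(p in rdisk t) (hxx p + hyy p) =
  RI 0 (2 * pi) (fun a => G (t, a)) * t.
Proof.
move=> t0 tr.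
have tW p : cdisk t p -> W p.
  move=> hp; apply: rW; apply: le_trans hp _.
  by rewrite ler_sqr ?nnegrE ?(ltW t0) ?(ltW r0).
rewrite RintegralD; last 3 first.
- by apply: open_measurable2; exact: open_rdisk.
- by apply: disk_integrable => // p /tW /chxx.
- by apply: disk_integrable => // p /tW /chyy.
rewrite (@disk_divergence_x _ hxx hx t t0 (fun x y hp => dhx (tW _ hp))
  (fun p hp => chx (tW p hp)) (fun p hp => chxx (tW p hp))).
rewrite (@disk_divergence_y _ hyy hy t t0 (fun x y hp => dhy (tW _ hp))
  (fun p hp => chy (tW p hp)) (fun p hp => chyy (tW p hp))).
have c1 := polar_continuous (fun p hp => chx (tW p hp)).
have c2 := polar_continuous (fun p hp => chy (tW p hp)).
have c1' : continuous (fun a => hx (t * cos a, t * sin a) * (t * cos a)).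
  by move=> a; apply: cvgM; [exact: c1|apply: cvgM; [exact: cvg_cst|exact: continuous_cos]].
have c2' : continuous (fun a => hy (t * cos a, t * sin a) * (t * sin a)).
  by move=> a; apply: cvgM; [exact: c2|apply: cvgM; [exact: cvg_cst|exact: continuous_sin]].
have cG : continuous (fun a => G (t, a)).
  move=> a; apply: cvgD; apply: cvgM; [exact: continuous_cos|exact: c1|exact: continuous_sin|exact: c2].
rewrite -RI_add// [RHS]mulrC -RI_scale//; apply: eq_RI => a _ /=.
by rewrite /G /pol /=; ring.
Qed.

(** Dividing [disk_laplacian] by [t] leaves the integral over all angles of the radial derivative at
    radius [t]. Fubini lets the radius be integrated first, along each ray from the origin. *)
Lemma smooth_jensen :
  \int[mu]_(t in `]0, r])
    ((\int[(mu \x mu)%E]_(p in rdisk t) (hxx p + hyy p)) / t) =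
  RI 0 (2 * pi) (fun a => h (r * cos a, r * sin a)) - 2 * pi * h (0, 0).
Proof.
have Gt_cont t : 0 <= t <= r -> continuous (fun a => G (t, a)).
  move=> /andP[t0 tr] a; apply: (@continuous_comp _ _ _ (fun a => (t, a)) G).
    by apply: continuous_pairing; [exact: cvg_cst|exact: cvg_id].
  by apply: G_cont; apply: rW; exact: pol_cdisk.
have Ga_cont t a : 0 <= t <= r -> {for t, continuous (fun t => G (t, a))}.
  move=> /andP[t0 tr]; apply: (@continuous_comp _ _ _ (fun t => (t, a)) G).
    by apply: continuous_pairing; [exact: cvg_id|exact: cvg_cst].
  by apply: G_cont; apply: rW; exact: pol_cdisk.
have rad a t : 0 <= t <= r ->
    is_derive t 1 (fun t => h (t * cos a, t * sin a)) (G (t, a)).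
  move=> /andP[t0 tr].
  have D := hrad (cos a) (sin a) (rW (pol_cdisk a t0 tr)).
  have du : is_derive t 1 (fun u : R => u - t) 1.
    have := is_deriveB (is_derive_id t (1 : R)) (is_derive_cst t t 1).
    by rewrite subr0; exact.
  rewrite -(subrr t) in D.
  have := @is_derive1_comp _ _ (fun u : R => u - t) t _ _ D du.
  rewrite /GRing.scale /= mulr1; congr is_derive; apply/funext => u /=.
  by rewrite -!mulrDl addrC subrK.
have main : (\int[mu]_(t in `]0%R, r])
    ((\int[(mu \x mu)%E]_(p in rdisk t) (hxx p + hyy p)) / t)%:E =
    \int[mu]_(a in `[0%R, (2 * pi)%R])
      (h (r * cos a, r * sin a) - h (0%R, 0%R))%:E)%E.
  transitivity (\int[mu]_t \int[mu]_a ((G \_ Q) (t, a))%:E)%E.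
    rewrite integral_mkcond; apply: eq_integral => t _; rewrite patchE.
    case: ifPn => [|tn].
      rewrite inE /= in_itv /= => /andP[t0 tr].
      rewrite disk_laplacian// mulfK ?gt_eqF//.
      rewrite /RI /Rintegral fineK; last first.
        by apply: integrable_fin_num => //; apply: RI_integrable; apply: Gt_cont; rewrite ltW.
      rewrite integral_mkcond; apply: eq_integral => a _ /=; rewrite !patchE /Q in_setX.
      have tI : t \in `]0, r]%classic by rewrite mem_set//= in_itv /= t0.
      by rewrite /= tI /=; case: ifP.
    rewrite integral0_eq// => a _; rewrite patchE ifF//.
    by apply/negbTE; move: tn; apply: contraNN; rewrite /Q in_setX => /andP[].
  rewrite (Fubini G_integrable) [RHS]integral_mkcond; apply: eq_integral => a _.
  rewrite [RHS]patchE; case: ifPn => [|an].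
    rewrite inE => aI.
    transitivity (\int[mu]_(t in `]0%R, r]) (G (t, a))%:E)%E.
      rewrite [RHS]integral_mkcond; apply: eq_integral => t _ /=; rewrite !patchE /Q in_setX.
      by rewrite (mem_set aI) andbT; case: ifP.
    have cGa : {within `[0, r], continuous (fun t => G (t, a))}.
      by apply: continuous_in_subspaceT => t; rewrite inE /= in_itv; exact: Ga_cont.
    rewrite integral_itv_obnd_cbnd; last first.
      have := continuous_compact_integrable (@segment_compact _ _ _) cGa.
      move=> /(measurable_int mu); apply: measurable_funS => //.
      by apply: subset_itvr; rewrite bnd_simp.
    have cF (t : R) : 0 <= t <= r ->
        {for t, continuous (fun t : R => h (t * cos (a : R), t * sin (a : R)))}.
      by move=> /(rad a)[? _]; exact/differentiable_continuous/derivable1_diffP.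
    rewrite (@continuous_FTC2 _ _ (fun t => h (t * cos a, t * sin a)) _ _ r0 cGa).
    - by rewrite !mul0r.
    - split=> [t||].
      + by move=> /subset_itv_oo_cc; rewrite in_itv => /(rad a)[].
      + by apply/cvg_at_right_filter/cF; rewrite lexx ltW.
      + by apply/cvg_at_left_filter/cF; rewrite lexx ltW.
    - move=> t /subset_itv_oo_cc; rewrite in_itv derive1E => /(rad a).
      by move=> [].
  rewrite integral0_eq// => t _; rewrite /= patchE ifF//.
  by apply/negbTE; move: an; apply: contraNN; rewrite /Q in_setX => /andP[].
rewrite /Rintegral main -/(Rintegral _ _ _).
have c0 : continuous (fun a => h (r * cos a, r * sin a)).
  by apply: polar_continuous => p /rW; exact: ch.
have := RI_sub 0 (2 * pi) c0 (@cst_continuous _ _ (h (0, 0))).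
rewrite RI_cst ?mulr_ge0 ?pi_ge0// subr0 mulrC (mulrC (h _)) => <-.
by [].
Qed.

End SmoothJensen.

(** * Derivatives along real lines *)

Section RealLine.
Context {R : realType}.
Local Notation C := (plane R).
Local Notation nc := (@Normc.normc R).
Local Notation Re := (@complex.Re R).
Local Notation Im := (@complex.Im R).

(** [V] is a normed space over [R[i]] only, hence the coerced real scalar in the quotient. The base
    point is 0, as the functions are restrictions to lines [z + t d]. *)
Definition real_deriv (V : normedModType R[i]) (f : R -> V) (l : V) :=
  (t^-1)%:C *: (f t - f 0) @[t --> (0 : R)^'] --> l.

Lemma is_derive_real_deriv (V : normedModType R[i]) (f : C -> V) (z d : C) (l : V) :
  is_derive z (1 : C) f l -> real_deriv (fun t => f (z + t%:C * d)) ((d : R[i]) *: l).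
Proof.
move=> [fd <-]; rewrite /real_deriv mul0r addr0.
have [->|d0] := eqVneq d 0.
  rewrite scale0r; under eq_fun do rewrite mulr0 addr0 subrr scaler0.
  exact: cvg_cst.
have tod : (t%:C * d : C) @[t --> (0 : R)^'] --> (0 : C)^'.
  move=> A [/= e e0 he]; have [eE e1] := ltcR_re e0.
  exists (complex.Re e / nc d) => /=; first by rewrite divr_gt0// nc_gt0.
  move=> t /=; rewrite sub0r normrN => td t0; apply: he.
    rewrite /= sub0r normrN normCE Normc.normcM ncR eE ltcR.
    by rewrite -ltr_pdivlMr// nc_gt0.
  by rewrite mulf_neq0// -nc_eq0 ncR normr_eq0.
have h := cvg_comp _ _ tod fd.
have {}h : (d : R[i]) *: ((t%:C * d)^-1 *: ((f \o shift z) ((t%:C * d) *: 1) - f z))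
    @[t --> (0 : R)^'] --> (d : R[i]) *: 'D_1 f z.
  by apply: cvgZ; [exact: cvg_cst|exact: h].
apply: cvg_trans h.
apply: near_eq_cvg; near=> t => /=.
have t0 : t != 0 by near: t; exact: (@withinT _ (nbhs (0 : R)) (fun y => y != 0) _).
rewrite scalerA /GRing.scale /= mulr1 (addrC z); congr (_ *: _).
have tC : t%:C != 0 :> R[i] by rewrite -nc_eq0 ncR normr_eq0.
by rewrite fmorphV /= invfM mulrCA mulfV// mulr1.
Unshelve. all: by end_near. Qed.

Lemma real_deriv_Re (f : R -> C) l : real_deriv f l -> is_derive (0 : R) 1 (Re \o f) (Re l).
Proof.
move=> /cvgC_ReIm[+ _] => fl.
have {}fl : h^-1 *: (((Re \o f) \o shift 0) (h *: 1) - (Re \o f) 0) @[h --> (0 : R)^'] --> Re l.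
  apply: cvg_trans fl; apply: near_eq_cvg; near=> h.
  rewrite /GRing.scale /= mulr1 addr0 -raddfB.
  by case: (f h - f 0) => a b /=; rewrite mul0r subr0.
by apply: DeriveDef; [apply/cvg_ex; exists (Re l)|exact: cvg_lim].
Unshelve. all: by end_near. Qed.

Lemma real_deriv_Im (f : R -> C) l : real_deriv f l -> is_derive (0 : R) 1 (Im \o f) (Im l).
Proof.
move=> /cvgC_ReIm[_ +] => fl.
have {}fl : h^-1 *: (((Im \o f) \o shift 0) (h *: 1) - (Im \o f) 0) @[h --> (0 : R)^'] --> Im l.
  apply: cvg_trans fl; apply: near_eq_cvg; near=> h.
  rewrite /GRing.scale /= mulr1 addr0 -raddfB.
  by case: (f h - f 0) => a b /=; rewrite mul0r addr0.
by apply: DeriveDef; [apply/cvg_ex; exists (Im l)|exact: cvg_lim].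
Unshelve. all: by end_near. Qed.

Lemma real_deriv_continuous (V : normedModType R[i]) (f : R -> V) (l : V) : real_deriv f l ->
  f t @[t --> (0 : R)^'] --> f 0.
Proof.
move=> fl.
have h : (t%:C : C) @[t --> (0 : R)^'] --> (0 : C).
  by apply: (@cvgRC R _ _ _ id 0); apply: cvg_within_filter; exact: cvg_id.
have h2 : t%:C *: ((t^-1)%:C *: (f t - f 0)) + f 0 @[t --> (0 : R)^'] --> f 0.
  rewrite -[X in _ --> X]add0r -(scale0r l).
  by apply: cvgD; [apply: cvgZ; [exact: h|exact: fl]|exact: cvg_cst].
apply: cvg_trans h2.
apply: near_eq_cvg; near=> t => /=.
have t0 : t != 0 by near: t; exact: (@withinT _ (nbhs (0 : R)) (fun y => y != 0) _).
have tC : t%:C != 0 :> R[i] by rewrite -nc_eq0 ncR normr_eq0.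
by rewrite scalerA fmorphV /= divff// scale1r subrK.
Unshelve. all: by end_near. Qed.

End RealLine.

(** * Second derivatives of real functions on the plane *)

Section Smooth2.
Context {R : realType}.
Local Notation C := (plane R).
Local Notation nc := (@Normc.normc R).
Local Notation Re := (@complex.Re R).
Local Notation Im := (@complex.Im R).
Local Notation mu := (@lebesgue_measure R).

(* [p] is [dh / dz], so that the derivative of [h] in the direction [d] is
   [2 Re (d p)] and the Laplacian of [h] is [2 (pxx - pyy)]. *)
Definition smooth2_at (h : C -> R) (p : C -> C) (pxx pyy : C -> R) (z : C) : Prop :=
  [/\ forall d : C, is_derive (0 : R) 1 (fun t : R => h (z + t%:C * d)) (2 * Re (d * p z)),
      is_derive (0 : R) 1 (fun t : R => Re (p (z + t%:C * 1))) (pxx z),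
      is_derive (0 : R) 1 (fun t : R => Im (p (z + t%:C * 'i%C))) (pyy z),
      {for z, continuous h} /\ {for z, continuous p} &
      {for z, continuous pxx} /\ {for z, continuous pyy}].

Lemma near_line (z d : C) (e : R) (P : C -> Prop) : 0 < e ->
  (forall w, nc (w - z) < e -> P w) -> \forall t \near (0 : R), P (z + t%:C * d).
Proof.
move=> e0 hP.
have h : (t%:C * d : C) @[t --> (0 : R)] --> (0 : C).
  rewrite -(mul0r d); apply: cvgM; last exact: cvg_cst.
  by apply: (@cvgRC R _ _ _ id 0); exact: cvg_id.
move/cvgC : h => /(_ e e0); apply: filterS => t.
by rewrite sub0r ncN => ht; apply: hP; rewrite addrAC subrr add0r.
Qed.

Lemma near_continuousC (T : topologicalType) (f g : C -> T) (z : C) (e : R) : 0 < e ->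
  (forall w, nc (w - z) < e -> f w = g w) -> {for z, continuous g} -> {for z, continuous f}.
Proof.
move=> e0 fg cg; have fgz : f z = g z by apply: fg; rewrite subrr Normc.normc0.
have : f w @[w --> z] --> g z.
  apply: cvg_trans cg; apply: (@near_eq_cvg _ _ (nbhs z) (nbhs_filter z)).
  by apply/nbhsC; exists e => // w /fg.
by rewrite -fgz.
Qed.

Lemma smooth2_atB h1 p1 a1 b1 h2 p2 a2 b2 z :
  smooth2_at h1 p1 a1 b1 z -> smooth2_at h2 p2 a2 b2 z ->
  smooth2_at (fun w => h1 w - h2 w) (fun w => p1 w - p2 w)
    (fun w => a1 w - a2 w) (fun w => b1 w - b2 w) z.
Proof.
move=> [d1 x1 y1 [c1 q1] [u1 v1]] [d2 x2 y2 [c2 q2] [u2 v2]]; split.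
- move=> d; have := is_deriveB (d1 d) (d2 d).
  by rewrite mulrBr raddfB mulrBr; exact.
- have := is_deriveB x1 x2; congr is_derive; apply/funext => t.
  by rewrite !fctE /= raddfB.
- have := is_deriveB y1 y2; congr is_derive; apply/funext => t.
  by rewrite !fctE /= raddfB.
- by split; [exact: (cvgB c1 c2)|exact: (cvgB q1 q2)].
- by split; [exact: (cvgB u1 u2)|exact: (cvgB v1 v2)].
Qed.

Definition dz (h : C -> R) : C -> C := wirtinger (fun w : C => (h w)%:C).
Definition dzxx (h : C -> R) (z : C) : R :=
  derive1 (fun t : R => Re (dz h (z + t%:C * 1))) 0.
Definition dzyy (h : C -> R) (z : C) : R :=
  derive1 (fun t : R => Im (dz h (z + t%:C * 'i%C))) 0.

Lemma is_derive1E (f : R -> R) (x l : R) : is_derive x 1 f l -> derive1 f x = l.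
Proof. by move=> [_ <-]; rewrite derive1E. Qed.

(** The model [h'] may change from point to point, whereas [dz h], [dzxx h] and [dzyy h] do not;
    local models thus combine to a statement on an open set. Agreement on a whole neighbourhood
    matters, because the second Wirtinger derivative differentiates [dz h]. *)
Lemma smooth2_near (h h' : C -> R) p' pxx' pyy' (z : C) (e : R) : 0 < e ->
  (forall w, nc (w - z) < e -> h w = h' w) ->
  (forall w, nc (w - z) < e -> smooth2_at h' p' pxx' pyy' w) ->
  [/\ smooth2_at h (dz h) (dzxx h) (dzyy h) z, dzxx h z = pxx' z & dzyy h z = pyy' z].
Proof.
move=> e0 hh' H.
have z0 w : nc (w - z) < e -> 0 < e - nc (w - z) by rewrite subr_gt0.
have zw w x : nc (x - w) < e - nc (w - z) -> nc (x - z) < e.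
  move=> hx; rewrite (_ : x - z = (x - w) + (w - z)); last by ring.
  by rewrite (le_lt_trans (ncD _ _))// -ltrBrDr.
have Dh w d : nc (w - z) < e ->
    is_derive (0 : R) 1 (fun t : R => h (w + t%:C * d)) (2 * Re (d * p' w)).
  move=> wz; have [D _ _ _ _] := H w wz; apply: near_eq_is_derive (D d).
  by apply: (@near_line w d _ (fun x => h' x = h x) (z0 w wz)) => x /zw /hh' ->.
have dzE w : nc (w - z) < e -> dz h w = p' w.
  move=> wz; rewrite /dz /wirtinger /real_directional.
  rewrite (is_derive1E (Dh w 1 wz)) (is_derive1E (Dh w 'i%C wz)).
  rewrite (is_derive1E (is_derive_cst (0 : R) (0 : R) 1)).
  case: (p' w) => a b; apply/eqP; rewrite eq_complex /=; apply/andP; split; apply/eqP.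
    by field.
  by field.
have Dx w : nc (w - z) < e ->
    is_derive (0 : R) 1 (fun t : R => Re (dz h (w + t%:C * 1))) (pxx' w).
  move=> wz; have [_ D _ _ _] := H w wz; apply: near_eq_is_derive D.
  by apply: (@near_line w 1 _ (fun x => Re (p' x) = Re (dz h x)) (z0 w wz)) => x /zw /dzE ->.
have Dy w : nc (w - z) < e ->
    is_derive (0 : R) 1 (fun t : R => Im (dz h (w + t%:C * 'i%C))) (pyy' w).
  move=> wz; have [_ _ D _ _] := H w wz; apply: near_eq_is_derive D.
  by apply: (@near_line w 'i%C _ (fun x => Im (p' x) = Im (dz h x)) (z0 w wz)) => x /zw /dzE ->.
have xxE w : nc (w - z) < e -> dzxx h w = pxx' w by move=> /Dx /is_derive1E.
have yyE w : nc (w - z) < e -> dzyy h w = pyy' w by move=> /Dy /is_derive1E.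
have zz : nc (z - z) < e by rewrite subrr Normc.normc0.
have [_ _ _ [c1 c2] [c3 c4]] := H z zz.
split; [split|exact: xxE|exact: yyE].
- by move=> d; rewrite (dzE z zz); exact: (Dh z d zz).
- by rewrite (xxE z zz); exact: (Dx z zz).
- by rewrite (yyE z zz); exact: (Dy z zz).
- by split; [exact: near_continuousC hh' c1|exact: near_continuousC dzE c2].
- by split; [exact: near_continuousC xxE c3|exact: near_continuousC yyE c4].
Qed.

Lemma wirtinger_bar_dz (h : C -> R) (z : C) :
  Re (wirtinger_bar (dz h) z) = (dzxx h z - dzyy h z) / 2.
Proof.
rewrite /wirtinger_bar /real_directional -/(dzxx h z) -/(dzyy h z).
by rewrite /=; field.
Qed.

Lemma cdiff_real_deriv (f : C -> C) (z l d : C) : cdiff_at f z l ->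
  real_deriv (fun t : R => f (z + t%:C * d)) (d * l).
Proof. by move=> /cdiff_atP fl; exact: (@is_derive_real_deriv R C f z d l fl). Qed.

Lemma is_derive_ln (g : R -> R) (x l : R) : 0 < g x -> is_derive x 1 g l ->
  is_derive x 1 (fun t => ln (g t)) (l / g x).
Proof.
move=> gx gl; have := @is_derive1_comp _ (@ln R) g x _ _ (is_derive1_ln gx) gl.
by rewrite /GRing.scale /= mulrC.
Qed.

(** [d ln |f|^2 / dz] is the logarithmic derivative [f' / f]. It is holomorphic, so by the
    Cauchy-Riemann equations the same [pxx] serves in both directions: [ln |f|^2] is harmonic. *)
Lemma smooth2_ln (f : C -> C) (z : C) (e : R) : 0 < e -> hol_disk f z e -> f z != 0 ->
  exists e' p pxx, 0 < e' /\
    forall w, nc (w - z) < e' -> smooth2_at (fun w => ln (nc (f w) ^+ 2)) p pxx pxx w.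
Proof.
move=> e0 hf fz.
have e2 : 0 < e / 2 by rewrite divr_gt0.
have e2e : e / 2 < e by rewrite ltr_pdivrMr// ltr_pMr// ltr1n.
have [f' hf' df] := hol_disk_derive e2 e2e hf.
have zz : nc (z - z) < e by rewrite subrr Normc.normc0.
have [l /cdiff_at_cont cf] := hf z zz.
have [e1 [e10 e1e f0]] : exists e1, [/\ 0 < e1, e1 < e / 2 & forall w, nc (w - z) < e1 -> f w != 0].
  have cn : {for z, continuous (fun w => nc (f w))}.
    by apply: (continuous_comp cf); exact: nc_continuous.
  have : \forall w \near z, 0 < nc (f w) by apply: (cvgr_gt (nc (f z)) cn); rewrite nc_gt0.
  move=> /nbhsC[e1 e10 h]; exists (Num.min e1 (e / 2 / 2)); split.
  - by rewrite lt_min e10 !divr_gt0.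
  - by rewrite gt_min; apply/orP; right; rewrite ltr_pdivrMr// ltr_pMr// ltr1n.
  - by move=> w; rewrite lt_min => /andP[/h + _]; rewrite nc_gt0.
pose g w := f' w / f w.
have hg : hol_disk g z e1.
  move=> w we; have we2 : nc (w - z) < e / 2 by exact: lt_trans we e1e.
  have [l' hl'] := hf' w we2; eexists.
  by apply: (cdiff_atM hl'); apply: cdiff_atV; [exact: f0|exact: df].
have e12 : 0 < e1 / 2 by rewrite divr_gt0.
have e12e : e1 / 2 < e1 by rewrite ltr_pdivrMr// ltr_pMr// ltr1n.
have [g' hg' dg] := hol_disk_derive e12 e12e hg.
exists (e1 / 2), g, (fun w => Re (g' w)); split; first exact: e12.
move=> w we.
have we1 : nc (w - z) < e1 by exact: lt_trans we e12e.
have we2 : nc (w - z) < e / 2 by exact: lt_trans we1 e1e.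
have fw : f w != 0 by exact: f0.
have Dg := dg w we; have Df := df w we2.
have cfw := cdiff_at_cont Df.
have [m /cdiff_at_cont cg'] := hg' w we.
split.
- move=> d; have fl := cdiff_real_deriv (d := d) Df.
  have Dr := real_deriv_Re fl; have Di := real_deriv_Im fl.
  have := is_derive_ln (g := fun t => nc (f (w + t%:C * d)) ^+ 2) (x := 0)
    (l := 2 * (Re (f w) * Re (d * f' w) + Im (f w) * Im (d * f' w))).
  rewrite mul0r addr0 exprn_gt0 ?nc_gt0// => H.
  have -> : 2 * Re (d * g w) =
      2 * (Re (f w) * Re (d * f' w) + Im (f w) * Im (d * f' w)) / nc (f w) ^+ 2.
    rewrite -mulrA; congr (_ * _); rewrite /g mulrA.
    have ffw : f w * (f w)^*%C = (nc (f w) ^+ 2)%:C.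
      by rewrite mulrC -[RHS]/(((Normc.normc (f w)) ^+ 2)%:C) rmorphXn /= -normCE normCKC.
    have n0 : (nc (f w) ^+ 2)%:C != 0 :> C.
      by rewrite -nc_eq0 ncR normr_eq0 expf_eq0 /= nc_eq0.
    have -> : d * f' w / f w = (d * f' w * (f w)^*%C) * ((nc (f w) ^+ 2)^-1)%:C.
      rewrite fmorphV /= -ffw invfM; field; rewrite fw /=.
      by rewrite andbT; apply: contra n0 => /eqP h; rewrite -ffw (h : (f w)^*%C = 0) mulr0.
    case: (d * f' w) => a b; case: (f w) => u v /=.
    by rewrite !mulr0 !subr0; congr (_ * _); ring.
  apply: H => //.
  have -> : (fun t : R => nc (f (w + t%:C * d)) ^+ 2) =
      (Re \o (fun t : R => f (w + t%:C * d))) * (Re \o (fun t : R => f (w + t%:C * d))) +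
      (Im \o (fun t : R => f (w + t%:C * d))) * (Im \o (fun t : R => f (w + t%:C * d))).
    by apply/funext => t; rewrite nc_sqr !fctE /= !expr2.
  have := is_deriveD (is_deriveM Dr Dr) (is_deriveM Di Di).
  rewrite /= mul0r addr0 /GRing.scale /=; congr is_derive; ring.
- by have := real_deriv_Re (cdiff_real_deriv (d := 1) Dg); rewrite mul1r; exact.
- have := real_deriv_Im (cdiff_real_deriv (d := 'i%C) Dg); congr is_derive.
  by case: (g' w) => a b /=; rewrite mul0r mul1r add0r.
- split; last exact: cdiff_at_cont Dg.
  have c1 : {for w, continuous (fun w => nc (f w) ^+ 2)}.
    have cn : {for w, continuous (fun w => nc (f w))}.
      by apply: (continuous_comp cfw); exact: nc_continuous.
    exact: (cvgM cn cn).
  apply: (@continuous_comp _ _ _ (fun w => nc (f w) ^+ 2) (@ln R)); first exact: c1.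
  by apply: continuous_ln; rewrite exprn_gt0// nc_gt0.
- by split; apply: (continuous_comp cg'); exact: continuous_Re.
Qed.

(** In real coordinates the gradient of [h] is [(2 Re p, - 2 Im p)], which puts [smooth_jensen] into
    complex notation. *)
Lemma smooth2_jensen (r : R) (W : set C) (h : C -> R) p pxx pyy : 0 < r -> open W ->
  (forall z, nc z <= r -> W z) -> (forall z, W z -> smooth2_at h p pxx pyy z) ->
  \int[mu]_(t in `]0, r])
    ((\int[(mu \x mu)%E]_(q in [set q : R * R | disk t (q.1 +i* q.2)])
       (2 * (pxx (q.1 +i* q.2) - pyy (q.1 +i* q.2)))) / t) =
  RI 0 (2 * pi) (fun a => h (r%:C * cis a)) - 2 * pi * h 0.
Proof.
move=> r0 oW rW H.
pose c (q : R * R) : C := q.1 +i* q.2.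
have cc : continuous c by move=> q; exact: continuous_pair.
have cl (a b : R) (w : C) t : w + t%:C * (a +i* b) = (Re w + t * a) +i* (Im w + t * b).
  by case: w => u v; apply/eqP; rewrite eq_complex /= !mul0r subr0 addr0 !eqxx.
have c2 (u : R -> R) (l x0 : R) : is_derive (0 : R) 1 (fun t => u (x0 + t)) l ->
    is_derive x0 1 u l.
  move=> D; have du : is_derive x0 1 (fun v : R => v - x0) 1.
    have := is_deriveB (is_derive_id x0 (1 : R)) (is_derive_cst x0 x0 1).
    by rewrite subr0; exact.
  rewrite -(subrr x0) in D.
  have := @is_derive1_comp _ _ (fun v : R => v - x0) x0 _ _ D du.
  rewrite /GRing.scale /= mulr1; congr is_derive; apply/funext => v /=.
  by rewrite addrC subrK.
have cmp (T : topologicalType) (u : C -> T) q : {for c q, continuous u} ->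
    {for q, continuous (fun q => u (c q))}.
  by move=> cu; apply: continuous_comp; [exact: cc|exact: cu].
have scale (u : R * R -> R) (k : R) q : {for q, continuous u} ->
    {for q, continuous (fun q => k * u q)}.
  by move=> cu; apply: cvgM; [exact: cvg_cst|exact: cu].
have := @smooth_jensen R r (c @^-1` W) (fun q => h (c q)) (fun q => 2 * Re (p (c q)))
  (fun q => - 2 * Im (p (c q))) (fun q => 2 * pxx (c q)) (fun q => - 2 * pyy (c q)) r0.
have -> : (fun a => h (c (r * cos a, r * sin a))) = (fun a => h (r%:C * cis a)).
  apply/funext => a; congr h; apply/eqP; rewrite eq_complex /=.
  by rewrite !mul0r subr0 addr0 !eqxx.
have -> : h (c (0, 0)) = h 0 by [].
move=> SJ.
have A0 : open (c @^-1` W) by apply: open_comp => // q _; exact: cc.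
have A1 : cdisk r `<=` c @^-1` W.
  move=> q; rewrite /cdisk /= => hq; apply: rW.
  by rewrite -ler_sqr ?nnegrE ?nc_ge0 ?(ltW r0)// nc_sqr.
have A2 (x y a b : R) : W (c (x, y)) -> is_derive (0 : R) 1
    (fun t => h (c (x + t * a, y + t * b)))
    (a * (2 * Re (p (c (x, y)))) + b * (- 2 * Im (p (c (x, y))))).
  move=> /H[D _ _ _ _]; have := D (a +i* b).
  have -> : 2 * Re ((a +i* b) * p (c (x, y))) =
      a * (2 * Re (p (c (x, y)))) + b * (- 2 * Im (p (c (x, y)))).
    by case: (p _) => u v /=; ring.
  by congr is_derive; apply/funext => t; rewrite cl.
have A3 (x y : R) : W (c (x, y)) -> is_derive x 1
    (fun x => 2 * Re (p (c (x, y)))) (2 * pxx (c (x, y))).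
  move=> /H[_ D _ _ _].
  have D' : is_derive (0 : R) 1 (fun t => 2 * Re (p (c (x + t, y)))) (2 * pxx (c (x, y))).
    have := is_deriveZ 2 D; congr is_derive; apply/funext => t.
    by rewrite /= (cl 1 0) /= mulr0 addr0 mulr1.
  exact: (c2 (fun x => 2 * Re (p (c (x, y)))) _ x D').
have A4 (x y : R) : W (c (x, y)) -> is_derive y 1
    (fun y => - 2 * Im (p (c (x, y)))) (- 2 * pyy (c (x, y))).
  move=> /H[_ _ D _ _].
  have D' : is_derive (0 : R) 1 (fun t => - 2 * Im (p (c (x, y + t))))
      (- 2 * pyy (c (x, y))).
    have := is_deriveZ (- 2) D; congr is_derive; apply/funext => t.
    by rewrite /= (cl 0 1) /= mulr0 addr0 mulr1.
  exact: (c2 (fun y => - 2 * Im (p (c (x, y)))) _ y D').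
have A5 q : W (c q) -> {for q, continuous (fun q => h (c q))}.
  by move=> /H[_ _ _ [chq _] _]; exact: cmp.
have A6 q : W (c q) -> {for q, continuous (fun q => 2 * Re (p (c q)))}.
  move=> /H[_ _ _ [_ cp] _]; apply: scale; apply: (cmp _ (Re \o p)).
  by apply: continuous_comp; [exact: cp|exact: continuous_Re].
have A7 q : W (c q) -> {for q, continuous (fun q => - 2 * Im (p (c q)))}.
  move=> /H[_ _ _ [_ cp] _]; apply: scale; apply: (cmp _ (Im \o p)).
  by apply: continuous_comp; [exact: cp|exact: continuous_Im].
have A8 q : W (c q) -> {for q, continuous (fun q => 2 * pxx (c q))}.
  by move=> /H[_ _ _ _ [cx _]]; apply: scale; exact: cmp.
have A9 q : W (c q) -> {for q, continuous (fun q => - 2 * pyy (c q))}.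
  by move=> /H[_ _ _ _ [_ cy]]; apply: scale; exact: cmp.
rewrite -(SJ A0 A1 A2 A3 A4 A5 A6 A7 A8 A9).
apply: eq_Rintegral => t; rewrite inE /= in_itv /= => /andP[t0 _]; congr (_ / _).
have -> : [set q : R * R | disk t (q.1 +i* q.2)] = rdisk t.
  apply/seteqP; split => q; rewrite /disk /rdisk /= => hq.
    rewrite [ltLHS](_ : _ = nc (q.1 +i* q.2) ^+ 2); last by rewrite nc_sqr.
    by rewrite ltr_sqr ?nnegrE ?nc_ge0 ?(ltW t0).
  by rewrite -ltr_sqr ?nnegrE ?nc_ge0 ?(ltW t0)// (nc_sqr (q.1 +i* q.2)).
by apply: eq_Rintegral => q _; rewrite /c; ring.
Qed.

End Smooth2.

(** * The mean of a logarithm over a circle *)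

Section LogMean.
Context {R : realType}.
Local Notation C := (plane R).
Local Notation nc := (@Normc.normc R).
Local Notation Re := (@complex.Re R).
Local Notation mu := (@lebesgue_measure R).
Local Notation mR := (measurableTypeR R).

Let pi2 : 0 <= 2 * pi :> R. Proof. by rewrite mulr_ge0// pi_ge0. Qed.

(** This is [smooth2_jensen] on the open set where [f] does not vanish: the Laplacian of [ln |f|^2]
    is zero there. *)
Lemma log_mean_harmonic (f : C -> C) (r : R) : 0 < r ->
  (forall z, exists l, cdiff_at f z l) -> (forall z, nc z <= r -> f z != 0) ->
  RI 0 (2 * pi) (fun t => ln (nc (f (r%:C * cis t)) ^+ 2)) =
  2 * pi * ln (nc (f 0) ^+ 2).
Proof.
move=> r0 hf f0; pose h (z : C) := ln (nc (f z) ^+ 2).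
pose W : set C := [set z | 0 < nc (f z)].
have cf : continuous f by move=> z; have [l /cdiff_at_cont] := hf z.
have oW : open W.
  apply: (@open_comp _ _ (fun z => nc (f z)) [set x | 0 < x]); last exact: open_gt.
  by move=> z _; apply: continuous_comp; [exact: cf|exact: nc_continuous].
have H z : W z -> [/\ smooth2_at h (dz h) (dzxx h) (dzyy h) z & dzxx h z = dzyy h z].
  rewrite /W /= nc_gt0 => fz.
  have hd : hol_disk f z 1 by move=> w _; exact: hf.
  have [e [p [pxx [e0 hs]]]] := smooth2_ln ltr01 hd fz.
  have [s1 s2 s3] := smooth2_near e0 (fun w _ => erefl (h w)) hs.
  by split; [exact: s1|rewrite s2 s3].
have rW z : nc z <= r -> W z by move=> /f0; rewrite /W /= nc_gt0.
have := smooth2_jensen r0 oW rW (fun z hz => let: conj a _ := H z hz in a).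
rewrite (_ : \int[mu]_(t in _) _ = 0).
  by move=> /esym/eqP; rewrite subr_eq0 => /eqP.
rewrite (@eq_Rintegral _ _ _ _ _ (cst 0)); last first.
  move=> t; rewrite inE /= in_itv /= => /andP[t0 tr].
  rewrite (@eq_Rintegral _ _ _ _ _ (cst 0)); first by rewrite /Rintegral integral0 /= mul0r.
  move=> q; rewrite inE /disk /= => hq.
  have /H[_ ->] : W (q.1 +i* q.2) by apply: rW; exact: ltW (lt_le_trans hq tr).
  by rewrite subrr mulr0.
by rewrite /Rintegral integral0.
Qed.

Lemma cdiff_affine_all (a b : C) (z : C) : exists l, cdiff_at (fun w => a * w + b) z l.
Proof. by exists a; exact: cdiff_at_affine. Qed.

Let cont_dist (a : C) r : continuous (fun t => nc (r%:C * cis t - a)).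
Proof.
move=> t; apply: (@continuous_comp _ _ _ (fun t => r%:C * cis t - a : C) nc);
  last exact: nc_continuous.
apply: cvgB; last exact: cvg_cst.
by apply: (continuousMC (@continuous_cstC R r%:C) (@cis_continuous R)).
Qed.

Let log_mean_half (g : R -> R) (l : R) : (forall t, 0 < g t) -> continuous g -> 0 < l ->
  RI 0 (2 * pi) (fun t => ln (g t ^+ 2)) = 2 * pi * ln (l ^+ 2) ->
  RI 0 (2 * pi) (fun t => ln (g t)) = 2 * pi * ln l.
Proof.
move=> g0 cg l0.
have -> : (fun t => ln (g t ^+ 2)) = (fun t => 2 * ln (g t)).
  by apply/funext => t; rewrite lnXn// mulr_natl.
have cl : continuous (fun t => ln (g t)).
  by move=> t; apply: continuous_comp; [exact: cg|exact: continuous_ln].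
rewrite (RI_scale _ _ _ cl) lnXn// -mulr_natl => h.
by move: h; set I := RI _ _ _; lra.
Qed.

Lemma log_mean_out (a : C) r : 0 < r -> r < nc a ->
  RI 0 (2 * pi) (fun t => ln (nc (r%:C * cis t - a))) = 2 * pi * ln (nc a).
Proof.
move=> r0 ra.
have ne (z : C) : nc z <= r -> 1 * z + - a != 0.
  rewrite mul1r subr_eq0 => zr; apply: contraTneq ra => <-.
  by rewrite -leNgt.
apply: log_mean_half => //.
- move=> t; rewrite nc_gt0; have := ne (r%:C * cis t); rewrite mul1r; apply.
  by rewrite Normc.normcM ncR nc_cis mulr1 gtr0_norm.
- exact: lt_trans ra.
have := log_mean_harmonic r0 (cdiff_affine_all 1 (- a)) ne.
rewrite mulr0 add0r ncN => <-.
by apply: eq_RI => t _; rewrite mul1r.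
Qed.

(** For [|z| = r] one has [|z - a| = |r - conj a * z / r|]. The affine function on the right has no
    zero in the closed disk when [nc a < r], and its value at 0 is [r]. *)
Lemma log_mean_in (a : C) r : 0 < r -> nc a < r ->
  RI 0 (2 * pi) (fun t => ln (nc (r%:C * cis t - a))) = 2 * pi * ln r.
Proof.
move=> r0 ra.
have rC : r%:C != 0 :> C by rewrite -nc_eq0 ncR normr_eq0 gt_eqF.
pose k : C := - (a^*%C / r%:C).
have ne (z : C) : nc z <= r -> k * z + r%:C != 0.
  move=> zr; rewrite -nc_gt0.
  have : nc (k * z) <= nc a.
    rewrite Normc.normcM /k ncN Normc.normcM ncJ Normc.normcV ncR gtr0_norm//.
    by rewrite -mulrA ler_piMr ?nc_ge0// mulrC ler_pdivrMr// mul1r.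
  have := ncB_ge r%:C (- (k * z)).
  rewrite ncR gtr0_norm// ncN opprK addrC (addrC r%:C) => h1 h2.
  apply: lt_le_trans h1; rewrite addrC subr_gt0; exact: le_lt_trans h2 ra.
apply: log_mean_half => //.
  by move=> t; rewrite nc_gt0 circ_neq.
have := log_mean_harmonic r0 (cdiff_affine_all k r%:C) ne.
rewrite mulr0 add0r ncR gtr0_norm// => <-.
apply: eq_RI => t _; congr (ln (_ ^+ 2)).
rewrite -[LHS]mulr1 -(nc_cis t) -[in LHS]ncJ.
rewrite -Normc.normcM; congr nc.
have cc : (cis t)^*%C * cis t = 1 :> C.
  apply/eqP; rewrite eq_complex /= !mulNr opprK; apply/andP; split; apply/eqP.
    by rewrite -!expr2 cos2Dsin2.
  by rewrite (mulrC (cos t)) subrr.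
have cM (x y : C) : (x * y)^*%C = x^*%C * y^*%C by exact: rmorphM.
have cB (x y : C) : (x - y)^*%C = x^*%C - y^*%C by exact: rmorphB.
rewrite cB cM conjc_real mulrBl -mulrA cc mulr1 /k.
by field.
Qed.

(** Cosine is injective on [[0, pi]] and, by reflection, on [[pi, 2 pi]], so each half contains at
    most one such angle. *)
Lemma circ_fiber_countable (a : C) r : 0 < r ->
  countable [set t : R | 0 <= t <= 2 * pi /\ r%:C * cis t = a].
Proof.
move=> r0.
have cosE t : r%:C * cis t = a -> cos t = Re a / r.
  by move=> <-; rewrite /= mul0r subr0 mulrC mulKf// gt_eqF.
have half (E : set R) : (forall s t, E s -> E t -> s = t) -> finite_set E.
  move=> hE; have [[s Es]|/forallNP E0] := pselect (exists s, E s).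
    by apply: (@sub_finite_set _ _ [set s]) => [t Et|]; [exact: hE|exact: finite_set1].
  by rewrite (_ : E = set0)//; apply/seteqP; split => // t /E0.
apply: finite_set_countable.
apply: (@sub_finite_set _ _ ([set t : R | 0 <= t <= pi /\ r%:C * cis t = a] `|`
   [set t : R | pi <= t <= 2 * pi /\ r%:C * cis t = a])).
  move=> t [/andP[t0 t2] ta].
  by have [tp|/ltW tp] := leP t pi; [left|right]; rewrite /= ?t0 ?tp.
rewrite finite_setU; split; apply: half => s t [hs /cosE es] [ht /cosE et].
  by apply: cos_inj; rewrite ?in_itv //= es et.
suff : 2 * pi - s = 2 * pi - t by move=> /addrI /oppr_inj.
have c2 x : cos (2 * pi - x) = cos x.
  by rewrite addrC mulr_natl cosD2pi cosN.
apply: cos_inj; rewrite ?in_itv /= ?c2 ?es ?et //; apply/andP; move: hs ht => /andP[? ?] /andP[? ?]; split; lra.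
Qed.

Let E (a : C) r := [set t : R | 0 <= t <= 2 * pi /\ r%:C * cis t = a].

Lemma circ_ae (a : C) r (P : R -> Prop) : 0 < r ->
  (forall t, 0 <= t <= 2 * pi -> r%:C * cis t != a -> P t) ->
  {ae mu, forall t, [set` `[(0 : R), 2 * pi]] t -> P t}.
Proof.
move=> r0 hP; exists (E a r); split.
- exact: countable_measurable (circ_fiber_countable a r0).
- exact: countable_lebesgue_measure0 (circ_fiber_countable a r0).
- move=> t /= /not_implyP[t2 nP]; move: t2; rewrite in_itv /= => t2; split => //.
  by apply: contrapT => /eqP h; apply: nP; exact: hP.
Qed.

Let logd (a : C) r t := ln (nc (r%:C * cis t - a)).

Lemma measurable_logd a r : measurable_fun (`[0, 2 * pi] : set mR) (logd a r).
Proof.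
apply: (@measurable_funS _ _ _ _ setT) => //.
apply: measurableT_comp; first exact: measurable_ln.
by apply: continuous_measurable_fun; exact: cont_dist.
Qed.

(* Replace [a] by [rho a] with [rho] increasing to [1].  Fatou's lemma gives the
   integrability, and [|r e^it - a| <= 2 |r e^it - rho a|] the domination. *)
Lemma log_mean_on (a : C) r : 0 < r -> nc a = r ->
  mu.-integrable `[0, 2 * pi] (EFin \o logd a r) /\
  RI 0 (2 * pi) (logd a r) = 2 * pi * ln r.
Proof.
move=> r0 ar.
pose rho n : R := 1 - n.+1%:R^-1.
have rho1 n : rho n < 1 by rewrite /rho ltrBlDr ltrDl invr_gt0.
have rho0 n : 0 <= rho n by rewrite subr_ge0 invf_le1// ler1n.
have crho : rho n @[n --> \oo] --> (1 : R).
  by rewrite -[X in _ --> X]subr0; apply: cvgB; [exact: cvg_cst|exact: cvg_harmonic].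
clearbody rho.
pose g n t := logd ((rho n)%:C * a) r t.
have nra n : nc ((rho n)%:C * a) < r.
  by rewrite Normc.normcM ncR (ger0_norm (rho0 n)) ar gtr_pMl.
have dpos n t : 0 < nc (r%:C * cis t - (rho n)%:C * a) by rewrite nc_gt0 circ_neq.
have cg n : continuous (g n).
  move=> t.
  apply: (@continuous_comp _ _ _ (fun t => nc (r%:C * cis t - (rho n)%:C * a)) (@ln R)).
    exact: cont_dist.
  by apply: continuous_ln; exact: dpos.
have Ig n : RI 0 (2 * pi) (g n) = 2 * pi * ln r by exact: log_mean_in.
have up n t : nc (r%:C * cis t - (rho n)%:C * a) <= 2 * r.
  rewrite (le_trans (ncD _ _))// ncN Normc.normcM ncR nc_cis mulr1 gtr0_norm//.
  by have := nra n; lra.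
have low n t : nc (r%:C * cis t - a) <= 2 * nc (r%:C * cis t - (rho n)%:C * a).
  have h1 := circ_gap ((rho n)%:C * a) t (ltW r0).
  have -> : r%:C * cis t - a = (r%:C * cis t - (rho n)%:C * a) + (rho n - 1)%:C * a.
    by rewrite rmorphB rmorph1; ring.
  rewrite (le_trans (ncD _ _))//.
  rewrite Normc.normcM ncR ar ler0_norm ?subr_le0 ?(ltW (rho1 n))//.
  move: h1; rewrite Normc.normcM ncR (ger0_norm (rho0 n)) ar; lra.
(* A common upper bound that makes [K - g n] nonnegative, as Fatou's lemma requires. The maximum
   with 0 covers the angle where the limit takes the default value [ln 0 = 0]. *)
pose K := Num.max (ln (2 * r)) 0.
have K0 : 0 <= K by rewrite le_max lexx orbT.
have g_up n t : g n t <= K.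
  rewrite (@le_trans _ _ (ln (2 * r)))//; last by rewrite le_max lexx.
  by rewrite ler_ln ?posrE ?dpos ?mulr_gt0//.
have cvgg t : r%:C * cis t != a -> g n t @[n --> \oo] --> logd a r t.
  move=> ta; have d0 : 0 < nc (r%:C * cis t - a) by rewrite nc_gt0 subr_eq0.
  apply: (@cvg_comp _ _ _ (fun n => nc (r%:C * cis t - (rho n)%:C * a)) (@ln R)); last exact: continuous_ln.
  apply: (@cvg_comp _ _ _ (fun n => r%:C * cis t - (rho n)%:C * a : C) nc); last exact: nc_continuous.
  apply: cvgB; first exact: cvg_cst.
  have h1 : ((rho n)%:C : C) @[n --> \oo] --> (1%:C : C) by exact: (@cvgRC R nat \oo _ rho 1 crho).
  have h2 := cvgM h1 (@cvg_cst _ a nat \oo _).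
  by rewrite -[X in _ --> X]mul1r; exact: h2.
pose D : set mR := [set` `[(0 : R), 2 * pi]].
have mD : measurable D by exact: measurable_itv.
pose F n t : \bar R := (K - g n t)%:E.
have mF n : measurable_fun D (F n).
  apply/measurable_EFinP; apply: measurable_funB; first exact: measurable_cst.
  exact: measurable_logd.
have F0 n t : D t -> (0 <= F n t)%E by move=> _; rewrite lee_fin subr_ge0.
have IF n : (\int[mu]_(t in D) F n t)%E = (2 * pi * (K - ln r))%:E.
  have h : continuous (fun t => K - g n t).
    by move=> t; apply: cvgB; [exact: cvg_cst|exact: cg].
  have it := RI_integrable 0 (2 * pi) h.
  rewrite -[LHS]fineK; last exact: integrable_fin_num.
  congr EFin; rewrite -[LHS]/(RI 0 (2 * pi) (fun t => K - g n t)).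
  rewrite RI_sub//; last exact: cst_continuous.
  by rewrite RI_cst// Ig subr0; ring.
pose L t : \bar R := limn_einf (F ^~ t).
have LE t : L t = (- limn_esup (fun n => - F n t))%E.
  rewrite -limn_einfN; congr limn_einf; apply/funext => n /=.
  by rewrite opprK.
have mL : measurable_fun D L.
  rewrite (_ : L = (fun t => (- limn_esup (fun n => - F n t))%E)); last first.
    by apply/funext => t; exact: LE.
  apply: measurableT_comp => //; apply: measurable_fun_limn_esup => n.
  by apply: measurableT_comp => //; exact: mF.
have L0 t : D t -> (0 <= L t)%E.
  move=> Dt; rewrite /L limn_einf_lim; apply: lime_ge; first exact: is_cvg_einfs.
  apply: nearW => n; apply: le_ereal_inf_tmp => _ [m /= _ <-]; exact: F0.
have mG : measurable_fun D (fun t => (K - logd a r t)%:E).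
  apply/measurable_EFinP; apply: measurable_funB; first exact: measurable_cst.
  exact: measurable_logd.
have GL : ae_eq mu D (fun t => (K - logd a r t)%:E) L.
  apply: (circ_ae (a := a) r0) => t _ ta; apply/esym.
  have cF : F n t @[n --> \oo] --> (K - logd a r t)%:E.
    by apply: cvg_EFin; [exact: nearW|apply: cvgB; [exact: cvg_cst|exact: cvgg]].
  by rewrite /L (cvg_limn_einf_sup cF).1.
have G0 t : D t -> (0 <= (K - logd a r t)%:E)%E.
  move=> _; rewrite lee_fin subr_ge0 /logd.
  have [->|n0] := eqVneq (nc (r%:C * cis t - a)) 0; first by rewrite ln0.
  have d0 : 0 < nc (r%:C * cis t - a) by rewrite lt_def n0 nc_ge0.
  apply: (@le_trans _ _ (ln (2 * r))); last by rewrite le_max lexx.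
  rewrite ler_ln ?posrE ?mulr_gt0// (le_trans (ncD _ _))// ncN Normc.normcM ncR nc_cis.
  by rewrite mulr1 gtr0_norm// ar mulr_natl mulr2n.
have intG : mu.-integrable D (fun t => (K - logd a r t)%:E).
  apply/integrableP; split => //.
  rewrite (_ : (\int[mu]_(t in D) _)%E = (\int[mu]_(t in D) (K - logd a r t)%:E)%E); last first.
    by apply: eq_integral => t /set_mem Dt; rewrite gee0_abs//; exact: G0.
  rewrite (ge0_ae_eq_integral mD mG mL G0 L0 GL).
  apply: le_lt_trans (fatou _ mD mF F0) _.
  have -> : (fun n => \int[mu]_(t in D) F n t)%E = (fun=> (2 * pi * (K - ln r))%:E).
    by apply/funext => n; exact: IF.
  by rewrite (cvg_limn_einf_sup (cvg_cst _)).1 ltry.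
have cstI (k : R) : mu.-integrable D (fun=> k%:E).
  exact: (RI_integrable 0 (2 * pi) (@cst_continuous _ _ k)).
have intg : mu.-integrable D (EFin \o logd a r).
  apply: eq_integrable (integrableB mD (cstI K) intG) => //.
  by move=> t _ /=; rewrite -EFinB; congr EFin; ring.
split; first exact: intg.
(* The dominating function: [g n] is at most [K], and at least [logd a r - ln 2] by [low]. *)
pose B t : \bar R := (K + ln 2 + `|logd a r t|)%:E.
have intB : mu.-integrable D B.
  have intn : mu.-integrable D (fun t => `|logd a r t|%:E) by exact: (integrable_norm intg).
  apply: eq_integrable (integrableD mD (cstI (K + ln 2)) intn) => //.
have mg n : measurable_fun D (EFin \o g n).
  by apply/measurable_EFinP; exact: measurable_logd.
have mlg : measurable_fun D (EFin \o logd a r).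
  by apply/measurable_EFinP; exact: measurable_logd.
have cv : {ae mu, forall t, D t -> (EFin \o g n) t @[n --> \oo] --> (EFin \o logd a r) t}.
  apply: (circ_ae (a := a) r0) => t _ ta.
  by apply: cvg_EFin; [exact: nearW|exact: cvgg].
have bd : {ae mu, forall t n, D t -> (`|(EFin \o g n) t| <= B t)%E}.
  exists (E a r); split; first exact: countable_measurable (circ_fiber_countable a r0).
    exact: countable_lebesgue_measure0 (circ_fiber_countable a r0).
  move=> t /= nP; apply: contrapT => nE; apply: nP => n Dt.
  have ta : r%:C * cis t != a.
    by apply/eqP => ta; apply: nE; split => //; move: Dt; rewrite /D /= in_itv.
  rewrite /B /= lee_fin ler_norml; apply/andP; split.
    have d0 : 0 < nc (r%:C * cis t - a) by rewrite nc_gt0 subr_eq0.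
    have : logd a r t <= ln 2 + g n t.
      rewrite /logd -lnM ?posrE ?dpos// ler_ln ?posrE ?mulr_gt0//.
    have := ler_norm (- logd a r t); rewrite normrN; have := K0; lra.
  have l2 : 0 <= ln 2 :> R by rewrite ln_ge0// ler1n.
  rewrite (le_trans (g_up n t))// -addrA lerDl addr_ge0//.
have [_ _ h] := dominated_convergence mD mg mlg cv intB bd.
have ce : (fun n => \int[mu]_(t in D) (EFin \o g n) t)%E = (fun=> (2 * pi * ln r)%:E).
  apply/funext => n; rewrite -(Ig n) /RI /Rintegral fineK//.
  by apply: integrable_fin_num => //; exact: RI_integrable.
rewrite ce in h.
exact: (congr1 fine (cvg_unique _ h (cvg_cst _))).
Qed.

Lemma log_mean (a : C) (r : R) : 0 < r ->
  mu.-integrable `[0, 2 * pi] (EFin \o (fun t => ln (nc (r%:C * cis t - a)))) /\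
  RI 0 (2 * pi) (fun t => ln (nc (r%:C * cis t - a))) = 2 * pi * ln (Num.max r (nc a)).
Proof.
move=> r0; have cl : (forall t, 0 < nc (r%:C * cis t - a)) ->
    mu.-integrable `[0, 2 * pi] (EFin \o (fun t => ln (nc (r%:C * cis t - a)))).
  move=> h; apply: RI_integrable => t.
  by apply: continuous_comp; [exact: cont_dist|exact: continuous_ln].
have [ra|ra|ra] := ltgtP (nc a) r.
- by split; [apply: cl => t; rewrite nc_gt0 circ_neq|exact: log_mean_in].
- split; last exact: log_mean_out.
  apply: cl => t; rewrite nc_gt0 subr_eq0; apply: contraTneq ra => <-.
  by rewrite Normc.normcM ncR nc_cis mulr1 gtr0_norm// ltxx.
- by rewrite ra; exact: log_mean_on.
Qed.

End LogMean.

(** * Hilbert spaces *)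

Section Hilbert.
Context {R : realType} {H : completeNormedModType R[i]}.
Local Notation C := (plane R).
Local Notation nc := (@Normc.normc R).
Local Notation Re := (@complex.Re R).

(** Norms in [H] are elements of [R[i]]; being nonnegative they are real, and their real parts allow
    arithmetic in [R]. *)
Definition hn (x : H) : R := Re `|x|.

Lemma hnE x : `|x| = (hn x)%:C.
Proof.
have : 0 <= `|x| by []; rewrite /hn; case: `|x| => a b.
by rewrite lecE /= => /andP[/eqP -> _].
Qed.

Lemma hn_ge0 x : 0 <= hn x.
Proof. by have : 0 <= `|x| by []; rewrite hnE lecR. Qed.

Lemma hnD x y : hn (x + y) <= hn x + hn y.
Proof. by have := ler_normD x y; rewrite !hnE -rmorphD lecR. Qed.

Lemma hnN x : hn (- x) = hn x.
Proof. by rewrite /hn normrN. Qed.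

Lemma hnB x y : hn (x - y) = hn (y - x).
Proof. by rewrite -hnN opprB. Qed.

Lemma hn_triangle x y z : hn (x - z) <= hn (x - y) + hn (y - z).
Proof. by rewrite -[x - z](subrKA y); exact: hnD. Qed.

Lemma hnZ (a : R[i]) x : hn (a *: x) = nc a * hn x.
Proof. by rewrite {1}/hn normrZ hnE (normCE a) -rmorphM. Qed.

Lemma hn0 : hn 0 = 0.
Proof. by rewrite /hn normr0. Qed.

Lemma hn_eq0 x : (hn x == 0) = (x == 0).
Proof. by rewrite -(normr_eq0 x) hnE -nc_eq0 ncR normr_eq0. Qed.

Lemma hn_gt0 x : (0 < hn x) = (x != 0).
Proof. by rewrite lt_def hn_ge0 andbT hn_eq0. Qed.

Lemma cvgH (T : Type) (F : set_system T) (FF : Filter F) (f : T -> H) (l : H) :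
  (f x @[x --> F] --> l) <->
  (forall e : R, 0 < e -> \forall x \near F, hn (l - f x) < e).
Proof.
split=> [/cvgrPdist_lt h e e0|h].
  by near=> x; rewrite -ltcR -hnE; near: x; apply: h; rewrite ltcR.
apply/cvgrPdist_lt => e e0; have [-> e1] := ltcR_re e0.
by near=> x; rewrite hnE ltcR; near: x; exact: h.
Unshelve. all: by end_near. Qed.

Lemma cvgH_squeeze (T : Type) (F : set_system T) (FF : Filter F) (f : T -> H) (l : H)
    (g : T -> R) :
  (\forall x \near F, hn (l - f x) <= g x) -> g x @[x --> F] --> (0 : R) ->
  f x @[x --> F] --> l.
Proof.
move=> h /cvgrPdist_lt g0; apply/cvgH => e e0; near=> x.
apply: (@le_lt_trans _ _ (g x)); first by near: x.
have : `|0 - g x| < e by near: x; exact: g0.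
by rewrite sub0r normrN; apply: le_lt_trans; exact: ler_norm.
Unshelve. all: by end_near. Qed.

Lemma cvg_hn (T : Type) (F : set_system T) (FF : Filter F) (f : T -> H) (l : H) :
  f x @[x --> F] --> l -> hn (l - f x) @[x --> F] --> (0 : R).
Proof.
move=> /cvgH h; apply/cvgrPdist_lt => e e0; near=> x.
by rewrite sub0r normrN ger0_norm ?hn_ge0//; near: x; exact: h.
Unshelve. all: by end_near. Qed.

Lemma cauchy_seq_cvg (u : nat -> H) :
  (forall e : R, 0 < e -> exists N, forall n m, (N <= n)%N -> (N <= m)%N ->
     hn (u n - u m) < e) -> exists l : H, u n @[n --> \oo] --> l.
Proof.
move=> hu; suff : cvg (u n @[n --> \oo]) by move=> h; exists (lim (u n @[n --> \oo])).
apply: cauchy_cvg; apply: cauchy_exP => e e0; have [-> e1] := ltcR_re e0.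
have [N hN] := hu _ e1; exists (u N).
exists N => // m /= hm; rewrite -ball_normE /= hnE ltcR.
by apply: hN.
Qed.

Section InnerProduct.
Variable ip : {dot H for Num.conj}.
Hypothesis hip : forall x : H, `|x| ^+ 2 = ip x x.

Lemma ipDl x y z : ip (x + y) z = ip x z + ip y z. Proof. exact: linearDl. Qed.
Lemma ipDr x y z : ip x (y + z) = ip x y + ip x z. Proof. exact: linearDr. Qed.
Lemma ipBl x y z : ip (x - y) z = ip x z - ip y z. Proof. exact: linearBl. Qed.
Lemma ipBr x y z : ip x (y - z) = ip x y - ip x z. Proof. exact: linearBr. Qed.
Lemma ipZl a x z : ip (a *: x) z = a * ip x z. Proof. exact: linearZl_LR. Qed.
Lemma ipZr a x z : ip x (a *: z) = a^*%C * ip x z. Proof. exact: linearZr_LR. Qed.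
Lemma ip0l z : ip 0 z = 0. Proof. exact: linear0l. Qed.
Lemma ip0r z : ip z 0 = 0. Proof. exact: linear0r. Qed.

Lemma ipC x y : ip y x = (ip x y)^*%C.
Proof. by rewrite hermC expr0 mul1r. Qed.

Lemma ipxx x : ip x x = (hn x ^+ 2)%:C.
Proof. by rewrite -hip hnE -rmorphXn. Qed.

Lemma ipxx_eq0 x : ip x x = 0 -> x = 0.
Proof. by rewrite -hip => /eqP; rewrite expf_eq0 /= normr_eq0 => /eqP. Qed.

Lemma hnD_sqr x y : hn (x + y) ^+ 2 = hn x ^+ 2 + hn y ^+ 2 + 2 * Re (ip x y).
Proof.
have E z : hn z ^+ 2 = Re (ip z z) by rewrite ipxx.
rewrite !E ipDl !ipDr (ipC x y) !raddfD /=; case: (ip x y) => a b /=; ring.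
Qed.

Lemma parallelogram x y :
  hn (x - y) ^+ 2 + hn (x + y) ^+ 2 = 2 * hn x ^+ 2 + 2 * hn y ^+ 2.
Proof.
have E z : hn z ^+ 2 = Re (ip z z) by rewrite ipxx.
rewrite !E ipBl !ipBr ipDl !ipDr.
by case: (ip x x) (ip x y) (ip y x) (ip y y) => [? ?] [? ?] [? ?] [? ?] /=; ring.
Qed.

Lemma cauchy_schwarz x y : nc (ip x y) <= hn x * hn y.
Proof.
have [->|y0] := eqVneq y 0; first by rewrite ip0r Normc.normc0 hn0 mulr0.
have hy : 0 < hn y by rewrite hn_gt0.
set a := ip x y.
have := exprn_ge0 2 (hn_ge0 (x + (- (a / (hn y ^+ 2)%:C)) *: y)).
rewrite hnD_sqr hnZ ncN ipZr -/a.
have -> : (a / (hn y ^+ 2)%:C) = ((hn y ^+ 2)^-1)%:C * a.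
  by rewrite mulrC fmorphV.
rewrite Normc.normcM ncR ger0_norm ?invr_ge0 ?sqr_ge0//.
have -> : Re ((- (((hn y ^+ 2)^-1)%:C * a))^*%C * a) = - (hn y ^+ 2)^-1 * nc a ^+ 2.
  by rewrite nc_sqr; case: (a) => p q /=; ring.
have -> : hn x ^+ 2 + ((hn y ^+ 2)^-1 * nc a * hn y) ^+ 2 + 2 * (- (hn y ^+ 2)^-1 * nc a ^+ 2)
   = hn x ^+ 2 - nc a ^+ 2 / hn y ^+ 2 by field; rewrite gt_eqF.
rewrite subr_ge0 ler_pdivrMr ?exprn_gt0// -exprMn.
by rewrite ler_sqr ?nnegrE ?nc_ge0 ?mulr_ge0 ?hn_ge0.
Qed.

Lemma cvg_ip (T : Type) (F : set_system T) (FF : Filter F) (f g : T -> H) (k l : H) :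
  f x @[x --> F] --> k -> g x @[x --> F] --> l ->
  (ip (f x) (g x) : C) @[x --> F] --> (ip k l : C).
Proof.
move=> /cvg_hn fk /cvg_hn gl.
have E x : nc (ip k l - ip (f x) (g x)) <=
    hn (k - f x) * hn l + hn (l - g x) * (hn k + hn (k - f x)).
  have -> : ip k l - ip (f x) (g x) = ip (k - f x) l + ip (f x) (l - g x).
    by rewrite ipBl ipBr addrA subrK.
  apply: le_trans (ncD _ _) _; rewrite lerD ?cauchy_schwarz//.
  rewrite mulrC (le_trans (cauchy_schwarz _ _))// ler_wpM2r ?hn_ge0//.
  by rewrite -{1}[f x](subKr k) (le_trans (hnD _ _))// hnN.
have c : hn (k - f x) * hn l + hn (l - g x) * (hn k + hn (k - f x)) @[x --> F] --> (0 : R).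
  rewrite -[X in _ --> X](_ : 0 * hn l + 0 * (hn k + 0) = 0); last by rewrite !mul0r addr0.
  apply: cvgD; apply: cvgM => //; first exact: cvg_cst.
  by apply: cvgD => //; exact: cvg_cst.
move: c => /cvgrPdist_lt c; apply/cvgC => e e0; near=> x.
apply: le_lt_trans (E x) _.
have : `|0 - (hn (k - f x) * hn l + hn (l - g x) * (hn k + hn (k - f x)))| < e by near: x; exact: c.
by rewrite sub0r normrN; apply: le_lt_trans; exact: ler_norm.
Unshelve. all: by end_near. Qed.

Lemma orth_inj (M : set H) (sM : subspace M) x y : M x -> M y ->
  (forall z, M z -> ip x z = ip y z) -> x = y.
Proof.
move=> Mx My h; apply/eqP; rewrite -subr_eq0; apply/eqP/ipxx_eq0.
have Mxy : M (x - y) by rewrite addrC -scaleN1r; exact: sM.2.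
by rewrite ipBl h// subrr.
Qed.

(** Minimise [J z = |z|^2 - 2 Re (phi z)] over [M]. The parallelogram identity makes a minimising
    sequence Cauchy, and its limit is stationary. The functional is conjugate linear because it is
    represented in the second variable of [ip]; outside [M] it is arbitrary. *)
Lemma riesz (M : set H) (phi : H -> R[i]) (B : R) : subspace M -> closed M ->
  (forall a x y, M x -> M y -> phi (a *: x + y) = a^*%C * phi x + phi y) ->
  (forall x, M x -> nc (phi x) <= B * hn x) ->
  exists2 k, M k & forall z, M z -> ip k z = phi z.
Proof.
move=> sM cM lphi bphi.
pose J z := hn z ^+ 2 - 2 * Re (phi z).
have MD x y : M x -> M y -> M (x + y) by move=> *; rewrite -[x]scale1r; exact: sM.2.
have MZ a x : M x -> M (a *: x) by move=> Mx; rewrite -[_ *: _]addr0; exact: sM.2 _ _ _ Mx sM.1.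
have phi0 : phi 0 = 0.
  have := lphi 1 0 0 sM.1 sM.1; rewrite scaler0 addr0 rmorph1 mul1r.
  by move/eqP; rewrite -subr_eq0 opprD addNKr oppr_eq0 => /eqP.
have phiZ a x : M x -> phi (a *: x) = a^*%C * phi x.
  by move=> Mx; have := lphi a x 0 Mx sM.1; rewrite !addr0 phi0 addr0.
have phiD x y : M x -> M y -> phi (x + y) = phi x + phi y.
  by move=> Mx My; rewrite -[x in LHS]scale1r lphi// rmorph1 mul1r.
have JB z : M z -> - B ^+ 2 <= J z.
  move=> Mz; have h1 := bphi _ Mz; have h2 := ler_norm (Re (phi z)).
  have h3 := nc_Re (phi z); have := sqr_ge0 (hn z - B); rewrite /J; nra.
pose S := [set J z | z in M].
have S0 : has_inf S.
  split; first by exists (J 0); exists 0 => //; exact: sM.1.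
  by exists (- B ^+ 2) => _ [z Mz <-]; exact: JB.
have mS z : M z -> inf S <= J z by move=> Mz; apply: (ge_inf S0.2); exists z.
have /choice[u hu] : forall n, exists z, M z /\ J z < inf S + n.+1%:R^-1.
  move=> n; have /(inf_adherent)/(_ S0)[_ [z Mz <-] hz] : 0 < n.+1%:R^-1 :> R by [].
  by exists z.
have uc n m : hn (u n - u m) ^+ 2 <= 2 * (n.+1%:R^-1 + m.+1%:R^-1).
  have [[Mn hn1] [Mm hm1]] := (hu n, hu m).
  have Mh : M ((2^-1 : R)%:C *: (u n + u m)) by apply: MZ; exact: MD.
  have := mS _ Mh; rewrite /J hnZ phiZ; last exact: MD.
  rewrite phiD// ncR ger0_norm ?invr_ge0// conjc_real.
  have -> (w : R[i]) : Re ((2^-1 : R)%:C * w) = 2^-1 * Re w.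
    by case: w => p q /=; rewrite mul0r subr0.
  have := parallelogram (u n) (u m); rewrite raddfD /=.
  rewrite exprMn (_ : (2^-1 : R) ^+ 2 = 4^-1); last by field.
  move: hn1 hm1; rewrite /J.
  move: (inf S) (hn (u n - u m) ^+ 2) (hn (u n + u m) ^+ 2) (hn (u n) ^+ 2) (hn (u m) ^+ 2).
  move: (complex.Re _) (complex.Re _) (n.+1%:R^-1) (m.+1%:R^-1) => fa fb ea eb I A P a b.
  move=> h1 h2 h3 h4.
  lra.
have [k uk] : exists l : H, u n @[n --> \oo] --> l.
  apply: cauchy_seq_cvg => e e0.
  have e4 : 0 < e ^+ 2 / 4 by rewrite divr_gt0 ?exprn_gt0.
  have [N hN] : exists N, N.+1%:R^-1 < e ^+ 2 / 4.
    have /cvgrPdist_lt/(_ _ e4)[N _ /(_ N (leqnn N))] := @cvg_harmonic R.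
    by rewrite /= sub0r normrN ger0_norm ?invr_ge0// => h; exists N.
  exists N => n m Nn Nm.
  have le k : (N <= k)%N -> k.+1%:R^-1 <= N.+1%:R^-1 :> R.
    by move=> Nk; rewrite lef_pV2 ?posrE ?ltr0n// ler_nat.
  rewrite -ltr_sqr ?nnegrE ?hn_ge0 ?ltW//; apply: le_lt_trans (uc n m) _.
  move: (le _ Nn) (le _ Nm) hN.
  move: (n.+1%:R^-1) (m.+1%:R^-1) (N.+1%:R^-1) => a b c *; lra.
exists k.
  by apply: (@closed_cvg nat _ \oo _ u M cM); [apply: nearW => n; exact: (hu n).1|exact: uk].
move=> z Mz; apply/eqP; rewrite -subr_eq0 -nc_eq0; apply/eqP.
pose d n := ip (u n) z - phi z.
(* [u n] is compared with [u n - t d_n z]. Since [t |z|^2 <= 1], [J] falls by at least [t |d_n|^2],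
   but by less than [1 / n.+1] because [u n] is nearly minimal. *)
have dn n : nc (d n) ^+ 2 <= (hn z ^+ 2 + 1) * n.+1%:R^-1.
  have [Mn h1] := hu n; pose t := (hn z ^+ 2 + 1)^-1.
  have q0 : 0 < hn z ^+ 2 + 1 by rewrite ltr_wpDl ?sqr_ge0.
  have := mS _ (MD _ _ Mn (MZ (- (t%:C * d n)) _ Mz)).
  rewrite /J hnD_sqr phiD//; last exact: MZ.
  have t0 : 0 < t by rewrite invr_gt0.
  rewrite phiZ// hnZ ncN Normc.normcM ncR (ger0_norm (ltW t0)) ipZr.
  move: h1; rewrite /J raddfD /=.
  have E : Re ((- (t%:C * d n))^*%C * ip (u n) z) - Re ((- (t%:C * d n))^*%C * phi z)
      = - t * nc (d n) ^+ 2.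
    rewrite -raddfB -mulrBr -/(d n) nc_sqr; case: (d n) => p q /=; ring.
  have tq : t * (hn z ^+ 2 + 1) = 1 by rewrite mulVf// gt_eqF.
  move=> h1 h2.
  have h3 : t * nc (d n) ^+ 2 <= n.+1%:R^-1.
    have : (t * nc (d n) * hn z) ^+ 2 <= t * nc (d n) ^+ 2.
      have tz : t * hn z ^+ 2 <= 1 by rewrite -tq ler_pM2l// lerDl.
      rewrite (_ : _ ^+ 2 = t * nc (d n) ^+ 2 * (t * hn z ^+ 2)); last by ring.
      by rewrite ler_piMr// mulr_ge0 ?sqr_ge0// ltW.
    move: h1 h2 E; move: (n.+1%:R^-1) => ee *; lra.
  by rewrite -ler_pdivrMl.
have cd : nc (d n) @[n --> \oo] --> nc (ip k z - phi z).
  apply: continuous_cvg; first exact: nc_continuous.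
  apply: cvgB; last exact: cvg_cst.
  by apply: cvg_ip => //; exact: cvg_cst.
have c2 : nc (d n) ^+ 2 @[n --> \oo] --> nc (ip k z - phi z) ^+ 2 by exact: cvgM.
have b0 : (hn z ^+ 2 + 1) * n.+1%:R^-1 @[n --> \oo] --> (0 : R).
  rewrite -[X in _ --> X](mulr0 (hn z ^+ 2 + 1)); apply: cvgM; first exact: cvg_cst.
  exact: cvg_harmonic.
have : nc (ip k z - phi z) ^+ 2 <= 0.
  by apply: ler_cvg_to c2 b0 _; exact: nearW.
by move=> h; apply/eqP; rewrite -sqrf_eq0 eq_le h sqr_ge0.
Qed.

End InnerProduct.
End Hilbert.

(** * Inverting [1 - a K] by the Neumann series *)

Section Resolvent.
Context {R : realType} {H : completeNormedModType R[i]}.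
Local Notation C := (plane R).
Local Notation nc := (@Normc.normc R).
Variables (K : H -> H) (c : R).
Hypothesis c0 : 0 < c.
Hypothesis linK : forall (a : R[i]) x y, K (a *: x + y) = a *: K x + K y.
Hypothesis bK : forall x, c * hn (K x) <= hn x.

Lemma res_K0 : K 0 = 0.
Proof.
by have := linK 1 0 0; rewrite !scale1r addr0 => /eqP; rewrite -subr_eq0 opprD addrA subrr sub0r oppr_eq0 => /eqP.
Qed.

Lemma res_KZ (a : R[i]) x : K (a *: x) = a *: K x.
Proof. by have := linK a x 0; rewrite !addr0 res_K0 addr0. Qed.

Lemma res_KD x y : K (x + y) = K x + K y.
Proof. by have := linK 1 x y; rewrite !scale1r. Qed.

Lemma res_KB x y : K (x - y) = K x - K y.
Proof. by rewrite res_KD -scaleN1r res_KZ scaleN1r. Qed.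

(** By [bK] the norm of [K] is at most [1 / c], so that of [a K] is at most [1 / 2]. *)
Definition small (a : C) := nc a <= c / 2.

Lemma small_hn (a : C) x : small a -> 2 * hn (a *: K x) <= hn x.
Proof.
move=> sa; rewrite hnZ; apply: le_trans (bK x).
have := ler_wpM2r (hn_ge0 (K x)) sa; lra.
Qed.

Lemma neumann_bound (a : C) e x : small a -> x = e + (a : R[i]) *: K x -> hn x <= 2 * hn e.
Proof.
move=> sa xE; have := small_hn x sa; have := hnD e ((a : R[i]) *: K x).
rewrite -xE; lra.
Qed.

Lemma neumann_unique (a : C) e x y : small a ->
  x = e + (a : R[i]) *: K x -> y = e + (a : R[i]) *: K y -> x = y.
Proof.
move=> sa xE yE; apply/eqP; rewrite -subr_eq0 -hn_eq0 eq_le hn_ge0 andbT.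
have : x - y = 0 + (a : R[i]) *: K (x - y).
  by rewrite add0r {1}xE {1}yE res_KB scalerBr opprD addrACA subrr add0r.
by move/(neumann_bound sa); rewrite hn0 mulr0.
Qed.

(** Iteration of [x |-> e + a K x], which at least halves distances. *)
Lemma neumann_exists (a : C) e : small a -> exists x, x = e + (a : R[i]) *: K x.
Proof.
move=> sa; pose F x := e + (a : R[i]) *: K x; pose u n := iter n F 0.
have FB x y : 2 * hn (F x - F y) <= hn (x - y).
  rewrite /F opprD addrACA subrr add0r -scalerBr -res_KB; exact: small_hn.
have ub n : hn (u n) <= 2 * hn e.
  elim: n => [|n IH]; first by rewrite /u /= hn0 mulr_ge0 ?hn_ge0.
  have := small_hn (u n) sa; have := hnD e ((a : R[i]) *: K (u n)).
  rewrite -/(F (u n)) -[F (u n)]/(u n.+1); lra.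
have ud n k : 2 ^+ n * hn (u (n + k)%N - u n) <= 2 * hn e.
  elim: n => [|n IH]; first by rewrite expr0 mul1r subr0 ub.
  apply: le_trans IH; rewrite exprSr -mulrA ler_wpM2l ?exprn_ge0//.
  exact: (FB (u (n + k)%N) (u n)).
have [x ux] : exists l : H, u n @[n --> \oo] --> l.
  apply: cauchy_seq_cvg => d d0.
  have [N hN] : exists N, 4 * hn e / 2 ^+ N < d.
    have [N hN] : exists N : nat, 4 * hn e / d < N%:R.
      by exists (Num.truncn (4 * hn e / d)).+1; exact: truncnS_gt.
    exists N; rewrite ltr_pdivrMr ?exprn_gt0// -ltr_pdivrMl// mulrC.
    apply: lt_trans hN _; rewrite -natrX ltr_nat; exact: ltn_expl.
  have uN n : (N <= n)%N -> hn (u n - u N) <= 2 * hn e / 2 ^+ N.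
    by move=> Nn; rewrite ler_pdivlMr ?exprn_gt0// mulrC; have := ud N (n - N)%N; rewrite subnKC.
  exists N => n m /uN hn1 /uN hm1; have := hn_triangle (u n) (u N) (u m).
  rewrite (hnB (u N)) => h; apply: le_lt_trans hN.
  apply: le_trans h _; move: hn1 hm1; rewrite -!mulrA.
  move: (hn e * (2 ^+ N)^-1) => q; lra.
exists x; apply/eqP; rewrite -subr_eq0 -hn_eq0 eq_le hn_ge0 andbT.
have /cvg_hn h1 := ux.
have h2 : hn (x - u n.+1) @[n --> \oo] --> (0 : R) by rewrite (cvg_shiftS (fun n => hn (x - u n))).

have h3 : hn (x - u n.+1) + hn (x - u n) @[n --> \oo] --> (0 : R).
  by rewrite -[X in _ --> X]addr0; exact: cvgD h2 h1.
have h4 : hn (x - F x) @[n --> \oo] --> hn (x - F x) by exact: cvg_cst.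
apply: (ler_cvg_to h4 h3); apply: nearW => n.
have := FB (u n) x; have := hn_triangle x (u n.+1) (F x).
rewrite -[u n.+1]/(F (u n)) (hnB (u n) x); have := hn_ge0 (x - u n); lra.
Qed.

(** This is [(1 - a K)^-1 e]; under [small a] a solution exists and is unique, so the default 0 of
    [xget] is not what is returned. *)
Definition resolvent (a : C) (e : H) : H := xget 0 [set x | x = e + (a : R[i]) *: K x].

Lemma resolventE (a : C) e : small a -> resolvent a e = e + (a : R[i]) *: K (resolvent a e).
Proof.
by move=> sa; have [x xE] := neumann_exists e sa;
exact: (@xgetPex _ 0 [set x | x = e + (a : R[i]) *: K x] (ex_intro _ x xE)).
Qed.

Lemma resolvent_unique (a : C) e x : small a -> x = e + (a : R[i]) *: K x -> resolvent a e = x.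
Proof. by move=> sa xE; apply: (neumann_unique sa _ xE); exact: resolventE. Qed.

Lemma resolvent_bound (a : C) e : small a -> hn (resolvent a e) <= 2 * hn e.
Proof. by move=> sa; apply: (neumann_bound sa); exact: resolventE. Qed.

Lemma resolventL (a : C) (k : R[i]) x y : small a ->
  resolvent a (k *: x + y) = k *: resolvent a x + resolvent a y.
Proof.
move=> sa; apply: resolvent_unique => //.
rewrite linK scalerDr scalerA mulrC -scalerA {1}(resolventE x sa) {1}(resolventE y sa).
by rewrite scalerDr addrACA.
Qed.

Lemma resolventB (a : C) x y : small a -> resolvent a (x - y) = resolvent a x - resolvent a y.
Proof. by move=> sa; rewrite addrC -scaleN1r resolventL// scaleN1r addrC. Qed.

Lemma resolvent_identity (a b : C) e : small a -> small b ->
  resolvent b e - resolvent a e = (b - a : R[i]) *: resolvent b (K (resolvent a e)).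
Proof.
move=> sa sb; apply/eqP; rewrite subr_eq; apply/eqP; apply: resolvent_unique => //.
rewrite linK scalerDr scalerA mulrC -scalerA.
have gen (k y z : H) : (b - a : R[i]) *: (k + (b : R[i]) *: y) + (z + (a : R[i]) *: k) =
    z + ((b - a : R[i]) *: ((b : R[i]) *: y) + (b : R[i]) *: k).
  have -> : (b : R[i]) *: k = (b - a : R[i]) *: k + (a : R[i]) *: k by rewrite -scalerDl subrK.
  by rewrite scalerDr addrCA; congr (z + _); rewrite -addrA addrCA.
have rE := resolventE e sa; have yE := resolventE (K (resolvent a e)) sb.
by rewrite [in LHS]yE [X in _ + X = _]rE; exact: gen.
Qed.

Lemma resolvent_cvg (T : Type) (F : set_system T) (FF : Filter F) (b : T -> C) (u : T -> H)
    (a : C) (l : H) : small a -> (\forall x \near F, small (b x)) ->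
  b x @[x --> F] --> a -> u x @[x --> F] --> l ->
  resolvent (b x) (u x) @[x --> F] --> resolvent a l.
Proof.
move=> sa sb /(@cvgC R _ F) ba /cvg_hn ul.
have bn : nc (a - b x) @[x --> F] --> (0 : R).
  apply/cvgrPdist_lt => e e0; near=> x.
  by rewrite sub0r normrN ger0_norm ?nc_ge0//; near: x; exact: ba.
apply: (@cvgH_squeeze _ _ _ _ _ _ _
  (fun x => nc (a - b x) * (2 * hn (K (resolvent a l))) + 2 * hn (l - u x))).
  near=> x; have sbx : small (b x) by near: x.
  have := hn_triangle (resolvent a l) (resolvent (b x) l) (resolvent (b x) (u x)).
  rewrite -resolventB// (hnB (resolvent a l) (resolvent (b x) l)).
  rewrite (resolvent_identity l sa sbx) hnZ ncB.
  have := resolvent_bound (l - u x) sbx.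
  have := ler_wpM2l (nc_ge0 (a - b x)) (resolvent_bound (K (resolvent a l)) sbx).
  lra.
rewrite -[X in _ --> X](_ : 0 * (2 * hn (K (resolvent a l))) + 2 * 0 = 0); last by rewrite mul0r mulr0 addr0.
by apply: cvgD; [apply: cvgM => //; exact: cvg_cst|apply: cvgM => //; exact: cvg_cst].
Unshelve. all: by end_near. Qed.

Lemma K_cvg (T : Type) (F : set_system T) (FF : Filter F) (u : T -> H) (l : H) :
  u x @[x --> F] --> l -> K (u x) @[x --> F] --> K l.
Proof.
move=> /cvg_hn ul; apply: (@cvgH_squeeze _ _ _ _ _ _ _ (fun x => c^-1 * hn (l - u x))).
  by apply: nearW => x; rewrite -res_KB ler_pdivlMl.
by rewrite -[X in _ --> X](mulr0 c^-1); apply: cvgM => //; exact: cvg_cst.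
Qed.

End Resolvent.

Section VectorDerivative.
Context {R : realType} {H : completeNormedModType R[i]}.
Local Notation C := (plane R).
Local Notation nc := (@Normc.normc R).
Variables (K : H -> H) (c : R).
Hypothesis c0 : 0 < c.
Hypothesis linK : forall (a : R[i]) x y, K (a *: x + y) = a *: K x + K y.
Hypothesis bK : forall x, c * hn (K x) <= hn x.

Definition vderiv (V : normedModType R[i]) (g : C -> V) (z : C) (l : V) :=
  (h^-1 : R[i]) *: (g (h + z) - g z) @[h --> (0 : C)^'] --> l.

Lemma vderivP (V : normedModType R[i]) (g : C -> V) (z : C) (l : V) :
  vderiv g z l <-> is_derive z (1 : C) g l.
Proof.
rewrite /vderiv; have -> : (fun h : C => (h^-1 : R[i]) *: (g (h + z) - g z)) =
    (fun h : C => h^-1 *: ((g \o shift z) (h *: (1 : C)) - g z)).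
  by apply/funext => h /=; rewrite /GRing.scale /= mulr1.
split=> [gl|[gd <-]].
  by apply: DeriveDef; [apply/cvg_ex; exists l|exact: cvg_lim].
exact: gd.
Qed.

Lemma vderiv_cst (V : normedModType R[i]) (k : V) (z : C) : vderiv (fun=> k) z 0.
Proof. by rewrite /vderiv; under eq_fun do rewrite subrr scaler0; exact: cvg_cst. Qed.

Lemma vderiv_K (g : C -> H) z l : vderiv g z l -> vderiv (fun w => K (g w)) z (K l).
Proof.
move=> gl; rewrite /vderiv; have -> : (fun h : C => (h^-1 : R[i]) *: (K (g (h + z)) - K (g z))) =
    (fun h : C => K ((h^-1 : R[i]) *: (g (h + z) - g z))).
  by apply/funext => h; rewrite (res_KZ linK) (res_KB linK).
exact: (K_cvg c0 linK bK).
Qed.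

(** The product rule, the derivative of [(1 - a K)^-1] being [(1 - a K)^-1 K (1 - a K)^-1] by
    [resolvent_identity]. Applied to [K] of the family just differentiated, it gives the next
    derivative. *)
Lemma vderiv_resolvent (a0 : C) (g : C -> H) (z : C) l : nc (z - a0) < c / 2 -> vderiv g z l ->
  vderiv (fun w => resolvent K (w - a0) (g w)) z
     (resolvent K (z - a0) l + resolvent K (z - a0) (K (resolvent K (z - a0) (g z)))).
Proof.
move=> za gl; set W := resolvent K.
have sz : small c (z - a0) by exact: ltW.
have sh : \forall h \near (0 : C)^', small c (h + z - a0).
  have d0 : 0 < c / 2 - nc (z - a0) by rewrite subr_gt0.
  near=> h; rewrite /small -addrA (le_trans (ncD _ _))// -lerBrDr ltW//.
  near: h; apply: nbhs_dnbhs; apply/nbhsC; exists (c / 2 - nc (z - a0)) => // w /=.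
  by rewrite subr0.
have cb : (h + z - a0 : C) @[h --> (0 : C)^'] --> (z - a0 : C).
  apply/cvgC => e e0; apply: nbhs_dnbhs; apply/nbhsC; exists e => // w /=.
  by rewrite subr0 (_ : z - a0 - (w + z - a0) = - w) ?ncN//; ring.
have E : {near (0 : C)^', (fun h : C => W (h + z - a0) ((h^-1 : R[i]) *: (g (h + z) - g z))
     + W (h + z - a0) (K (W (z - a0) (g z)))) =1
   (fun h : C => (h^-1 : R[i]) *: (W (h + z - a0) (g (h + z)) - W (z - a0) (g z)))}.
  near=> h; have s1 : small c (h + z - a0) by near: h.
  have h0 : h != 0 by near: h; exact: (@withinT _ (nbhs (0 : C)) (fun y => y != 0) _).
  have WL := resolventL linK bK.
  rewrite /W -[_ *: (g _ - g _)]addr0 (resolventL linK bK)//.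
  rewrite (resolventB linK bK)//.
  have -> : resolvent K (h + z - a0) 0 = 0.
    by apply: (resolvent_unique linK bK s1); rewrite (res_K0 linK) scaler0 addr0.
  rewrite addr0 -[resolvent K (h + z - a0) (g (h + z)) - resolvent K (z - a0) (g z)]
     (subrKA (resolvent K (h + z - a0) (g z))).
  rewrite [RHS]scalerDr; congr (_ + _).
  rewrite (resolvent_identity linK bK)// (_ : h + z - a0 - (z - a0) = h); last by ring.
  by rewrite scalerA mulVf// scale1r.
rewrite /vderiv; apply: cvg_trans (near_eq_cvg E) _.
apply: cvgD; apply: (resolvent_cvg linK bK) => //; exact: cvg_cst.
Unshelve. all: by end_near. Qed.

End VectorDerivative.

(** * Holomorphic frames of the bundle E *)

Section Fibers.
Context {R : realType} {H : completeNormedModType R[i]}.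
Local Notation C := (plane R).
Variables (ip : {dot H for Num.conj}) (T : operator H).
Hypothesis hip : forall x : H, `|x| ^+ 2 = ip x x.
Local Notation E := (Efiber ip T).

(** [E_lambda] is the defect space, the orthogonal complement of the range of [T - conj lambda]. The
    conjugate appears because [ip] is conjugate linear in its second variable. *)
Lemma EfiberP (lambda : C) x :
  E lambda x <-> forall y, dom T y -> ip x (T y - (lambda^*%C : R[i]) *: y) = 0.
Proof.
have conv y : bracket ip (x, (lambda : R[i]) *: x) (y, T y) = - ip x (T y - (lambda^*%C : R[i]) *: y).
  by rewrite /bracket /= ipZl ipBr ipZr conjcK opprB.
split=> [h y dy|h _ [y dy <-]].
  by apply/eqP; rewrite -oppr_eq0 -conv; apply/eqP/h; exists y.
by rewrite conv h// oppr0.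
Qed.

Lemma Efiber0 (l : C) : E l 0.
Proof. by apply/EfiberP => y _; rewrite ip0l. Qed.

Lemma EfiberL (l : C) (a : R[i]) x y : E l x -> E l y -> E l (a *: x + y).
Proof.
move=> /EfiberP hx /EfiberP hy; apply/EfiberP => z dz.
by rewrite ipDl ipZl hx// hy// mulr0 addr0.
Qed.

Lemma EfiberZ (l : C) (a : R[i]) x : E l x -> E l (a *: x).
Proof. by move=> hx; have := EfiberL a hx (Efiber0 l); rewrite addr0. Qed.

Hypothesis clT : closed_operator T.
Hypothesis regT : regular_operator T.

Lemma regular_hn (l : R[i]) : exists2 c : R, 0 < c &
  forall x, dom T x -> c * hn x <= hn (T x - l *: x).
Proof.
have [c c0 hc] := regT l; exists c => // x /hc.
by rewrite !hnE -rmorphM lecR.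
Qed.

Definition shifted_range (m : R[i]) : set H := [set z | exists2 y, dom T y & z = T y - m *: y].

Lemma shifted_rangeL m (a : R[i]) x y : dom T x -> dom T y ->
  T (a *: x + y) - m *: (a *: x + y) = a *: (T x - m *: x) + (T y - m *: y).
Proof.
move=> dx dy; rewrite app_linear// scalerBr scalerDr !scalerA (mulrC m) opprD.
by rewrite addrACA.
Qed.

Lemma subspace_shifted_range m : subspace (shifted_range m).
Proof.
have [d0 dL] := dom_subspace T; split.
  exists 0 => //; have := app_linear 1 d0 d0; rewrite !scale1r addr0 => /eqP.
  rewrite -subr_eq0 opprD addrA subrr sub0r oppr_eq0 => /eqP ->.
  by rewrite scaler0 subr0.
move=> a _ _ [x dx ->] [y dy ->]; exists (a *: x + y); first exact: dL.
by rewrite shifted_rangeL.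
Qed.

(** Regularity makes the preimages of a convergent sequence Cauchy, and the closed graph contains
    the limit. *)
Lemma shifted_range_closed m : closed (shifted_range m).
Proof.
have [c c0 hc] := regular_hn m.
move=> z zcl; have /choice[y hy] : forall n : nat, exists y, dom T y /\
    hn (z - (T y - m *: y)) < n.+1%:R^-1.
  move=> n; have n0 : 0 < n.+1%:R^-1 :> R by [].
  have [|w [[y dy ->] hw]] := zcl [set w | hn (z - w) < n.+1%:R^-1].
    have /cvgH := @cvg_id _ (nbhs z).
    by move=> /(_ _ n0).
  by exists y.
have rl (n N : nat) : (N <= n)%N -> n.+1%:R^-1 <= N.+1%:R^-1 :> R.
  by move=> Nn; rewrite lef_pV2 ?posrE ?ltr0n// ler_nat.
have Sy n k : hn (y n - y k) <= c^-1 * (n.+1%:R^-1 + k.+1%:R^-1).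
  have [[dn hyn] [dk hyk]] := (hy n, hy k).
  have dnk : dom T (y n - y k).
    by rewrite addrC -scaleN1r; exact: (dom_subspace T).2.
  rewrite ler_pdivlMl//; apply: le_trans (hc _ dnk) _.
  have -> : T (y n - y k) - m *: (y n - y k) = (T (y n) - m *: y n) - (T (y k) - m *: y k).
    have := shifted_rangeL m (-1) dk dn; rewrite !scaleN1r.
    by rewrite (addrC (- y k)) => ->; rewrite addrC.
  have := hn_triangle (T (y n) - m *: y n) z (T (y k) - m *: y k).
  rewrite (hnB _ z) => /le_trans; apply; rewrite lerD// ltW//.
have cvh : (n.+1%:R^-1 : R) @[n --> \oo] --> (0 : R) by exact: cvg_harmonic.
have [x yx] : exists l : H, y n @[n --> \oo] --> l.
  apply: cauchy_seq_cvg => e e0.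
  have ce : 0 < c * e / 2 by rewrite divr_gt0// mulr_gt0.
  have /cvgrPdist_lt/(_ _ ce)[N _ /(_ N (leqnn N))] := cvh.
  rewrite /= sub0r normrN ger0_norm ?invr_ge0// => hN.
  exists N => n k Nn Nk; apply: le_lt_trans (Sy n k) _.
  rewrite ltr_pdivrMl//; move: (rl _ _ Nn) (rl _ _ Nk) hN.
  move: (n.+1%:R^-1) (k.+1%:R^-1) (N.+1%:R^-1) => a b d *; lra.
have zc : T (y n) - m *: y n @[n --> \oo] --> z.
  apply: (@cvgH_squeeze _ _ _ _ _ _ _ (fun n => n.+1%:R^-1)); last exact: cvh.
  by apply: nearW => n; apply: ltW; exact: (hy n).2.
have Tc : T (y n) @[n --> \oo] --> z + m *: x.
  have -> : (fun n => T (y n)) = (fun n => (T (y n) - m *: y n) + m *: y n).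
    by apply/funext => n; rewrite subrK.
  by apply: cvgD => //; apply: cvgZ => //; exact: cvg_cst.
have [w dw [wx Tw]] : graph T (x, z + m *: x).
  apply: (@closed_cvg nat _ \oo _ (fun n => (y n, T (y n))) (graph T) clT).
    by apply: nearW => n; exists (y n) => //; exact: (hy n).1.
  exact: cvg_pair.
by rewrite wx in dw Tw; exists x => //; rewrite Tw addrK.
Qed.

Lemma shift_operator (l0 : C) : exists (K : H -> H) (c : R), [/\ 0 < c,
  forall (a : R[i]) x y, K (a *: x + y) = a *: K x + K y,
  forall x, c * hn (K x) <= hn x,
  forall x, shifted_range l0^*%C (K x) &
  forall x y, dom T y -> ip (K x) (T y - (l0^*%C : R[i]) *: y) = ip x y].
Proof.
set m : R[i] := l0^*%C; have [c c0 hc] := regular_hn m.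
pose M := shifted_range m; have sM : subspace M := subspace_shifted_range m.
have cM : closed M := @shifted_range_closed m.
have inj x y : dom T x -> dom T y -> T x - m *: x = T y - m *: y -> x = y.
  move=> dx dy xy; apply/eqP; rewrite -subr_eq0 -hn_eq0 eq_le hn_ge0 andbT.
  have dxy : dom T (- 1 *: y + x) by exact: (dom_subspace T).2.
  have := hc _ dxy; rewrite shifted_rangeL// xy !scaleN1r addNr hn0 addrC.
  by rewrite pmulr_rle0.
(* [S] is [(T - m)^-1] on [M]; elsewhere its values are irrelevant. *)
have /choice[S hS] : forall z, exists y, M z -> dom T y /\ z = T y - m *: y.
  by move=> z; have [[y dy ->]|nz] := pselect (M z); [exists y|exists 0].
have SE y : dom T y -> S (T y - m *: y) = y.
  move=> dy; have [|d e] := hS (T y - m *: y); first by exists y.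
  by apply: inj.
have SL a z w : M z -> M w -> S (a *: z + w) = a *: S z + S w.
  move=> [z' dz ->] [w' dw ->]; rewrite -shifted_rangeL// !SE//.
  exact: (dom_subspace T).2.
have Sb z : M z -> hn (S z) <= c^-1 * hn z.
  by move=> [y dy ->]; rewrite SE// ler_pdivlMl// hc.
have /choice[K hK] : forall x, exists k, M k /\ forall z, M z -> ip k z = ip x (S z).
  move=> x; have [|z Mz|k Mk hk] := @riesz _ _ ip hip M (fun z => ip x (S z)) (hn x * c^-1) sM cM.
  - by move=> a z w Mz Mw; rewrite SL// ipDr ipZr.
  - rewrite -mulrA (le_trans (cauchy_schwarz hip _ _))// ler_wpM2l ?hn_ge0//; exact: Sb.
  - by exists k.
exists K, c; split => //.
- move=> a x y; apply: (orth_inj hip sM).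
  + exact: (hK _).1.
  + by apply: sM.2; exact: (hK _).1.
  + move=> z Mz; rewrite (hK _).2// ipDl ipZl ipDl ipZl.
    by rewrite (hK x).2// (hK y).2.
(* [|K x| ^ 2 = ip x (S (K x))], and [S] is bounded by [1 / c] on [M]. *)
- move=> x; have [->|k0] := eqVneq (K x) 0; first by rewrite hn0 mulr0 hn_ge0.
  have [Mk hk] := hK x; have kp : 0 < hn (K x) by rewrite hn_gt0.
  have := hk _ Mk; rewrite (ipxx hip) => e.
  have := cauchy_schwarz hip x (S (K x)); rewrite -e ncR ger0_norm ?sqr_ge0// expr2.
  have := ler_wpM2l (hn_ge0 x) (Sb _ Mk); rewrite mulrA => h1 h2.
  have := le_trans h2 h1; rewrite ler_pM2r// mulrC => h3.
  by rewrite -ler_pdivlMl.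
- by move=> x; exact: (hK x).1.
- by move=> x y dy; rewrite (hK x).2 ?SE//; exists y.
Qed.

End Fibers.

Section Frame.
Context {R : realType} {H : completeNormedModType R[i]}.
Local Notation C := (plane R).
Local Notation nc := (@Normc.normc R).
Local Notation Im := (@complex.Im R).
Variables (ip : {dot H for Num.conj}) (T : operator H).
Hypothesis hip : forall x : H, `|x| ^+ 2 = ip x x.
Hypothesis hT : entire_operator11 ip T.
Local Notation E := (Efiber ip T).

Let regT := entire_regular hT.

Lemma graphL (a : R[i]) (X Y : H * H) : graph T X -> graph T Y -> graph T (a *: X + Y).
Proof.
move=> [x dx <-] [y dy <-]; exists (a *: x + y); first exact: (dom_subspace T).2.
by rewrite app_linear.
Qed.

(** A nonzero such [x] would be an eigenvector of [T], which regularity excludes. Hence [E_l] embeds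
    into the quotient of [graph_perp] by the graph. *)
Lemma graph_Efiber l x : graph T (x, (l : R[i]) *: x) -> x = 0.
Proof.
move=> [y dy [yx Ty]]; rewrite yx in dy Ty.
have [c c0 hc] := regular_hn regT l.
have := hc _ dy; rewrite Ty subrr hn0 pmulr_rle0// => h.
by apply/eqP; rewrite -hn_eq0 eq_le h hn_ge0.
Qed.

Local Notation Q := (fun X Y : H * H => - 'i%C * bracket ip X Y).

Lemma bracketL (a : R[i]) X Y Z : bracket ip (a *: X + Y) Z = a * bracket ip X Z + bracket ip Y Z.
Proof. by rewrite /bracket /= !ipDl !ipZl; ring. Qed.

Lemma bracketC X Y : bracket ip Y X = - (bracket ip X Y)^*%C.
Proof. by rewrite /bracket (ipC ip X.1 Y.2) (ipC ip X.2 Y.1) rmorphB /= opprB. Qed.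

(** The form is blind to [g]: the graph is isotropic by symmetry, and orthogonal to [(x, l x)] by
    the definition of [E_l]. *)
Lemma Q_Efiber l (x : H) (g : H * H) : E l x -> graph T g ->
  Q ((x, (l : R[i]) *: x) - g) ((x, (l : R[i]) *: x) - g) = (2 * Im l * hn x ^+ 2)%:C.
Proof.
move=> Ex gT; have [y dy yg] := gT.
have gg : bracket ip g g = 0.
  by rewrite -yg /bracket /= (entire_symmetric hT dy dy) subrr.
have xg : bracket ip (x, (l : R[i]) *: x) g = 0 by exact: Ex.
have gx : bracket ip g (x, (l : R[i]) *: x) = 0 by rewrite bracketC xg conjc0 oppr0.
have -> : (x, (l : R[i]) *: x) - g = -1 *: g + (x, (l : R[i]) *: x) by rewrite scaleN1r addrC.
set Z := -1 *: g + _.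
have gZ : bracket ip g Z = 0 by rewrite bracketC /Z bracketL gg xg mulr0 addr0 conjc0 oppr0.
have XZ : bracket ip (x, (l : R[i]) *: x) Z = bracket ip (x, (l : R[i]) *: x) (x, (l : R[i]) *: x).
  by rewrite bracketC /Z bracketL gx mulr0 add0r -bracketC.
rewrite {1}/Z bracketL gZ XZ mulr0 add0r /bracket /= ipZl ipZr (ipxx hip).
by apply/eqP; rewrite eq_complex /=; case: (l) => a b /=; apply/andP; split; apply/eqP; ring.
Qed.

(* On the vectors [(x, l x)] the form is [2 Im l] times the inner product, so they
   cannot span both a positive and a negative line. *)
Lemma Efiber_line l x y : E l x -> E l y -> x != 0 -> exists k : R[i], y = k *: x.
Proof.
move=> Ex Ey x0.
have [u [v [[Wu Wv] Quu Qvv Quv dec]]] := entire_deficiency hT.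
pose X z : H * H := (z, (l : R[i]) *: z).
have dec1 z : E l z -> exists a b : R[i], graph T (X z - (a *: u ord0 + b *: v ord0)).
  by move=> /dec[a [b]]; rewrite !big_ord1; exists (a ord0), (b ord0).
have XL (a b : R[i]) : X (a *: x + b *: y) = a *: X x + b *: X y.
  by congr (_, _); rewrite /= scalerDr !scalerA !(mulrC (l : R[i])).
have [a [b gx]] := dec1 _ Ex; have [a' [b' gy]] := dec1 _ Ey.
(* If [(z, l z)] equals [k w] modulo the graph, its form is [|k|^2] times that of [w]. The sign [s]
   is that of [w], for use with both [u] and [v]. *)
have key (k : R[i]) z (g w : H * H) (s : bool) : E l z -> graph T (X z - k *: w) ->
  Q w w = (-1) ^+ s -> (nc k ^+ 2 * (-1) ^+ s = 2 * Im l * hn z ^+ 2)%R.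
  move=> Ez gz Qw; have := Q_Efiber Ez gz; rewrite -/(X z) subKr.
  rewrite -[k *: w]addr0 bracketL (bracketC (k *: w + 0) w) bracketL.
  have -> : bracket ip 0 w = 0 by rewrite /bracket /= !ip0l subrr.
  have -> : bracket ip 0 (k *: w + 0) = 0 by rewrite /bracket /= !ip0l subrr.
  rewrite !addr0 rmorphM -mulrN -bracketC => e.
  have {}e : (k * k^*%C) * (- 'i%C * bracket ip w w) = (2 * Im l * hn z ^+ 2)%:C.
    by rewrite -e /=; ring.
  apply: complexI; rewrite -e Qw rmorphM rmorph_sign; congr (_ * _).
  by apply/eqP; rewrite eq_complex nc_sqr; case: (k) => p q /=; apply/andP; split; apply/eqP; ring.
have Ecomb (p q : R[i]) : E l (p *: x + q *: y) by exact: EfiberL (EfiberZ _ Ey).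
pose D := a * b' - a' * b.
have comb (p q : R[i]) : graph T (X (p *: x + q *: y) -
    ((p * a + q * a') *: u ord0 + (p * b + q * b') *: v ord0)).
  have := graphL p gx (graphL q gy (graphL (-1) gx gx)).
  rewrite scaleN1r addNr addr0; congr graph.
  rewrite XL !scalerBr addrACA -opprD; congr (_ - _).
  by rewrite !scalerDr !scalerA !scalerDl addrACA.
(* For [D != 0] Cramer's combinations isolate [u] and [v], so [|D|^2] and [- |D|^2] would both be
   nonnegative multiples of [Im l]. *)
have [D0|D0] := eqVneq D 0; last first.
  have h1 : graph T (X (b' *: x + (- b) *: y) - D *: u ord0).
    have := comb b' (- b); have -> : b' * b + - b * b' = 0 by ring.
    by rewrite scale0r addr0; congr (graph _ (_ - _ *: _)); rewrite /D; ring.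
  have h2 : graph T (X ((- a') *: x + a *: y) - D *: v ord0).
    have := comb (- a') a; have -> : - a' * a + a * a' = 0 by ring.
    by rewrite scale0r add0r; congr (graph _ (_ - _ *: _)); rewrite /D; ring.
  have := key D _ 0 _ false (Ecomb _ _) h1 (Quu _ _).
  have := key D _ 0 _ true (Ecomb _ _) h2 (Qvv _ _).
  rewrite expr0 expr1 mulr1 mulrN1.
  have : 0 < nc D ^+ 2 by rewrite exprn_gt0// nc_gt0.
  move: (hn _) (hn _) (nc D ^+ 2) => p q d d0 e1 e2.
  have [i0|i0] := leP (Im l) 0; have := sqr_ge0 p; have := sqr_ge0 q; nra.
(* For [D = 0] the coordinates of [x] and [y] are proportional, and a combination lying in the graph
   is zero by [graph_Efiber]. *)
have fin (p q : R[i]) : p * a + q * a' = 0 -> p * b + q * b' = 0 -> p *: x + q *: y = 0.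
  move=> e1 e2; apply: (@graph_Efiber l); have := comb p q.
  by rewrite e1 e2 !scale0r addr0 subr0.
have solve (p q : R[i]) : q != 0 -> p *: x + q *: y = 0 -> exists k : R[i], y = k *: x.
  move=> q0 e; exists (- (q^-1 * p)).
  have : q^-1 *: (p *: x + q *: y) = 0 by rewrite e scaler0.
  rewrite scalerDr !scalerA mulVf// scale1r scaleNr => /eqP.
  by rewrite addrC addr_eq0 => /eqP.
have [a0|a0] := eqVneq a 0; last first.
  apply: (solve a' (- a)); first by rewrite oppr_eq0.
  apply: fin; first by ring.
  by move/eqP: D0; rewrite /D subr_eq0 => /eqP; rewrite mulNr => ->; ring.
have [b0|b0] := eqVneq b 0; last first.
  apply: (solve b' (- b)); first by rewrite oppr_eq0.
  apply: fin; last by ring.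
  by move/eqP: D0; rewrite /D subr_eq0 => /eqP e; rewrite mulrC e; ring.
case/eqP: x0; have := fin 1 0; rewrite a0 b0 scale1r scale0r addr0.
by apply; ring.
Qed.

(** The frame is [v z = (1 - (z - l0) K)^-1 e0]. The range of [K] is orthogonal to [e0], so
    [ip (v z) e0] stays 1 and [ip x e0] reads off the coefficient of [x] in the frame. Two
    derivatives and the continuity of the second are kept for the curvature. *)
Lemma local_frame (l0 : C) (e0 : H) : E l0 e0 -> ip e0 e0 = 1 ->
  exists (r : R) (v v1 v2 : C -> H), 0 < r /\ forall z, nc (z - l0) < r ->
   [/\ E z (v z) /\ ip (v z) e0 = 1, forall x, E z x -> x = ip x e0 *: v z,
     vderiv v z (v1 z), vderiv v1 z (v2 z) & v2 w @[w --> z] --> v2 z].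
Proof.
move=> E0 e01; have [K [c [c0 linK bK rK hK]]] := shift_operator hip (entire_closed hT) regT l0.
have Ke0 x : ip (K x) e0 = 0.
  have [y dy ->] := rK x; rewrite ipC; move/EfiberP: E0 => ->//.
  by rewrite conjc0.
have tr z x : E z x <-> E l0 (x - (z - l0 : R[i]) *: K x).
  have e y : dom T y -> ip (x - (z - l0 : R[i]) *: K x) (T y - (l0^*%C : R[i]) *: y)
     = ip x (T y - (z^*%C : R[i]) *: y).
    move=> dy; rewrite ipBl ipZl hK// !ipBr !ipZr !conjcK; ring.
  split=> /EfiberP h; apply/EfiberP => y dy; first by rewrite e// h.
  by rewrite -e// h.
pose W (z : C) := resolvent K (z - l0).
have WE z x : nc (z - l0) < c / 2 -> W z x = x + (z - l0 : R[i]) *: K (W z x).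
  by move=> zl; apply: (resolventE linK bK); exact: ltW.
have W0 z : nc (z - l0) < c / 2 -> W z 0 = 0.
  move=> zl; apply: (resolvent_unique linK bK); first exact: ltW.
  by rewrite (res_K0 linK) scaler0 addr0.
pose v (z : C) := W z e0; pose v1 (z : C) := W z (K (v z)).
pose v2 (z : C) := W z (K (v1 z)) + W z (K (v1 z)).
have c2 : 0 < c / 2 by rewrite divr_gt0.
have Wc (z : C) (g : C -> H) : nc (z - l0) < c / 2 -> g w @[w --> z] --> g z ->
    W w (g w) @[w --> z] --> W z (g z).
  move=> zl gz;
  apply: (@resolvent_cvg _ _ K c linK bK _ _ (nbhs_filter z) (fun w : C => w - l0) g (z - l0) (g z)) => //; first exact: (ltW zl).
    have d0 : 0 < c / 2 - nc (z - l0) by rewrite subr_gt0.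
    apply/nbhsC; exists (c / 2 - nc (z - l0)) => // w hw; rewrite /small ltW//.
    by rewrite -[w - l0](subrKA z) (le_lt_trans (ncD _ _))// -ltrBrDr.
  by apply: cvgB; [exact: cvg_id|exact: cvg_cst].
have Kc (z : C) (g : C -> H) : g w @[w --> z] --> g z -> K (g w) @[w --> z] --> K (g z).
  exact: (@K_cvg _ _ K c c0 linK bK _ _ (nbhs_filter z)).
exists (c / 2), v, v1, v2; split=> // z zl.
have dv w : nc (w - l0) < c / 2 -> vderiv v w (v1 w).
  move=> wl; have := vderiv_resolvent linK bK wl (vderiv_cst e0 w).
  by rewrite -/(W w) W0// add0r.
have cv : v w @[w --> z] --> v z by exact: (Wc z (fun=> e0) zl (@cvg_cst _ e0 _ _ (nbhs_filter z))).
have cv1 : v1 w @[w --> z] --> v1 z by exact: (Wc z (fun w => K (v w)) zl (Kc z v cv)).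
split.
- split.
    by apply/tr; rewrite {1}/v WE// addrK.
  by rewrite /v WE// ipDl ipZl Ke0 mulr0 addr0.
- move=> x /tr Ex; have e0N : e0 != 0.
    by apply: contra_eq_neq e01 => ->; rewrite ip0l eq_sym oner_eq0.
  have [k hk] := Efiber_line E0 Ex e0N.
  have xe : ip x e0 = k.
    rewrite -[x](subrK ((z - l0 : R[i]) *: K x)) hk ipDl !ipZl Ke0 e01; ring.
  rewrite xe; apply: (neumann_unique (e := k *: e0) linK bK (ltW zl)).
    by rewrite -hk subrK.
  by rewrite (res_KZ linK) scalerA mulrC -scalerA -scalerDr -WE.
- exact: dv.
- exact: (vderiv_resolvent linK bK zl (vderiv_K c0 linK bK (dv _ zl))).
- have h := Wc z (fun w => K (v1 w)) zl (Kc z v1 cv1).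
  exact: (cvgD h h).
Qed.

Lemma trivial_fiber_open (l0 : C) : (forall x, E l0 x -> x = 0) ->
  exists2 r : R, 0 < r & forall z, nc (z - l0) < r -> forall x, E z x -> x = 0.
Proof.
move=> E0; have [K [c [c0 linK bK rK hK]]] := shift_operator hip (entire_closed hT) regT l0.
exists (c / 2) => [|z zl x /EfiberP Ex]; first by rewrite divr_gt0.
have : E l0 (x - (z - l0 : R[i]) *: K x).
  apply/EfiberP => y dy; rewrite ipBl ipZl hK//.
  have := Ex _ dy; rewrite !ipBr !ipZr !conjcK => e; rewrite -[RHS]e; ring.
move/E0/eqP; rewrite subr_eq0 => /eqP xE.
have := @neumann_bound _ _ K c bK (z - l0) 0 x (ltW zl).
rewrite add0r => /(_ xE); rewrite hn0 mulr0 => h.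
by apply/eqP; rewrite -hn_eq0 eq_le h hn_ge0.
Qed.

Lemma unit_vector (l : C) x : E l x -> x != 0 -> exists2 e, E l e & ip e e = 1.
Proof.
move=> Ex x0; exists ((hn x)^-1%:C *: x); first exact: EfiberZ.
by rewrite ipxx// hnZ ncR ger0_norm ?invr_ge0 ?hn_ge0// mulVf ?expr1n// hn_eq0.
Qed.

(** Connectedness of the segment from [l0] to [l1]; it serves both the nontriviality of the fibres
    and the identity theorem for sections. *)
Lemma plane_connected (P : set C) (l0 l1 : C) : open P -> open (~` P) -> P l0 -> P l1.
Proof.
move=> oP cP P0; pose g (t : R) : C := l0 + t%:C * (l1 - l0).
have cg : continuous g.
  move=> t; apply: cvgD; first exact: cvg_cst.
  have h1 := @cvgRC R _ _ (nbhs_filter t) id t (@cvg_id _ (nbhs t)).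
  exact: (cvgM h1 (@cvg_cst _ (l1 - l0) _ _ _)).
have := @segment_connected R 0 1 (`[0, 1] `&` (g @^-1` P)).
move=> h; have {}h : `[0, 1]%classic `&` (g @^-1` P) = `[0, 1]%classic.
  apply: h.
  - exists 0; split; first by rewrite /= in_itv /= lexx ler01.
    by rewrite /= /g mul0r addr0.
  - by exists (g @^-1` P) => //; exact: open_comp.
  - exists (g @^-1` P) => //; rewrite -[_ @^-1` _]setCK; apply: open_closedC.
    by rewrite preimage_setC; exact: open_comp.
have : `[(0 : R), 1]%classic 1 by rewrite /= in_itv /= lexx ler01.
by rewrite -h => -[_]; rewrite /= /g mul1r addrC subrK.
Qed.

Lemma fiber_nontrivial (l0 l1 : C) x : E l0 x -> x != 0 -> exists2 e, E l1 e & ip e e = 1.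
Proof.
move=> Ex x0; pose P := [set z : C | exists2 y, E z y & y != 0].
have oP : open P.
  rewrite openE => z [y Ey y0]; have [e Ee e1] := unit_vector Ey y0.
  have [r [v [v1 [v2 [r0 hv]]]]] := local_frame Ee e1.
  apply/nbhsC; exists r => // w /hv[[Ew vw] _ _ _ _]; exists (v w) => //.
  by apply: contra_eq_neq vw => ->; rewrite ip0l eq_sym oner_eq0.
have cP : open (~` P).
  rewrite openE => z nPz.
  have [|r r0 hr] := @trivial_fiber_open z.
    by move=> y Ey; apply: contrapT => /eqP y0; apply: nPz; exists y.
  by apply/nbhsC; exists r => // w /hr h [y /h ->]; rewrite eqxx.
have [y Ey y0] : P l1 by apply: (plane_connected (l0 := l0)) => //; exists x.
exact: unit_vector Ey y0.
Qed.

End Frame.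

(** * Curvature of F *)

Section LogNorm.
Context {R : realType} {H : completeNormedModType R[i]}.
Local Notation C := (plane R).
Local Notation Re := (@complex.Re R).
Local Notation Im := (@complex.Im R).
Variables (ip : {dot H for Num.conj}).
Hypothesis hip : forall x : H, `|x| ^+ 2 = ip x x.

Lemma vderiv_continuous (V : normedModType R[i]) (f : C -> V) (z : C) (l : V) :
  vderiv f z l -> {for z, continuous f}.
Proof.
move=> /vderivP[fd _]; apply: differentiable_continuous.
exact/derivable1_diffP.
Qed.

Lemma real_deriv_ip (f g : R -> H) (l m : H) : real_deriv f l -> real_deriv g m ->
  real_deriv (fun t => ip (f t) (g t) : C) (ip l (g 0) + ip (f 0) m).
Proof.
move=> fl gm; have cg := real_deriv_continuous gm; rewrite /real_deriv.
have cg' : g t @[t --> (0 : R)^'] --> g 0 by exact: cg.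
have -> : (fun t : R => (t^-1)%:C *: (ip (f t) (g t) - ip (f 0) (g 0) : C)) =
    (fun t : R => (ip ((t^-1)%:C *: (f t - f 0)) (g t) + ip (f 0) ((t^-1)%:C *: (g t - g 0)) : C)).
  apply/funext => t; rewrite ipZl ipZr conjc_real ipBl ipBr -mulrDr /GRing.scale /=.
  by congr (_ * _); rewrite addrA subrK.
apply: cvgD; first by apply: (cvg_ip hip); [exact: fl|exact: cg'].
by apply: (cvg_ip hip); [exact: cvg_cst|exact: gm].
Qed.

Let conj_line (z d : C) (t : R) : ((z + t%:C * d)^*%C : C) = z^*%C + t%:C * d^*%C.
Proof. by case: z d => a b [c d]; apply/eqP; rewrite eq_complex /=; apply/andP; split; apply/eqP; ring. Qed.

Lemma real_deriv_conj (v : C -> H) (z d : C) (l : H) : vderiv v z^*%C l ->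
  real_deriv (fun t : R => v (z + t%:C * d)^*%C) ((d^*%C : R[i]) *: l).
Proof.
move=> /vderivP vl; have := @is_derive_real_deriv R H v z^*%C d^*%C l vl; congr real_deriv.
by apply/funext => t; rewrite conj_line.
Qed.

Section Formulas.
Variables v v1 v2 : C -> H.
Let N (z : C) : R := hn (v z^*%C) ^+ 2.
Let q (z : C) : C := ip (v z^*%C) (v1 z^*%C).
Let q2 (z : C) : C := ip (v z^*%C) (v2 z^*%C).
Let n1 (z : C) : R := hn (v1 z^*%C) ^+ 2.
Let p (z : C) : C := ((N z)^-1)%:C * q z.
Let pxx (z : C) : R := (n1 z + Re (q2 z)) / N z - 2 * Re (q z) ^+ 2 / N z ^+ 2.
Let pyy (z : C) : R := (Re (q2 z) - n1 z) / N z + 2 * Im (q z) ^+ 2 / N z ^+ 2.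

(** Here [dN / dz = q], as [ip] is conjugate linear in its second variable and [v] is taken at the
    conjugate point; hence [p = q / N]. The derivatives of [q] in the directions 1 and [i] are
    [n1 + q2] and [i (q2 - n1)], and the quotient rule gives [pxx] and [pyy]. *)
Lemma smooth2_ln_norm : exists p pxx pyy, forall z : C,
  vderiv v z^*%C (v1 z^*%C) -> vderiv v1 z^*%C (v2 z^*%C) -> v2 w @[w --> (z^*%C : C)] --> v2 z^*%C ->
  v z^*%C != 0 -> smooth2_at (fun w => ln (hn (v w^*%C) ^+ 2)) p pxx pyy z.
Proof.
exists p, pxx, pyy => z dv dv1 c2 vz.
have Nz : 0 < N z by rewrite exprn_gt0// hn_gt0.
have N0 : N z != 0 by rewrite gt_eqF.
have cj : (w^*%C : C) @[w --> z] --> (z^*%C : C) by exact: (@continuousJ R z).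
have cv : v w^*%C @[w --> z] --> v z^*%C by exact: (cvg_comp _ _ cj (vderiv_continuous dv)).
have cv1 : v1 w^*%C @[w --> z] --> v1 z^*%C by exact: (cvg_comp _ _ cj (vderiv_continuous dv1)).
have cv2 : v2 w^*%C @[w --> z] --> v2 z^*%C by exact: (cvg_comp _ _ cj c2).
have cRe (f : C -> C) (l : C) : f w @[w --> z] --> l -> Re (f w) @[w --> z] --> Re l.
  by move=> fl; apply: (cvg_comp _ _ fl); exact: continuous_Re.
have cIm (f : C -> C) (l : C) : f w @[w --> z] --> l -> Im (f w) @[w --> z] --> Im l.
  by move=> fl; apply: (cvg_comp _ _ fl); exact: continuous_Im.
have chn (f : C -> H) (l : H) : f w @[w --> z] --> l -> hn (f w) ^+ 2 @[w --> z] --> hn l ^+ 2.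
  move=> fl; have := cRe _ _ (@cvg_ip _ _ ip hip _ _ (nbhs_filter z) _ _ _ _ fl fl); rewrite (ipxx hip) /=.
  by under eq_fun do rewrite (ipxx hip).
have cN : N w @[w --> z] --> N z by exact: chn.
have cn1 : n1 w @[w --> z] --> n1 z by exact: chn.
have cq : q w @[w --> z] --> q z by exact: (@cvg_ip _ _ ip hip _ _ (nbhs_filter z)).
have cq2 : q2 w @[w --> z] --> q2 z by exact: (@cvg_ip _ _ ip hip _ _ (nbhs_filter z)).
have cVN : (N w)^-1 @[w --> z] --> (N z)^-1 by exact: (cvgV N0 cN).
have cVN2 : (N w ^+ 2)^-1 @[w --> z] --> (N z ^+ 2)^-1.
  have n2 : N z * N z != 0 by rewrite mulf_neq0.
  exact: (cvgV n2 (cvgM cN cN)).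
have z0 (d : C) : z + (0 : R)%:C * d = z by rewrite mul0r addr0.
have DN (d : C) : is_derive (0 : R) 1 (fun t : R => N (z + t%:C * d)) (2 * Re (d * q z)).
  have := real_deriv_Re (real_deriv_ip (real_deriv_conj (d := d) dv) (real_deriv_conj (d := d) dv)); rewrite z0.
  rewrite ipZl ipZr conjcK (ipC ip (v z^*%C) (v1 _)).
  have -> : 2 * Re (d * q z) = Re (d^*%C * (ip (v z^*%C) (v1 z^*%C))^*%C + d * ip (v z^*%C) (v1 z^*%C)).
    by rewrite /q; case: (d) (ip _ _) => a b [x y] /=; ring.
  by congr is_derive; apply/funext => t /=; rewrite (ipxx hip).
have Dq (d : C) : real_deriv (fun t : R => q (z + t%:C * d)) (d^*%C * (n1 z)%:C + d * q2 z).
  have := real_deriv_ip (real_deriv_conj (d := d) dv) (real_deriv_conj (d := d) dv1); rewrite z0.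
  by rewrite ipZl ipZr conjcK (ipxx hip).
have DV (d : C) : is_derive (0 : R) 1 (fun t : R => (N (z + t%:C * d))^-1)
    (- (N z) ^- 2 * (2 * Re (d * q z))).
  by have := is_deriveV _ (DN d); rewrite /= z0 /GRing.scale /=; exact.
split.
- move=> d; have := is_derive_ln (g := fun t => N (z + t%:C * d)) (x := 0) (l := 2 * Re (d * q z)).
  rewrite z0 => /(_ Nz (DN d)); congr is_derive.
  by rewrite /p; case: (d) (q z) => a b [x y] /=; field.
- have -> : (fun t : R => Re (p (z + t%:C * 1))) =
      (fun t : R => (N (z + t%:C * 1))^-1) * (Re \o (fun t : R => q (z + t%:C * 1))).
    by apply/funext => t; rewrite !fctE /p /=; case: (q _) => x y /=; ring.
  have := is_deriveM (DV 1) (real_deriv_Re (Dq 1)); congr is_derive.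
  rewrite z0 /= z0 /pxx /GRing.scale /=; case: (q z) (q2 z) => a b [x y] /=; field.
  exact: N0.
- have -> : (fun t : R => Im (p (z + t%:C * 'i%C))) =
      (fun t : R => (N (z + t%:C * 'i%C))^-1) * (Im \o (fun t : R => q (z + t%:C * 'i%C))).
    by apply/funext => t; rewrite !fctE /p /=; case: (q _) => x y /=; ring.
  have := is_deriveM (DV 'i%C) (real_deriv_Im (Dq 'i%C)); congr is_derive.
  rewrite z0 /= z0 /pyy /GRing.scale /=; case: (q z) (q2 z) => a b [x y] /=; field.
  exact: N0.
- split.
    apply: (@continuous_comp _ _ _ N (@ln R)); first exact: cN.
    exact: continuous_ln.
  have h := @cvgRC R _ _ (nbhs_filter z) _ _ cVN.
  exact: (cvgM h cq).
- have c2z : (2 : R) @[w --> z] --> (2 : R) by exact: (@cvg_cst R (2 : R) C (nbhs z) (nbhs_filter z)).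
  have cr := cRe _ _ cq; have ci := cIm _ _ cq; have cr2 := cRe _ _ cq2.
  have h1 := cvgM (cvgD cn1 cr2) cVN; have h2 := cvgM (cvgB cr2 cn1) cVN.
  have h3 := cvgM (cvgM c2z (cvgM cr cr)) cVN2; have h4 := cvgM (cvgM c2z (cvgM ci ci)) cVN2.
  by split; [exact: (@cvgB _ _ _ _ (nbhs_filter z) _ _ _ _ (h1 _ _) (h3 _ _ _))|exact: (@cvgD _ _ _ _ (nbhs_filter z) _ _ _ _ (h2 _ _) (h4 _ _ _))].
Qed.
End Formulas.
End LogNorm.

(** * Sections of F in local frames *)

Section Coefficients.
Context {R : realType} {H : completeNormedModType R[i]}.
Local Notation C := (plane R).
Local Notation nc := (@Normc.normc R).
Variables (ip : {dot H for Num.conj}) (T : operator H).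
Hypothesis hip : forall x : H, `|x| ^+ 2 = ip x x.
Local Notation E := (Efiber ip T).

Lemma ncJB (z w : C) : nc (z^*%C - w^*%C) = nc (z - w).
Proof. by rewrite -rmorphB ncJ. Qed.

Lemma open_nc_ball (a : C) (r : R) : open [set w : C | nc (w - a) < r].
Proof.
rewrite openE => z /= za; apply/nbhsC; exists (r - nc (z - a)); first by rewrite subr_gt0.
move=> w wz; rewrite /= (_ : w - a = (w - z) + (z - a)); last by ring.
by rewrite (le_lt_trans (ncD _ _))// -ltrBrDr.
Qed.

(** Schwarz reflection: conjugating both the argument and the value preserves holomorphy. *)
Lemma cdiff_at_conj (f : C -> C) (z l : C) : cdiff_at f z^*%C l ->
  cdiff_at (fun w : C => (f w^*%C)^*%C) z l^*%C.
Proof.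
move=> fl e e0; have [d d0 hd] := fl e e0; exists d => // w wd.
have := hd w^*%C; rewrite ncJB => /(_ wd); rewrite -[X in X <= _ -> _]ncJ.
have cM (x y : C) : (x * y)^*%C = x^*%C * y^*%C by exact: rmorphM.
have cB (x y : C) : (x - y)^*%C = x^*%C - y^*%C by exact: rmorphB.
by rewrite !(cB, cM) !conjcK.
Qed.

Lemma vderiv_ip (v : C -> H) (z : C) (l e : H) : vderiv v z l ->
  cdiff_at (fun w => ip (v w) e) z (ip l e).
Proof.
move=> vl; apply/cdiff_atP/vderivP; rewrite /vderiv.
have -> : (fun h : C => (h^-1 : R[i]) *: (ip (v (h + z)) e - ip (v z) e : C)) =
   (fun h : C => ip ((h^-1 : R[i]) *: (v (h + z) - v z)) e : C).
  by apply/funext => h; rewrite ipZl ipBl.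
by apply: (cvg_ip hip); [exact: vl|exact: cvg_cst].
Qed.

(** Frames of [E] with their first two derivatives, chosen at once for all centres [l0]. Every point
    is treated with the frame centred there, which avoids transition functions. *)
Definition frame_data (rho : C -> R) (e0 : C -> H) (V V1 V2 : C -> C -> H) :=
  forall l0 : C, 0 < rho l0 /\ forall z, nc (z - l0) < rho l0 ->
   [/\ E z (V l0 z) /\ ip (V l0 z) (e0 l0) = 1,
     forall x, E z x -> x = ip x (e0 l0) *: V l0 z,
     vderiv (V l0) z (V1 l0 z), vderiv (V1 l0) z (V2 l0 z) & V2 l0 w @[w --> z] --> V2 l0 z].

Lemma exists_frame_data (l : C) x : entire_operator11 ip T -> E l x -> x != 0 ->
  exists rho e0 V V1 V2, frame_data rho e0 V V1 V2.
Proof.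
move=> hT Ex x0.
pose P (l0 : C) (d : R * H * ((C -> H) * (C -> H) * (C -> H))) :=
  0 < d.1.1 /\ forall z, nc (z - l0) < d.1.1 ->
   [/\ E z (d.2.1.1 z) /\ ip (d.2.1.1 z) d.1.2 = 1,
     forall x, E z x -> x = ip x d.1.2 *: d.2.1.1 z,
     vderiv d.2.1.1 z (d.2.1.2 z), vderiv d.2.1.2 z (d.2.2 z) & d.2.2 w @[w --> z] --> d.2.2 z].
have /choice[D hD] : forall l0, exists d, P l0 d.
  move=> l0; have [e Ee e1] := @fiber_nontrivial _ _ ip T hip hT _ l0 x Ex x0.
  have [r [v [v1 [v2 h]]]] := local_frame hip hT Ee e1.
  by exists (r, e, (v, v1, v2)).
by exists (fun l => (D l).1.1), (fun l => (D l).1.2), (fun l => (D l).2.1.1),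
  (fun l => (D l).2.1.2), (fun l => (D l).2.2).
Qed.

Variables (rho : C -> R) (e0 : C -> H) (V V1 V2 : C -> C -> H).
Hypothesis hV : frame_data rho e0 V V1 V2.

Let rad (z : C) : R := rho z^*%C.
(** A frame, near [z0], of the antiholomorphic bundle with fibres [E_(conj z)]; sections of [F] are
    read off through their values on it. *)
Let fv (z0 z : C) : H := V z0^*%C z^*%C.
Let dual0 (z0 : C) : H := e0 z0^*%C.
Let N (z0 z : C) : R := hn (fv z0 z).

Lemma rad_gt0 z : 0 < rad z. Proof. exact: (hV _).1. Qed.

Lemma fv_fiber z0 z : nc (z - z0) < rad z0 -> E z^*%C (fv z0 z).
Proof. by rewrite -ncJB => h; have [[]] := (hV z0^*%C).2 _ h. Qed.

Lemma fv_dual z0 z : nc (z - z0) < rad z0 -> ip (fv z0 z) (dual0 z0) = 1.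
Proof. by rewrite -ncJB => h; have [[]] := (hV z0^*%C).2 _ h. Qed.

Lemma fv_span z0 z x : nc (z - z0) < rad z0 -> E z^*%C x -> x = ip x (dual0 z0) *: fv z0 z.
Proof. by rewrite -ncJB => h; have [_ + _ _ _] := (hV z0^*%C).2 _ h; apply. Qed.

Lemma fv_neq0 z0 z : nc (z - z0) < rad z0 -> fv z0 z != 0.
Proof.
by move/fv_dual => h; apply: contra_eq_neq h => ->; rewrite ip0l eq_sym oner_eq0.
Qed.

Lemma fnorm_gt0 z0 z : nc (z - z0) < rad z0 -> 0 < N z0 z.
Proof. by move/fv_neq0; rewrite hn_gt0. Qed.

Lemma Ffiber_scale z f (a : R[i]) x : Ffiber ip T z f -> E z^*%C x -> f (a *: x) = a^*%C * f x.
Proof.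
move=> [fL _] Ex; have E0 : E z^*%C 0 by exact: Efiber0.
have f0 : f 0 = 0.
  have := fL 1 0 0 E0 E0; rewrite scaler0 addr0 rmorph1 mul1r => /eqP.
  by rewrite -subr_eq0 opprD addrA subrr sub0r oppr_eq0 => /eqP.
by have := fL a x 0 Ex E0; rewrite !addr0 f0 addr0.
Qed.

Lemma Ffiber_coef z0 z f x : nc (z - z0) < rad z0 -> Ffiber ip T z f -> E z^*%C x ->
  f x = (ip x (dual0 z0))^*%C * f (fv z0 z).
Proof.
move=> zr Ff Ex; rewrite {1}(fv_span zr Ex) (Ffiber_scale _ Ff)//.
exact: fv_fiber.
Qed.

Lemma nonvanishing_coef z0 z (s : C -> H -> C) : nc (z - z0) < rad z0 -> Ffiber ip T z (s z) ->
  nonvanishing_at s z <-> s z (fv z0 z) != 0.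
Proof.
move=> zr Fs; split=> [[x sx]|]; last by exists (fv z0 z).
have [Ex|nEx] := pselect (E z^*%C x); last by rewrite Fs.2// eqxx in sx.
by apply: contra_neq sx => s0; rewrite (Ffiber_coef zr Fs Ex) s0 mulr0.
Qed.

(** The fibre is the line spanned by [fv z0 z], so the supremum is attained at the normalised frame
    vector. *)
Lemma dual_normE z0 z f : nc (z - z0) < rad z0 -> Ffiber ip T z f ->
  dual_norm ip T z f = nc (f (fv z0 z)) / N z0 z.
Proof.
move=> zr Ff; have Np := fnorm_gt0 zr; rewrite /dual_norm.
set S := [set _ | _ in _]; set B := _ / _.
have ub : ubound S B.
  move=> _ [x [Ex x1] <-]; rewrite (Ffiber_coef zr Ff Ex) Normc.normcM ncJ.
  rewrite /B mulrC ler_wpM2l ?nc_ge0// -[leRHS]mul1r ler_pdivlMr// /N -hnZ.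
  by rewrite -(fv_span zr Ex) -lecR -hnE.
have NV : 0 < (N z0 z)^-1 by rewrite invr_gt0.
have SB : S B.
  exists (((N z0 z)^-1)%:C *: fv z0 z).
    split; first exact/EfiberZ/fv_fiber.
    by rewrite hnE lecR hnZ ncR (ger0_norm (ltW NV)) mulVf ?gt_eqF.
  rewrite (Ffiber_scale _ Ff); last exact: fv_fiber.
  by rewrite Normc.normcM ncJ ncR (ger0_norm (ltW NV)) mulrC.
apply/eqP; rewrite eq_le; apply/andP; split.
  by apply: ge_sup => //; exists B.
by apply: ub_le_sup => //; exists B.
Qed.

Lemma coef_hol W (s : C -> H -> C) z0 : Fholomorphic_section ip T W s -> W z0 ->
  exists e, [/\ 0 < e, e <= rad z0, hol_disk (fun z => s z (fv z0 z)) z0 e &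
    forall z, nc (z - z0) < e -> W z].
Proof.
move=> [oW Fs hs] Wz0.
have /nbhsC[e1 e10 h1] : nbhs z0 W by exact: open_nbhs_nbhs.
exists (Num.min e1 (rad z0)); split.
- by rewrite lt_min e10 rad_gt0.
- by rewrite ge_min lexx orbT.
- move=> z; rewrite lt_min => /andP[ze zr].
  pose U : set C := [set w | nc (w - z0^*%C) < rad z0].
  have loc : Elocal_section ip T U (V z0^*%C).
    split.
    - exact: open_nc_ball.
    - by move=> w Uw; have [[]] := (hV z0^*%C).2 _ Uw.
    - by move=> w Uw; have [_ _ /vderivP[]] := (hV z0^*%C).2 _ Uw.
  have wz : [set w : C | W w /\ U w^*%C] z by split; [exact: h1|rewrite /U /= ncJB].
  have D := hs U (V z0^*%C) loc z wz.
  by exists ('D_1 (fun z => s z (fv z0 z) : C) z); apply/cdiff_atP; exact: derivableP.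
- by move=> z; rewrite lt_min => /andP[/h1].
Qed.

(** The section of [F] with coefficient [g] in the frame dual to [fv z0]; it is 0 off the fibre
    because [Ffiber] represents functionals by their extension by 0. *)
Definition mk_section (z0 : C) (g : C -> C) (z : C) (x : H) : C :=
  if `[< E z^*%C x >] then (ip x (dual0 z0))^*%C * g z else 0.

Lemma mk_sectionE z0 g z x : E z^*%C x -> mk_section z0 g z x = (ip x (dual0 z0))^*%C * g z.
Proof. by move=> Ex; rewrite /mk_section asboolT. Qed.

Lemma mk_section_frame z0 g e : e <= rad z0 -> hol_disk g z0 e ->
  (forall z, nc (z - z0) < e -> g z != 0) ->
  Fframe ip T [set z | nc (z - z0) < e] (mk_section z0 g).
Proof.
move=> er hg g0.
have oB : open [set z : C | nc (z - z0) < e] by exact: open_nc_ball.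
split; first split => //.
- move=> z ze; split=> [a x y Ex Ey|x nEx].
    rewrite !mk_sectionE//; last exact: EfiberL.
    by rewrite ipDl ipZl rmorphD rmorphM mulrDl mulrA.
  by rewrite /mk_section asboolF.
- move=> U v [oU vE vh] z [ze Uz].
  have /nbhsC[d d0 hd] : nbhs (z^*%C : C) U by exact: open_nbhs_nbhs.
  have [m hm] := hg z ze.
  have vl : vderiv v z^*%C ('D_1 v z^*%C) by apply/vderivP; apply: derivableP; exact: vh.
  have h1 := cdiff_atM (cdiff_at_conj (vderiv_ip (dual0 z0) vl)) hm.
  suff : cdiff_at (fun w : C => mk_section z0 g w (v w^*%C)) z
     ((ip ('D_1 v z^*%C) (dual0 z0))^*%C * g z + (ip (v z^*%C) (dual0 z0))^*%C * m) by move/cdiff_atP => -[].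
  apply: cdiff_at_near (h1); exists d => // w wd.
  rewrite mk_sectionE//; apply: vE; apply: hd; by rewrite ncJB.
- move=> z ze; exists (fv z0 z); have zr : nc (z - z0) < rad z0 by exact: lt_le_trans er.
  by rewrite mk_sectionE ?fv_dual ?conjc1 ?mul1r ?g0//; exact: fv_fiber.
Qed.

End Coefficients.

(** * Zeros of sections *)

Section Order.
Context {R : realType} {H : completeNormedModType R[i]}.
Local Notation C := (plane R).
Local Notation nc := (@Normc.normc R).
Variables (ip : {dot H for Num.conj}) (T : operator H).
Hypothesis hip : forall x : H, `|x| ^+ 2 = ip x x.
Local Notation E := (Efiber ip T).
Variables (rho : C -> R) (e0 : C -> H) (V V1 V2 : C -> C -> H).
Hypothesis hV : frame_data ip T rho e0 V V1 V2.

Local Notation rad z := (rho z^*%C).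
Local Notation fv z0 z := (V z0^*%C z^*%C).

Lemma cvg_dist (f : C -> C) (z : C) (e : R) : {for z, continuous f} -> 0 < e ->
  exists2 d, 0 < d & forall w, nc (w - z) < d -> nc (f z - f w) < e.
Proof. by move=> /(@cvgC R _ (nbhs z)) h /h /nbhsC. Qed.

(** For [n < m], cancelling powers gives [g = (z - z0) ^ (m - n) * f] off [z0], and continuity would
    force [g z0 = 0]. *)
Lemma order_le (f g : C -> C) (z0 : C) (n m : nat) (e : R) : 0 < e ->
  {for z0, continuous f} -> {for z0, continuous g} -> g z0 != 0 ->
  (forall z, nc (z - z0) < e -> (z - z0) ^+ n * g z = (z - z0) ^+ m * f z) -> (m <= n)%N.
Proof.
move=> ep cf cg g0 h; rewrite leqNgt; apply/negP => nm.
pose k (z : C) : C := (z - z0) ^+ (m - n) * f z.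
have ck : {for z0, continuous k}.
  have c1 : (w - z0 : C) @[w --> z0] --> (z0 - z0 : C).
    apply/(@cvgC R _ (nbhs z0)) => d d0; apply/nbhsC; exists d => // w wd.
    by rewrite (_ : z0 - z0 - (w - z0) = - (w - z0)) ?ncN//; ring.
  have c2 : (w - z0) ^+ (m - n) @[w --> z0] --> (z0 - z0) ^+ (m - n).
    elim: (m - n)%N => [|j IH]; first exact: (@cvg_cst C (1 : C) C (nbhs z0) (nbhs_filter z0)).
    under eq_fun do rewrite exprS; rewrite exprS; exact: (cvgM c1 IH).
  exact: (cvgM c2 cf).
have k0 : k z0 = 0 by rewrite /k subrr expr0n subn_eq0 leqNgt nm mul0r.
have e2 : 0 < nc (g z0) / 2 by rewrite divr_gt0 ?nc_gt0.
have [d1 d10 h1] := cvg_dist cg e2; have [d2 d20 h2] := cvg_dist ck e2.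
pose d := Num.min e (Num.min d1 d2); have d0 : 0 < d by rewrite !lt_min ep d10.
(* A test point other than [z0], near enough that [g] and [k] have each moved by less than
   [nc (g z0) / 2]. *)
pose z : C := z0 + (d / 2)%:C.
have zz : z - z0 = (d / 2)%:C by rewrite /z addrAC subrr add0r.
have nz : nc (z - z0) = d / 2 by rewrite zz ncR ger0_norm// divr_ge0// ltW.
have : nc (z - z0) < d by rewrite nz ltr_pdivrMr// ltr_pMr// ltr1n.
rewrite !lt_min => /and3P[ze zd1 zd2].
have z0N : z - z0 != 0 by rewrite -nc_gt0 nz divr_gt0.
have gk : g z = k z.
  have := h z ze; rewrite -(subnKC (ltnW nm)) exprD -mulrA => /mulfI; apply.
  by rewrite expf_neq0.
have := h1 z zd1; have := h2 z zd2; rewrite k0 sub0r ncN -gk => l2 l1.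
have := ncD (g z0 - g z) (g z); rewrite subrK; lra.
Qed.

Lemma order_unique (f g : C -> C) (z0 : C) (n m : nat) (e : R) : 0 < e ->
  {for z0, continuous f} -> {for z0, continuous g} -> f z0 != 0 -> g z0 != 0 ->
  (forall z, nc (z - z0) < e -> (z - z0) ^+ n * g z = (z - z0) ^+ m * f z) -> m = n.
Proof.
move=> ep cf cg f0 g0 h; apply/eqP; rewrite eqn_leq (order_le ep cf cg g0 h).
by apply: (order_le ep cg cf f0) => z /h.
Qed.

Lemma hol_disk_neq0 (g : C -> C) (z0 : C) (e : R) : 0 < e -> hol_disk g z0 e -> g z0 != 0 ->
  exists d, [/\ 0 < d, d <= e & forall z, nc (z - z0) < d -> g z != 0].
Proof.
move=> ep hg g0; have [l /cdiff_at_cont cg] := hg z0 (ltac:(by rewrite subrr Normc.normc0)).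
have gp : 0 < nc (g z0) by rewrite nc_gt0.
have [d d0 hd] := cvg_dist cg gp; exists (Num.min d e); split.
- by rewrite lt_min d0.
- by rewrite ge_min lexx orbT.
- move=> z; rewrite lt_min => /andP[/hd + _]; apply: contraTneq => ->.
  by rewrite subr0 ltxx.
Qed.

(* Near [z0], [h] is the logarithm of the squared norm of a holomorphic frame. *)
Definition adapted (h : C -> R) (z0 : C) := exists e F, [/\ 0 < e, hol_disk F z0 e, F z0 != 0 &
  forall w, nc (w - z0) < e -> h w = ln (nc (F w) ^+ 2) - ln (hn (fv z0 w) ^+ 2)].

(** [ln |F|^2] contributes equally to [dzxx] and [dzyy], so [L] depends on the frame [fv z0] alone.
    This makes the curvature at [z0] computable from any adapted function, whatever frame
    [curvature] has chosen. *)
Lemma adapted_smooth (z0 : C) : exists L : R, forall h, adapted h z0 ->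
  smooth2_at h (dz h) (dzxx h) (dzyy h) z0 /\ dzxx h z0 - dzyy h z0 = L.
Proof.
have [p [pxx [pyy hp]]] := smooth2_ln_norm hip (V z0^*%C) (V1 z0^*%C) (V2 z0^*%C).
exists (pyy z0 - pxx z0) => h [e [F [ep hF F0 hE]]].
have [e' [q [qxx [ep' hq]]]] := smooth2_ln ep hF F0.
have r0 := rad_gt0 hV z0.
pose d := Num.min (rad z0) (Num.min e e').
have d0 : 0 < d by rewrite !lt_min r0 ep.
have sm w : nc (w - z0) < d -> smooth2_at
    (fun w => ln (nc (F w) ^+ 2) - ln (hn (fv z0 w) ^+ 2)) (fun w => q w - p w)
    (fun w => qxx w - pxx w) (fun w => qxx w - pyy w) w.
  rewrite !lt_min => /and3P[wr we we']; apply: smooth2_atB; first exact: hq.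
  have [_ _ d1 d2 c2] := (hV z0^*%C).2 w^*%C (ltac:(by rewrite ncJB)).
  by apply: hp => //; exact: (fv_neq0 hV wr).
have hh w : nc (w - z0) < d -> h w = ln (nc (F w) ^+ 2) - ln (hn (fv z0 w) ^+ 2).
  by rewrite !lt_min => /and3P[wr we we']; exact: hE.
have [s1 s2 s3] := smooth2_near d0 hh sm.
by split => //; rewrite s2 s3; ring.
Qed.

Lemma ln_sqr_div (a b : R) : 0 < a -> 0 < b -> ln ((a / b) ^+ 2) = ln (a ^+ 2) - ln (b ^+ 2).
Proof. by move=> a0 b0; rewrite expr_div_n ln_div ?posrE ?exprn_gt0. Qed.

Lemma frame_adapted W (s : C -> H -> C) z0 : Fframe ip T W s -> W z0 ->
  adapted (fun w => ln (dual_norm ip T w (s w) ^+ 2)) z0.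
Proof.
move=> [hs nv] Wz0; have [e [ep er hf hW]] := coef_hol hV hs Wz0.
have Fs z : nc (z - z0) < e -> Ffiber ip T z (s z) by move=> /hW; have [_ + _] := hs; apply.
have f0 z : nc (z - z0) < e -> s z (fv z0 z) != 0.
  move=> ze; have zr := lt_le_trans ze er.
  by apply/(nonvanishing_coef hV zr (Fs z ze)); apply: nv; exact: hW.
exists e, (fun z => s z (fv z0 z)); split => //.
  by apply: f0; rewrite subrr Normc.normc0.
move=> w we; have wr := lt_le_trans we er.
rewrite (dual_normE hV wr (Fs w we)) ln_sqr_div ?nc_gt0 ?f0//.
exact: (fnorm_gt0 hV wr).
Qed.

Lemma frame_exists z0 : exists s, Fframe_near ip T z0 s.
Proof.
exists (mk_section ip T e0 z0 (fun=> 1)); exists [set z | nc (z - z0) < rad z0].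
  by rewrite /= subrr Normc.normc0; exact: (rad_gt0 hV).
apply: (mk_section_frame hip hV (lexx _)) => z _; last exact: oner_neq0.
by exists 0; exact: cdiff_at_cst.
Qed.

(** [i / (2 pi) * 2 i = - 1 / pi], and the real part of the curvature is half of [dzxx - dzyy]. The
    result is written with [2 * (dzxx - dzyy)], the Laplacian in [smooth2_jensen]. *)
Lemma c1_densityE h z0 : adapted h z0 ->
  c1_density ip T z0 = - (4 * pi)^-1 * (2 * (dzxx h z0 - dzyy h z0)).
Proof.
move=> ah; have [L hL] := adapted_smooth z0; have [_ ->] := hL _ ah.
rewrite /c1_density /curvature; set s := xget _ _.
have [W Wz Fs] : Fframe_near ip T z0 s.
  exact: (@xgetPex _ (fun _ _ => 0) _ (frame_exists z0)).
have [_ {}hL] := hL _ (frame_adapted Fs Wz).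
have := wirtinger_bar_dz (fun w => ln (dual_norm ip T w (s w) ^+ 2)) z0.
rewrite hL /dz; have p0 : pi != 0 :> R by rewrite gt_eqF// pi_gt0.
move: (@pi R) p0 => q q0; case: (wirtinger_bar _ z0) => a b /= ->.
by rewrite (expr0n R 2) /= addr0; field.
Qed.

Variable s : C -> H -> C.
Hypothesis hs : Fholomorphic_section ip T setT s.
Hypothesis hs0 : exists z, nonvanishing_at s z.

Let Fs z : Ffiber ip T z (s z). Proof. by have [_ + _] := hs; apply. Qed.

Definition factor_at (z0 : C) (n : nat) (g : C -> C) (e : R) := [/\ 0 < e, e <= rad z0, hol_disk g z0 e,
  forall z, nc (z - z0) < e -> g z != 0 &
  forall z, nc (z - z0) < e -> s z (fv z0 z) = (z - z0) ^+ n * g z].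

Lemma factor_or_zero z0 : (exists2 e, 0 < e & forall z, nc (z - z0) < e -> ~ nonvanishing_at s z) \/
  exists n g e, factor_at z0 n g e.
Proof.
have [e [ep er hf _]] := coef_hol hV hs (I : setT z0).
have e2 : 0 < e / 2 by rewrite divr_gt0.
have e2e : e / 2 < e by rewrite ltr_pdivrMr// ltr_pMr// ltr1n.
have [h|[n [g [hg g0 fg]]]] := hol_disk_order e2 e2e hf.
  left; exists (e / 2) => // z ze; have zr := lt_le_trans (lt_trans ze e2e) er.
  by move/(nonvanishing_coef hV zr (Fs z)); rewrite h// eqxx.
right; have [d [d0 de hd]] := hol_disk_neq0 e2 hg g0.
exists n, g, d; split => //.
- by rewrite (le_trans de)// (le_trans (ltW e2e)).
- by move=> z zd; apply: hg; exact: lt_le_trans de.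
- by move=> z zd; apply: fg; exact: lt_le_trans de.
Qed.

Lemma factor_nonvanishing z0 n g e z : factor_at z0 n g e -> nc (z - z0) < e -> z != z0 ->
  nonvanishing_at s z.
Proof.
move=> [ep er hg g0 fg] ze zz; have zr := lt_le_trans ze er.
apply/(nonvanishing_coef hV zr (Fs z)); rewrite fg// mulf_neq0 ?g0//.
by rewrite expf_neq0// subr_eq0.
Qed.

(** The identity theorem. Near a point of finite order [s] has no zero except possibly that point,
    and a point without finite order has a neighbourhood on which [s] vanishes; so both sets are
    open, and [hs0] excludes the second kind. *)
Lemma factor_exists z0 : exists n g e, factor_at z0 n g e.
Proof.
have [l0 nl0] := hs0.
pose P := [set z : C | exists n g e, factor_at z n g e].
have iP z e : 0 < e -> (forall w, nc (w - z) < e -> ~ nonvanishing_at s w) -> ~ P z.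
  move=> ep h [n [g [d hd]]]; have [d0 _ _ _ _] := hd.
  pose m := Num.min e d; have m0 : 0 < m by rewrite lt_min ep.
  have wz : nc (z + (m / 2)%:C - z) = m / 2.
    by rewrite addrAC subrr add0r ncR ger0_norm// divr_ge0// ltW.
  have : nc (z + (m / 2)%:C - z) < m by rewrite wz ltr_pdivrMr// ltr_pMr// ltr1n.
  rewrite lt_min => /andP[we wd]; apply: (h _ we).
  by apply: (factor_nonvanishing hd wd); rewrite -subr_eq0 -nc_gt0 wz divr_gt0.
have nP z : ~ P z -> exists2 e, 0 < e & forall w, nc (w - z) < e -> ~ nonvanishing_at s w.
  by move=> Pz; have [//|] := factor_or_zero z.
have nearw z w (d : R) : nc (w - z) < d -> exists2 e, 0 < e & forall x, nc (x - w) < e -> nc (x - z) < d.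
  move=> wz; exists (d - nc (w - z)); first by rewrite subr_gt0.
  move=> x xw; rewrite (_ : x - z = (x - w) + (w - z)); last by ring.
  by rewrite (le_lt_trans (ncD _ _))// -ltrBrDr.
have oP : open P.
  rewrite openE => z [n [g [d hd]]]; have [d0 _ _ _ _] := hd.
  apply/nbhsC; exists d => // w wz; apply: contrapT => /nP[e ep he].
  have [wz0|wz0] := eqVneq w z.
    by subst w; apply: (iP z e ep he); exists n, g, d.
  by apply: (he w); [rewrite subrr Normc.normc0|exact: (factor_nonvanishing hd wz)].
have cP : open (~` P).
  rewrite openE => z /nP[e ep he]; apply/nbhsC; exists e => // w wz.
  have [d d0 hd] := nearw _ _ _ wz.
  by apply: (iP w d d0) => x /hd /he.
suff : P z0 by [].
suff : P l0 by exact: (@plane_connected R P l0 z0 oP cP).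
apply: contrapT => /nP[e ep he]; apply: (he l0) => //.
by rewrite subrr Normc.normc0.
Qed.

(** [multiplicity] selects some vanishing order; [order_unique] shows that it can only be [n]. *)
Lemma factor_multiplicity z0 n g e : factor_at z0 n g e -> multiplicity ip T s z0 = n.
Proof.
move=> [ep er hg g0 fg].
have zz (r : R) : 0 < r -> nc (z0 - z0) < r by rewrite subrr Normc.normc0.
have ex : vanishing_order ip T s z0 n.
  exists [set z | nc (z - z0) < e], (mk_section ip T e0 z0 g); split; first exact: zz.
    exact: (mk_section_frame hip hV).
  move=> z x ze; have zr := lt_le_trans ze er.
  have [Ex|nEx] := pselect (E z^*%C x).
    by rewrite mk_sectionE// (Ffiber_coef hV zr (Fs z) Ex) fg// mulrCA.
  by rewrite (Fs z).2// /mk_section asboolF ?mulr0.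
have : vanishing_order ip T s z0 (multiplicity ip T s z0).
  by apply: (@xgetPex _ 0%N); exists n.
move: (multiplicity _ _ _ _) => m [W [sg [Wz [hsg nv] sE]]].
have [d [dp dr hf hW]] := coef_hol hV hsg Wz.
have [l /cdiff_at_cont cf] := hf z0 (zz d dp).
have [l' /cdiff_at_cont cg] := hg z0 (zz e ep).
have Fsg : Ffiber ip T z0 (sg z0) by have [_ + _] := hsg; apply.
have mp : 0 < Num.min e d by rewrite lt_min ep.
apply: (order_unique mp cf cg) => //.
- by apply/(nonvanishing_coef hV (zz _ (rad_gt0 hV z0)) Fsg); exact: nv.
- exact: g0 (zz _ ep).
- move=> z; rewrite lt_min => /andP[ze zd].
  by rewrite -fg// sE//; exact: hW.
Qed.

Lemma order_data : exists (G : C -> C -> C) (eps : C -> R),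
  forall z0, factor_at z0 (multiplicity ip T s z0) (G z0) (eps z0).
Proof.
have /choice[D hD] : forall z0, exists d : (C -> C) * R, factor_at z0 (multiplicity ip T s z0) d.1 d.2.
  move=> z0; have [n [g [e h]]] := factor_exists z0; exists (g, e).
  by rewrite (factor_multiplicity h).
by exists (fun z => (D z).1), (fun z => (D z).2).
Qed.

End Order.

(** * The three growth functions *)

Section Potential.
Context {R : realType} {H : completeNormedModType R[i]}.
Local Notation C := (plane R).
Local Notation nc := (@Normc.normc R).
Local Notation Re := (@complex.Re R).
Local Notation Im := (@complex.Im R).

(** Finitely many disks that contain no point of [Z] except possibly their centre cover a square
    around the disk of radius [r], so the points of [Z] in it are among the centres. *)
Lemma isolated_finite (Z : set C) (r : R) :
  (forall z0, exists2 e, 0 < e & forall z, nc (z - z0) < e -> z != z0 -> ~ Z z) ->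
  finite_set [set z | nc z <= r /\ Z z].
Proof.
move=> iso; have /choice[e he] : forall z0, exists e, 0 < e /\
    forall z, nc (z - z0) < e -> z != z0 -> ~ Z z.
  by move=> z0; have [e ep hz] := iso z0; exists e.
pose K : set C := [set q.1 +i* q.2 | q in `[- r, r]%classic `*` `[- r, r]%classic].
have cK : compact K.
  apply: continuous_compact; last by apply: compact_setX; exact: segment_compact.
  by apply: continuous_subspaceT => q; exact: continuous_pair.
move: cK; rewrite compact_cover => /(_ C setT (fun z0 => [set z | nc (z - z0) < e z0])).
case.
- by move=> z0 _; exact: open_nc_ball.
- by move=> z _; exists z => //=; rewrite subrr Normc.normc0; exact: (he z).1.
move=> D _ cov; apply: sub_finite_set (finite_fset D) => z [zr Zz].
have [|w /= wD zw] := cov z.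
  exists (Re z, Im z); last by case: (z).
  have := nc_Re z; have := nc_Im z => h1 h2.
  by split; rewrite /= in_itv /= -ler_norml (le_trans _ zr).
have [->//|zw'] := eqVneq z w.
by have := (he w).2 z zw zw'.
Qed.

Lemma hol_disk_prod (A : seq C) (m : C -> nat) (g : C -> C) (z0 : C) (e : R) :
  hol_disk g z0 e -> (forall a, a \in A -> forall w, nc (w - z0) < e -> w != a) ->
  hol_disk (fun w => g w * \prod_(a <- A) ((w - a) ^+ m a)^-1) z0 e.
Proof.
move=> hg; elim: A => [|a A IH] hA w we.
  have [l hl] := hg w we; exists l; congr cdiff_at: hl.
  by apply/funext => x; rewrite big_nil mulr1.
have [l hl] := IH (fun b bA => hA b (mem_behead (s := a :: A) bA)) w we.
have wa : w - a != 0 by rewrite subr_eq0; apply: hA => //; exact: mem_head.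
have [k hk] : exists k, cdiff_at (fun w : C => (w - a) ^+ m a) w k.
  elim: (m a) => [|n [k hk]]; first by exists 0; exact: cdiff_at_cst.
  have h1 : cdiff_at (fun w : C => w - a) w 1.
    have := cdiff_at_affine 1 (- a) w; congr cdiff_at.
    by apply/funext => x; rewrite mul1r.
  eexists; have := cdiff_atM h1 hk; congr cdiff_at.
  by apply/funext => x; rewrite exprS.
have wn : (w - a) ^+ m a != 0 by rewrite expf_neq0.
have := cdiff_atM hl (@cdiff_atV R (fun w => (w - a) ^+ m a) w k wn hk).
set l' := (X in cdiff_at _ _ X) => hh; exists l'; congr cdiff_at: hh.
by apply/funext => x; rewrite big_cons mulrAC mulrA.
Qed.

Lemma ln_prod (A : seq C) (m : C -> nat) (x w : C) : x != 0 ->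
  (forall a, a \in A -> w != a) ->
  x * \prod_(a <- A) ((w - a) ^+ m a)^-1 != 0 /\
  ln (nc (x * \prod_(a <- A) ((w - a) ^+ m a)^-1) ^+ 2) =
  ln (nc x ^+ 2) - \sum_(a <- A) (m a)%:R * ln (nc (w - a) ^+ 2).
Proof.
move=> x0; elim: A => [|a A IH] hA.
  by rewrite !big_nil mulr1 subr0.
have [IH0 IH1] := IH (fun b bA => hA b (mem_behead (s := a :: A) bA)).
have wa : w - a != 0 by rewrite subr_eq0; apply: hA; exact: mem_head.
rewrite !big_cons mulrCA; split.
  by rewrite mulf_neq0// invr_eq0 expf_neq0.
have np : 0 < nc (w - a) by rewrite nc_gt0.
rewrite Normc.normcM Normc.normcV ncX exprMn exprVn lnM ?posrE ?invr_gt0 ?exprn_gt0 ?nc_gt0//.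
rewrite IH1 lnV ?posrE ?exprn_gt0// -exprM mulnC exprM lnXn ?exprn_gt0// -mulr_natl.
ring.
Qed.

Lemma smooth2_atZ (k : R) h p a b z : smooth2_at h p a b z ->
  smooth2_at (fun w => k * h w) (fun w => k%:C * p w) (fun w => k * a w) (fun w => k * b w) z.
Proof.
move=> [d1 x1 y1 [c1 q1] [u1 v1]].
have eZ (f : R -> R) l : is_derive (0 : R) 1 f l -> is_derive (0 : R) 1 (fun t => k * f t) (k * l).
  by move=> fl; exact: (is_deriveZ k fl).
have cZ (f : C -> R) : {for z, continuous f} -> {for z, continuous (fun w => k * f w)}.
  by move=> cf; exact: (cvgM (@cvg_cst R k C (nbhs z) (nbhs_filter z)) cf).
split.
- move=> d; have := eZ _ _ (d1 d); congr is_derive.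
  by case: (d) (p z) => s t [u v] /=; ring.
- have := eZ _ _ x1; congr is_derive; apply/funext => t.
  by case: (p _) => s u /=; ring.
- have := eZ _ _ y1; congr is_derive; apply/funext => t.
  by case: (p _) => s u /=; ring.
- split; first exact: cZ.
  exact: (cvgM (@cvg_cst C (k%:C : C) C (nbhs z) (nbhs_filter z)) q1).
- by split; exact: cZ.
Qed.

Variables (ip : {dot H for Num.conj}) (T : operator H).
Hypothesis hip : forall x : H, `|x| ^+ 2 = ip x x.
Variables (rho : C -> R) (e0 : C -> H) (V V1 V2 : C -> C -> H).
Hypothesis hV : frame_data ip T rho e0 V V1 V2.
Variable s : C -> H -> C.
Hypothesis hs : Fholomorphic_section ip T setT s.
Local Notation m := (multiplicity ip T s).
Variables (G : C -> C -> C) (eps : C -> R).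
Hypothesis hG : forall z0, factor_at rho V s z0 (m z0) (G z0) (eps z0).

Local Notation fv z0 z := (V z0^*%C z^*%C).

Let Fs z : Ffiber ip T z (s z). Proof. by have [_ + _] := hs; apply. Qed.
Let zz (z : C) (r : R) : 0 < r -> nc (z - z) < r.
Proof. by rewrite subrr Normc.normc0. Qed.

Lemma eps_gt0 z : 0 < eps z. Proof. by have [] := hG z. Qed.

Lemma G_neq0 z0 z : nc (z - z0) < eps z0 -> G z0 z != 0.
Proof. by have [_ _ _ + _] := hG z0; apply. Qed.

Lemma mult_eq0 z : m z = 0%N <-> nonvanishing_at s z.
Proof.
have [ep er _ _ sE] := hG z; have zr := lt_le_trans (zz z ep) er.
have e := sE z (zz z ep).
split=> [mz|/(nonvanishing_coef hV zr (Fs z))].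
  apply/(nonvanishing_coef hV zr (Fs z)).
  by rewrite e mz mul1r G_neq0// zz.
by rewrite e subrr expr0n; case: (m z) => [//|n]; rewrite mul0r eqxx.
Qed.

Lemma mult_isolated z0 z : nc (z - z0) < eps z0 -> z != z0 -> m z = 0%N.
Proof. by move=> ze zn; apply/mult_eq0; exact: (factor_nonvanishing hV hs (hG z0)). Qed.

(* [ln |s / (w - z) ^+ m z| ^ 2] at [w = z]. *)
Definition logpart (z : C) : R := ln (nc (G z z) ^+ 2) - ln (hn (fv z z) ^+ 2).

Lemma dual_norm_gt0 z : m z = 0%N -> 0 < dual_norm ip T z (s z).
Proof.
move=> mz; have [ep er _ _ sE] := hG z; have zr := lt_le_trans (zz z ep) er.
rewrite (dual_normE hV zr (Fs z)) divr_gt0 ?(fnorm_gt0 hV)// nc_gt0.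
by apply/(nonvanishing_coef hV zr (Fs z))/mult_eq0.
Qed.

Lemma logpart_dual_norm z : m z = 0%N -> logpart z = ln (dual_norm ip T z (s z) ^+ 2).
Proof.
move=> mz; have [ep er _ _ sE] := hG z; have zr := lt_le_trans (zz z ep) er.
rewrite (dual_normE hV zr (Fs z)) sE ?zz// mz mul1r ln_sqr_div ?nc_gt0 ?G_neq0 ?zz//.
exact: (fnorm_gt0 hV zr).
Qed.

Lemma logpart_near z0 z : nc (z - z0) < eps z0 -> z != z0 ->
  logpart z = (m z0)%:R * ln (nc (z - z0) ^+ 2) + ln (nc (G z0 z) ^+ 2) - ln (hn (fv z0 z) ^+ 2).
Proof.
move=> ze zn; have [ep er _ g0 sE] := hG z0; have zr := lt_le_trans ze er.
rewrite logpart_dual_norm; last exact: mult_isolated zn.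
have d0 : 0 < nc (z - z0) by rewrite nc_gt0 subr_eq0.
rewrite (dual_normE hV zr (Fs z)) sE// ln_sqr_div; last exact: (fnorm_gt0 hV zr).
  congr (_ - _); rewrite Normc.normcM ncX exprMn lnM ?posrE ?exprn_gt0 ?nc_gt0 ?g0 ?subr_eq0//.
  by rewrite -exprM mulnC exprM lnXn ?exprn_gt0// mulr_natl.
by rewrite nc_gt0 mulf_neq0 ?g0// expf_neq0// subr_eq0.
Qed.

Section Reduced.
Variables (A : seq C).
Hypothesis uA : uniq A.

(* [ln |sigma| ^ 2] for the section [sigma] obtained from [s] by dividing out its
   zeros in [A]. *)
Definition reduced_log (w : C) : R :=
  logpart w - \sum_(a <- A | a != w) (m a)%:R * ln (nc (w - a) ^+ 2).

Let W : set C := [set z | m z = 0%N \/ z \in A].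

Lemma reduced_domain_open : open W.
Proof.
rewrite openE => z Wz; apply/nbhsC; exists (eps z); first exact: eps_gt0.
move=> w we; have [->//|wz] := eqVneq w z.
by left; exact: mult_isolated wz.
Qed.

Lemma separation (z0 : C) : exists2 e, 0 < e & forall a, a \in A -> nc (a - z0) < e -> a = z0.
Proof.
elim: A => [|b B [e ep he]]; first by exists 1.
have [->|bz] := eqVneq b z0.
  exists e => // a; rewrite inE => /predU1P[//|]; exact: he.
exists (Num.min e (nc (b - z0))); first by rewrite lt_min ep nc_gt0 subr_eq0.
move=> a; rewrite inE lt_min => /predU1P[->|aB] /andP[ae ab]; last exact: he.
by rewrite ltxx in ab.
Qed.

(** The holomorphic factor is [G z0] divided by the powers belonging to the other points of [A]. For
    [w != z0] the term of [z0] in the sum cancels the zero of [s]; at [w = z0] that term is left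
    out, and [logpart] has removed the zero already. *)
Lemma reduced_adapted z0 : W z0 -> adapted V reduced_log z0.
Proof.
move=> Wz0; have [ep er hg g0 sE] := hG z0.
have [d d0 hd] := separation z0.
pose e := Num.min (eps z0) d; have e_gt0 : 0 < e by rewrite lt_min ep.
pose B := [seq a <- A | a != z0].
have hB a : a \in B -> forall w, nc (w - z0) < e -> w != a.
  rewrite mem_filter => /andP[az aA] w; rewrite lt_min => /andP[_ wd].
  by apply: contra az => /eqP wa; apply/eqP; apply: hd => //; rewrite -wa.
exists e, (fun w => G z0 w * \prod_(a <- B) ((w - a) ^+ m a)^-1); split => //.
- apply: hol_disk_prod => // w; rewrite lt_min => /andP[we _]; exact: hg.
- by have [] := @ln_prod B m (G z0 z0) z0 (g0 z0 (zz z0 ep)) (fun a aB => hB a aB z0 (zz z0 e_gt0)).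
move=> w we; have := we; rewrite lt_min => /andP[wep wd].
have [_ ->] := @ln_prod B m (G z0 w) w (g0 w wep) (fun a aB => hB a aB w we).
rewrite /reduced_log /B big_filter.
have [->|wz] := eqVneq w z0.
  by rewrite /logpart; ring.
have wA : w \notin A.
  by apply/negP => wA; case/eqP: wz; exact: hd.
have -> : \sum_(a <- A | a != w) (m a)%:R * ln (nc (w - a) ^+ 2) =
    \sum_(a <- A) (m a)%:R * ln (nc (w - a) ^+ 2).
  rewrite big_seq_cond [RHS]big_seq_cond; apply: eq_bigl => a.
  rewrite andbT; apply: andb_idr => aA.
  by apply: contra wA => /eqP <-.
rewrite (logpart_near wep wz).
have -> : \sum_(a <- A) (m a)%:R * ln (nc (w - a) ^+ 2) = (m z0)%:R * ln (nc (w - z0) ^+ 2) +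
    \sum_(a <- A | a != z0) (m a)%:R * ln (nc (w - a) ^+ 2).
  (* A point of the domain outside [A] has multiplicity 0, so its term may be added. *)
  have [zA|zA] := boolP (z0 \in A); first by rewrite (bigD1_seq z0).
  have -> : m z0 = 0%N by case: Wz0 => // zA'; rewrite zA' in zA.
  rewrite mul0r add0r big_seq [RHS]big_seq_cond; apply: eq_bigl => a.
  apply/esym/andb_idr => aA; by apply: contra zA => /eqP <-.
ring.
Qed.

(** This is [smooth2_jensen] for [k h], where [k] is the factor in [c1_densityE]; the value at the
    centre comes with [- 2 pi k = 1 / 2]. *)
Lemma characteristic_functionE r : 0 < r -> (forall z, nc z <= r -> W z) ->
  characteristic_function ip T r =
  - (4 * pi)^-1 * RI 0 (2 * pi) (fun t => reduced_log (r%:C * cis t)) + reduced_log 0 / 2.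
Proof.
move=> r0 rW; pose k : R := - (4 * pi)^-1; pose h := reduced_log.
have sm z : W z -> smooth2_at h (dz h) (dzxx h) (dzyy h) z.
  by move=> Wz; have [L hL] := adapted_smooth hip hV z; have [] := hL h (reduced_adapted Wz).
have J := smooth2_jensen r0 reduced_domain_open rW (fun z Wz => smooth2_atZ k (sm z Wz)).
have ch : continuous (fun t => h (r%:C * cis t)).
  move=> t; apply: (@continuous_comp _ _ _ (fun t => r%:C * cis t : C) h).
    by apply: (continuousMC (@continuous_cstC R r%:C) (@cis_continuous R)).
  have [|_ _ _ [] //] := sm (r%:C * cis t); apply: rW.
  by rewrite Normc.normcM ncR nc_cis mulr1 gtr0_norm.
rewrite (RI_scale _ _ _ ch) in J.
have p0 : pi != 0 :> R by rewrite gt_eqF// pi_gt0.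
have -> : reduced_log 0 / 2 = - (2 * pi * (k * h 0)).
  by rewrite /k /h; move: (@pi R) (reduced_log 0) p0 => q x q0; field.
rewrite -/k -/h.
rewrite -J /characteristic_function; apply: eq_Rintegral => t.
rewrite inE /= in_itv /= => /andP[t0 tr]; congr (_ / _).
rewrite /c1_disk; apply: eq_Rintegral => q; rewrite inE /disk /= => qt.
have Wq : W (q.1 +i* q.2) by apply: rW; exact: ltW (lt_le_trans qt tr).
by rewrite (c1_densityE hip hV (reduced_adapted Wq)) -/k -/h; ring.
Qed.

End Reduced.
End Potential.

(** * Termwise integration over the zeros *)

Section Integrals.
Context {R : realType}.
Local Notation C := (plane R).
Local Notation mu := (@lebesgue_measure R).
Local Notation mR := (measurableTypeR R).

Lemma sum_integrable (I : eqType) (A : seq I) (D : set mR) (c : I -> R) (f : I -> R -> R) (v : I -> R) :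
  measurable D ->
  (forall a, a \in A -> mu.-integrable D (EFin \o f a) /\ \int[mu]_(t in D) f a t = v a) ->
  mu.-integrable D (EFin \o (fun t => \sum_(a <- A) c a * f a t)) /\
  \int[mu]_(t in D) (\sum_(a <- A) c a * f a t) = \sum_(a <- A) c a * v a.
Proof.
move=> mD; elim: A => [|a A IH] h.
  split.
    rewrite (_ : _ \o _ = cst 0%E); first exact: integrable0.
    by apply/funext => t /=; rewrite big_nil.
  rewrite big_nil (@eq_Rintegral _ _ _ _ _ (cst 0)).
    by rewrite /Rintegral integral0.
  by move=> t _; rewrite big_nil.
have [i1 e1] := h a (mem_head a A).
have [i2 e2] := IH (fun b bA => h b (mem_behead (s := a :: A) bA)).
have i1' : mu.-integrable D (EFin \o (fun t => c a * f a t)).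
  have := integrableZl mD (c a) i1; congr (mu.-integrable D).
split.
  have := integrableD mD i1' i2; congr (mu.-integrable D).
  by apply/funext => t /=; rewrite big_cons EFinD.
rewrite big_cons -e1 -e2 -RintegralZl// -RintegralD//.
by apply: eq_Rintegral => t _; rewrite big_cons.
Qed.

(** A zero at distance [b] is counted in the disks of radius [t > b], and so contributes the
    integral of [1 / t] over []b, r]]. *)
Lemma counting_kernel (b r : R) : 0 < b -> b <= r ->
  mu.-integrable `]0, r] (EFin \o (fun t : R => (b < t)%R%:R / t)) /\
  \int[mu]_(t in `]0, r]) ((b < t)%R%:R / t) = ln r - ln b.
Proof.
(* [f] equals [1 / t] on []b, r]] and is continuous on the whole line, as the later substitution
   [t = exp u] requires. *)
move=> b0 br; pose f (t : R) : R := (Num.max t b)^-1.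
have cf : continuous f.
  move=> t; apply: cvgV.
    by rewrite gt_eqF// lt_max b0 orbT.
  have c1 : (Num.max x b) @[x --> t] --> Num.max t b.
    under eq_fun do rewrite maxr_absE; rewrite maxr_absE.
    have i1 : x @[x --> t] --> t by exact: cvg_id.
    have i2 : b @[_ --> t] --> b by exact: cvg_cst.
    have i3 : (2^-1 : R) @[_ --> t] --> (2^-1 : R) by exact: cvg_cst.
    exact: (cvgM (cvgD (cvgD i1 i2) (cvg_norm (cvgB i1 i2))) i3).
  exact: c1.
have fE t : t \in `]b, r] -> f t = t^-1.
  by rewrite in_itv /= => /andP[bt _]; rewrite /f max_l// ltW.
have r0 : 0 < r by exact: lt_le_trans br.
have pE : ((fun t : R => (b < t)%R%:R / t) \_ `]0, r]) = (f \_ `]b, r]).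
  apply/funext => t; rewrite !patchE !mem_setE.
  have [tb|tb] := boolP (t \in `]b, r]).
    have := tb; rewrite in_itv /= => /andP[bt tr].
    by rewrite in_itv /= (lt_trans b0 bt) tr bt mul1r fE.
  case: ifP => //; rewrite in_itv /= => /andP[t0 tr].
  by move: tb; rewrite in_itv /= tr andbT => /negbTE ->; rewrite mul0r.
have If : mu.-integrable `[b, r] (EFin \o f) by exact: RI_integrable.
have If2 : mu.-integrable `]b, r] (EFin \o f).
  by apply: (integrableS _ _ _ If) => //; exact: subset_itv_oc_cc.
split.
  rewrite integrable_mkcond//.
  rewrite (_ : _ \_ _ = (EFin \o f) \_ `]b, r]); last by rewrite !restrict_EFin pE.
  by rewrite -integrable_mkcond.
rewrite Rintegral_mkcond pE -Rintegral_mkcond.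
rewrite (Rintegral_itv_obnd_cbnd If2).
have lb : ln b <= ln r by rewrite ler_ln ?posrE.
have := @RI_substitution R (ln b) (ln r) f (@expR R) (@expR R) lb.
rewrite !lnK ?posrE// => /(_ br cf (@continuous_expR R) (fun x => is_derive_expR x)).
rewrite /RI => <-; rewrite -[RHS]mul1r -(RI_cst 1 lb).
apply: eq_RI => u /andP[u1 u2].
by rewrite /f max_l ?mulVf ?gt_eqF ?expR_gt0// -[leLHS]lnK ?posrE// ler_expR.
Qed.

Lemma circ_ae_seq (A : seq C) r (P : R -> Prop) : 0 < r ->
  (forall t, 0 <= t <= 2 * pi -> r%:C * cis t \notin A -> P t) ->
  {ae mu, forall t, [set` `[(0 : R), 2 * pi]] t -> P t}.
Proof.
move=> r0 hP; pose F := [set t : R | 0 <= t <= 2 * pi /\ r%:C * cis t \in A].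
have cF : countable F.
  have -> : F = \bigcup_(a in [set` A]) [set t : R | 0 <= t <= 2 * pi /\ r%:C * cis t = a].
    apply/seteqP; split => t /=; last by move=> [a aA [t2 ta]]; split => //; rewrite ta.
    by move=> [t2 tA]; exists (r%:C * cis t).
  apply: bigcup_countable => [|a _]; last exact: circ_fiber_countable.
  exact/finite_set_countable/finite_seq.
exists F; split; [exact: countable_measurable|exact: countable_lebesgue_measure0|].
move=> t /= /not_implyP[t2 nP]; move: t2; rewrite in_itv /= => t2; split => //.
by apply: contrapT => /negP h; apply: nP; exact: hP.
Qed.

End Integrals.

(** * The identity for a fixed radius *)

Section Final.
Context {R : realType} {H : completeNormedModType R[i]}.
Local Notation C := (plane R).
Local Notation nc := (@Normc.normc R).
Local Notation mu := (@lebesgue_measure R).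
Local Notation mR := (measurableTypeR R).
Variables (ip : {dot H for Num.conj}) (T : operator H).
Hypothesis hip : forall x : H, `|x| ^+ 2 = ip x x.
Variables (rho : C -> R) (e0 : C -> H) (V V1 V2 : C -> C -> H).
Hypothesis hV : frame_data ip T rho e0 V V1 V2.
Variable s : C -> H -> C.
Hypothesis hs : Fholomorphic_section ip T setT s.
Local Notation m := (multiplicity ip T s).
Variables (G : C -> C -> C) (eps : C -> R).
Hypothesis hG : forall z0, factor_at rho V s z0 (m z0) (G z0) (eps z0).
Local Notation fv z0 z := (V z0^*%C z^*%C).
Local Notation L := (logpart V G).

Let Fs z : Ffiber ip T z (s z). Proof. by have [_ + _] := hs; apply. Qed.

Let nc_on r (t : R) : 0 < r -> nc (r%:C * cis t) = r.
Proof. by move=> r0; rewrite Normc.normcM ncR nc_cis mulr1 gtr0_norm. Qed.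

Lemma dual_norm_continuous : continuous (fun z => dual_norm ip T z (s z)).
Proof.
move=> z0; have [ep er _ _ sE] := hG z0.
have zz : nc (z0 - z0) < eps z0 by rewrite subrr Normc.normc0.
apply: (@near_continuousC R _ _ (fun z => nc (s z (fv z0 z)) / hn (fv z0 z)) z0 _ ep).
  by move=> w we; rewrite (dual_normE hV (lt_le_trans we er) (Fs w)).
have [e [e_gt0 _ hf _]] := coef_hol hV hs (I : setT z0).
have [l /cdiff_at_cont cf] := hf z0 (ltac:(by rewrite subrr Normc.normc0)).
have c1 : {for z0, continuous (fun z => nc (s z (fv z0 z)))}.
  by apply: (continuous_comp cf); exact: nc_continuous.
have n0 := fnorm_gt0 hV (lt_le_trans zz er).
have cn : {for z0, continuous (fun z : C => hn (fv z0 z))}.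
  have [_ _ dv _ _] := (hV z0^*%C).2 z0^*%C (ltac:(by rewrite subrr Normc.normc0; exact: (hV _).1)).
  have cv := vderiv_continuous dv; have cj := @continuousJ R z0.
  have cvv : fv z0 w @[w --> z0] --> fv z0 z0 by exact: (cvg_comp _ _ cj cv).
  have := cvg_norm cvv => h.
  have h2 := cvg_comp _ _ (h (nbhs_filter z0)) (@continuous_Re R `|fv z0 z0|).
  exact: h2.
have n1 : hn (fv z0 z0) != 0 by rewrite gt_eqF.
exact: (cvgM c1 (cvgV n1 cn)).
Qed.

Variables (r : R) (B : seq C).
Hypothesis r0 : 0 < r.
Hypothesis uB : uniq B.
Hypothesis hB : forall z, z \in B <-> [/\ nc z <= r, m z <> 0%N & z != 0].

(** The origin is listed even when it is not a zero, then with multiplicity 0; this spares a case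
    distinction for the term in [ln r]. *)
Let A := 0 :: B.

Let uA : uniq A.
Proof.
rewrite /A /= uB andbT; apply/negP => /hB[_ _]; by rewrite eqxx.
Qed.

Let cover z : nc z <= r -> [set z | m z = 0%N \/ z \in A] z.
Proof.
move=> zr /=; have [mz|mz] := pselect (m z = 0%N); [by left|right].
have [->|z0] := eqVneq z 0; first exact: mem_head.
by rewrite inE; apply/orP; right; apply/hB.
Qed.

Let A_le a : a \in A -> nc a <= r.
Proof. by rewrite inE => /predU1P[->|/hB[]//]; rewrite Normc.normc0 ltW. Qed.

Let h := reduced_log ip T V s G A.

Let ch : continuous (fun t => h (r%:C * cis t)).
Proof.
move=> t; apply: (@continuous_comp _ _ _ (fun t => r%:C * cis t : C) h).
  by apply: (continuousMC (@continuous_cstC R r%:C) (@cis_continuous R)).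
have [Lp hL] := adapted_smooth hip hV (r%:C * cis t).
have ad : adapted V h (r%:C * cis t).
  by apply: (reduced_adapted hV hs hG uA); apply: cover; rewrite nc_on.
by have [[_ _ _ [] //]] := hL _ ad.
Qed.

(** Off the zeros on the circle, [ln |s|] is half of [h] plus the sum of the [m a * ln |z - a|]. All
    points of [A] satisfy [nc a <= r], so each mean in the sum is [ln r]. *)
Lemma proximity_functionE : proximity_function ip T s r =
  - (4 * pi)^-1 * RI 0 (2 * pi) (fun t => h (r%:C * cis t)) - \sum_(a <- A) (m a)%:R * ln r.
Proof.
pose D : set mR := [set` `[(0 : R), 2 * pi]].
have mD : measurable D by exact: measurable_itv.
pose S t := \sum_(a <- A) (m a)%:R * ln (nc (r%:C * cis t - a)).
pose d t := ln (dual_norm ip T (r%:C * cis t) (s (r%:C * cis t))).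
have [iS eS] : mu.-integrable D (EFin \o S) /\ \int[mu]_(t in D) S t =
    \sum_(a <- A) (m a)%:R * (2 * pi * ln r).
  apply: (sum_integrable (fun a => (m a)%:R) (f := fun a t => ln (nc (r%:C * cis t - a)))) => // a aA.
  have [i1 i2] := log_mean a r0; split; first exact: i1.
  by rewrite -/(RI _ _ _) in i2 *; rewrite i2 max_l ?A_le.
have ih : mu.-integrable D (EFin \o (fun t => 2^-1 * h (r%:C * cis t))).
  by have := integrableZl mD 2^-1 (RI_integrable 0 (2 * pi) ch); congr (mu.-integrable D).
(* The integrands agree only almost everywhere: at a zero on the circle both contain default values
   of [ln]. *)
have E : (\int[mu]_(t in D) (d t)%:E = \int[mu]_(t in D) (2^-1 * h (r%:C * cis t) + S t)%:E)%E.
  apply: ae_eq_integral => //.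
  - apply/measurable_EFinP; apply: (@measurable_funS _ _ _ _ setT) => //.
    apply: measurableT_comp; first exact: measurable_ln.
    apply: continuous_measurable_fun => t.
    apply: (@continuous_comp _ _ _ (fun t => r%:C * cis t : C) (fun z => dual_norm ip T z (s z))).
      by apply: (continuousMC (@continuous_cstC R r%:C) (@cis_continuous R)).
    exact: dual_norm_continuous.
  - have := measurable_int _ (integrableD mD ih iS); congr measurable_fun.
  apply: (circ_ae_seq (A := A) r0) => t t2 tA; congr EFin.
  set z := r%:C * cis t.
  have mz : m z = 0%N by have [//|zA] := cover (z := z) (ltac:(by rewrite nc_on)); rewrite zA in tA.
  have dp := dual_norm_gt0 hV hs hG mz.
  rewrite /d /h /reduced_log (logpart_dual_norm hV hs hG mz) lnXn// -/z.
  have -> : \sum_(a <- A | a != z) (m a)%:R * ln (nc (z - a) ^+ 2) = 2 * S t.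
    rewrite /S mulr_sumr big_seq_cond [RHS]big_seq; apply: congr_big => // a.
      by apply: andb_idr => aA; apply: contra tA => /eqP az; rewrite -/z -az.
    move=> /andP[aA az]; rewrite lnXn ?nc_gt0 ?subr_eq0 1?eq_sym//.
    by rewrite -/z -mulr_natl; ring.
  by rewrite -mulr_natl; field.
have -> : proximity_function ip T s r = - ((2 * pi)^-1 * \int[mu]_(t in D) d t).
  rewrite /proximity_function; congr (- (_ * _)); apply: eq_Rintegral => t _ /=.
  have -> : (r * cos t) +i* (r * sin t) = r%:C * cis t :> C.
    by apply/eqP; rewrite eq_complex /= !mul0r subr0 addr0 !eqxx.
  by [].
have -> : \int[mu]_(t in D) d t = \int[mu]_(t in D) (2^-1 * h (r%:C * cis t) + S t).
  by rewrite /Rintegral E.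
rewrite RintegralD// eS.
have -> : \int[mu]_(t in D) (2^-1 * h (r%:C * cis t)) = 2^-1 * RI 0 (2 * pi) (fun t => h (r%:C * cis t)).
  by rewrite -(RI_scale _ _ _ ch).
have -> : \sum_(a <- A) (m a)%:R * (2 * pi * ln r) = 2 * pi * \sum_(a <- A) (m a)%:R * ln r.
  by rewrite mulr_sumr; apply: eq_bigr => a _; ring.
have p0 : pi != 0 :> R by rewrite gt_eqF// pi_gt0.
by move: (RI _ _ _) (\sum_(_ <- _) _) => x y; move: (@pi R) p0 => q q0; field.
Qed.

Lemma zero_countE t : 0 < t -> t <= r ->
  zero_count ip T s t = (m 0)%:R + \sum_(a <- B) (m a)%:R * (nc a < t)%R%:R.
Proof.
move=> t0 tr; rewrite /zero_count.
rewrite (fsbigE [seq a <- A | nc a < t]).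
- have dE a : (a \in (disk t : set C)) = (nc a < t) by apply/idP/idP; rewrite inE.
  rewrite big_filter_cond big_mkcond /= /A big_cons dE andbb Normc.normc0 t0.
  congr (_ + _); apply: eq_bigr => a _; rewrite dE andbb.
  by case: ifPn => _; rewrite ?mulr1 ?mulr0.
- by rewrite filter_uniq.
- by move=> z; rewrite /mkset mem_filter => /andP[].
move=> z zt; rewrite mem_filter negb_and zt /= => zA.
have [->//|zA'] := cover (ltW (lt_le_trans zt tr)).
by rewrite zA' in zA.
Qed.

(** With the multiplicity at 0 subtracted, only zeros with [nc a > 0] are left under the integral,
    and [counting_kernel] applies to each. *)
Lemma counting_functionE : counting_function ip T s r =
  \sum_(a <- B) (m a)%:R * (ln r - ln (nc a)) + (m 0)%:R * ln r.
Proof.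
rewrite /counting_function; congr (_ + _).
have [|_ <-] := @sum_integrable R C B (`]0, r]) (fun a => (m a)%:R)
    (fun a t => (nc a < t)%R%:R / t) (fun a => ln r - ln (nc a)) (measurable_itv _).
  move=> a /hB[ar _ a0]; apply: counting_kernel => //.
  by rewrite nc_gt0.
apply: eq_Rintegral => t; rewrite inE /= in_itv /= => /andP[t0 tr].
rewrite zero_countE// addrAC subrr add0r mulr_suml.
by apply: eq_bigr => a _; rewrite mulrA.
Qed.

(** The circle means of [h] cancel, as do the terms [m a * ln r]. The logarithms of [nc a] in [h 0]
    match those of the counting function, so what remains depends neither on [r] nor on [B]. *)
Lemma first_main_identity : characteristic_function ip T r -
  (proximity_function ip T s r + counting_function ip T s r) = L 0 / 2.
Proof.
rewrite (characteristic_functionE hip hV hs hG uA r0 cover) proximity_functionE counting_functionE.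
rewrite -/h; have -> : h 0 = L 0 - 2 * \sum_(a <- B) (m a)%:R * ln (nc a).
  rewrite /h /reduced_log /A big_cons eqxx /= mulr_sumr; congr (_ - _).
  rewrite big_seq_cond [RHS]big_seq; apply: congr_big => // a.
    by apply: andb_idr => /hB[_ _].
  move=> /andP[_ a0]; rewrite sub0r ncN lnXn ?nc_gt0// -mulr_natl; ring.
rewrite /A big_cons.
have -> : \sum_(a <- B) (m a)%:R * (ln r - ln (nc a)) =
   \sum_(a <- B) (m a)%:R * ln r - \sum_(a <- B) (m a)%:R * ln (nc a).
  by rewrite -sumrB; apply: eq_bigr => a _; rewrite mulrBr.
move: (- (4 * pi)^-1 * _) (\sum_(_ <- _) _) (\sum_(_ <- _) _) => x y z.
by field.
Qed.

End Final.

Theorem proposition7p3 (R : realType) (H : completeNormedModType R[i])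
    (ip : {dot H for Num.conj}) (hH : separable_hilbert ip)
    (T : operator H) (hT : entire_operator11 ip T)
    (s : plane R -> H -> plane R) (hs : Fholomorphic_section ip T setT s)
    (hs0 : exists z, nonvanishing_at s z) :
  exists M : R, \forall r \near +oo,
    `|characteristic_function ip T r
      - (proximity_function ip T s r + counting_function ip T s r)| <= M.
Proof.
have [hip _ _] := hH.
have [z1 [x sx]] := hs0.
have Fs z : Ffiber ip T z (s z) by have [_ + _] := hs; apply.
(* The value of [s] at [z1] vanishes off the fibre, so [x] is a nonzero vector of the fibre at
   [conj z1]; from it the nontriviality of all fibres is propagated. *)
have Ex : Efiber ip T z1^*%C x.
  by apply: contrapT => nE; rewrite (Fs z1).2// eqxx in sx.
have x0 : x != 0.
  apply: contraNneq sx => x0; have := Ffiber_scale 0 (Fs z1) Ex.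
  by rewrite scale0r conjc0 mul0r x0 => ->.
have [rho [e0 [V [V1 [V2 hV]]]]] := exists_frame_data hip hT Ex x0.
have [G [eps hG]] := order_data hip hV hs hs0.
(* The difference is the same constant for every [r > 0], hence this bound. *)
exists `|logpart V G 0 / 2|; near=> r.
have r0 : 0 < r by near: r; exact: nbhs_pinfty_gt.
have : finite_set [set z : plane R | Normc.normc z <= r /\ (multiplicity ip T s z <> 0%N /\ z != 0)].
  apply: isolated_finite => z0; exists (eps z0); first exact: (eps_gt0 hG).
  by move=> z ze zz [+ _]; rewrite (mult_isolated hV hs hG ze zz).
move=> /finite_seqP[B0 hB0].
rewrite (@first_main_identity _ _ ip T hip rho e0 V V1 V2 hV s hs G eps hG r (undup B0) r0 (undup_uniq _))//.
move=> z; rewrite mem_undup.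
have -> : z \in B0 = [set` B0] z :> Prop by [].
rewrite -hB0 /=; split=> [[? [? ?]]|[? ? ?]]; by do ?split.
Unshelve. all: by end_near. Qed.
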